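(* Let $\Gamma\subset\mathbb{C}$ be a lattice, and let $\nu$, $\mu$, $\chi_W$, $P_r$, $\mathscr{H}_r(\Gamma)$, $\sigma(\cdot;\Gamma)$ and its Taylor coefficients $\mathscr{W}_r(\Gamma)$ be as defined in the context. Then $\mathscr{H}_0(\Gamma)\neq 0$ and the following hold. (i) For every $z\in\mathbb{C}$, $$\sigma(z;\Gamma)=\frac{1}{\mathscr{H}_0(\Gamma)}\,e^{\frac{\mu}{2}z^2}\sum_{\gamma\in\Gamma}\chi_W(\gamma)\,\gamma\, e^{-\frac{\nu}{2}|\gamma|^2+\nu z\overline{\gamma}}.$$ (ii) For every $z\in\mathbb{C}$, $$\sigma(z;\Gamma)=\frac{\nu}{\pi}\,e^{\frac{\mu}{2}z^2}\int_{\mathbb{C}}e^{\nu z\overline{w}-\frac{\mu}{2}w^2-\nu|w|^2}\,\sigma(w;\Gamma)\,dm(w),$$ where $dm$ is Lebesgue measure on $\mathbb{C}$. (iii) For every integer $r\ge 0$, $$\mathscr{W}_r(\Gamma)=\frac{\mathscr{H}_r(\Gamma)}{\mathscr{H}_0(\Gamma)}.$$ (iv) For every integer $r\ge 0$, $$\mathscr{W}_r(\Gamma)=\frac{\nu^2}{\pi}\,\frac{(2r+1)!}{2^r\, r!}\int_{\mathbb{C}}\overline{w}\;P_r(w)\,e^{-\frac{\mu}{2}w^2-\nu|w|^2}\,\sigma(w;\Gamma)\,dm(w).$$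
   Context: Let $\Gamma=\mathbb{Z}\omega_1+\mathbb{Z}\omega_2$ be a lattice in $\mathbb{C}$, where $\{\omega_1,\omega_2\}$ is an oriented $\mathbb{R}$-basis of $\mathbb{C}$, i.e. $S_\Gamma:=\operatorname{Im}(\overline{\omega_1}\omega_2)>0$ ($S_\Gamma$ is the area of a fundamental cell). The Weierstrass sigma-function is $\sigma(z;\Gamma)=z\prod_{\gamma\in\Gamma\setminus\{0\}}\left(1-\frac{z}{\gamma}\right)e^{\frac{z}{\gamma}+\frac12\left(\frac{z}{\gamma}\right)^2}$; it is an odd entire function, and its Taylor coefficients $\mathscr{W}_r(\Gamma)$ are defined by $\sigma(z;\Gamma)=\sum_{r=0}^\infty \mathscr{W}_r(\Gamma)\frac{z^{2r+1}}{(2r+1)!}$. The Weierstrass zeta-function is $\zeta(z;\Gamma)=\sigma'(z;\Gamma)/\sigma(z;\Gamma)$. Set $$\nu=\frac{\pi}{S_\Gamma},\qquad \mu=\frac{i}{S_\Gamma}\left(\zeta\!\left(\tfrac{\omega_1}{2};\Gamma\right)\overline{\omega_2}-\zeta\!\left(\tfrac{\omega_2}{2};\Gamma\right)\overline{\omega_1}\right).$$ The Weierstrass semi-character $\chi_W:\Gamma\to\{\pm1\}$ is $\chi_W(\gamma)=+1$ if $\gamma/2\in\Gamma$ and $\chi_W(\gamma)=-1$ if $\gamma/2\notin\Gamma$. Let ${\bf F}(a;c;x)=\sum_{k\ge0}\frac{(a)_k}{(c)_k}\frac{x^k}{k!}$ be the confluent hypergeometric function. For an integer $r\ge 0$ and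 $w\in\mathbb{C}$ put $$P_r(w)=\mu^r\,{\bf F}\!\left(-r;\tfrac32;-\frac{\nu^2\overline{w}^2}{2\mu}\right)=\sum_{k=0}^r\frac{(-r)_k}{(3/2)_k\,k!}\left(-\frac{\nu^2\overline{w}^2}{2}\right)^k\mu^{r-k},$$ the last (polynomial) expression being the meaning also when $\mu=0$. The Hermite-Gauss series of order $r$ is $$\mathscr{H}_r(\Gamma)=\nu\,\frac{(2r+1)!}{2^r\,r!}\sum_{\gamma\in\Gamma}P_r(\gamma)\,\chi_W(\gamma)\,|\gamma|^2e^{-\frac{\nu}{2}|\gamma|^2};$$ in particular $\mathscr{H}_0(\Gamma)=\nu\sum_{\gamma\in\Gamma}\chi_W(\gamma)|\gamma|^2e^{-\frac{\nu}{2}|\gamma|^2}$. *)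

(* Defs.v *)
From HB Require Import structures.
From mathcomp Require Import all_boot all_order all_algebra finmap.
From mathcomp Require Import complex.
From mathcomp Require Import all_classical all_reals all_analysis.
From mathcomp Require Import summability.

Set Implicit Arguments.
Unset Strict Implicit.
Unset Printing Implicit Defensive.

Import Order.TTheory GRing.Theory Num.Theory numFieldNormedType.Exports.

Local Open Scope classical_set_scope.
Local Open Scope ring_scope.
Local Open Scope complex_scope.

(* The usual topology and norm of the complex numbers: [R[i]] becomes a normed
   module over itself, so that [derive1] is the complex derivative. *)
Section complex_normedtype.
Variable R : realType.

HB.instance Definition _ := PseudoPointedMetric.copy R[i] R[i]^o.
HB.instance Definition _ := GRing.ComAlgebra.copy R[i] R[i]^o.
HB.instance Definition _ := Vector.copy R[i] R[i]^o.
HB.instance Definition _ := NormedModule.copy R[i] R[i]^o.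

End complex_normedtype.

Section complex_analysis.
Variable R : realType.
Local Notation C := R[i].

Definition cexp (z : C) : C :=
  (expR (complex.Re z))%:C * (cos (complex.Im z) +i* sin (complex.Im z)).

(* Unconditional sums and products over a set [D] of complex numbers: limits
   along the directed set of all finite sets of complex numbers, only the
   indices in [D] being counted.  Over [C], unconditional convergence of a sum
   is the same as absolute convergence. *)
Definition set_psum (D : set C) (f : C -> C) (A : {fset C}) : C :=
  \sum_(g <- A | g \in D) f g.

Definition set_summable (D : set C) (f : C -> C) : Prop :=
  cvg (set_psum D f @ totally).

Definition set_sum (D : set C) (f : C -> C) : C :=
  lim (set_psum D f @ totally).

Definition set_pprod (D : set C) (f : C -> C) (A : {fset C}) : C :=
  \prod_(g <- A | g \in D) f g.

Definition set_prod (D : set C) (f : C -> C) : C :=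
  lim (set_pprod D f @ totally).

(* Lebesgue measure on [C], transported to [R * R] by [w = x + i y]. *)
Definition leb2 :
    {measure set (measurableTypeR R * measurableTypeR R) -> \bar R} :=
  (lebesgue_measure \x lebesgue_measure)%E.

Definition cintegrable (f : C -> C) : Prop :=
  leb2.-integrable setT (fun p => (complex.Re (f (p.1 +i* p.2)))%:E) /\
  leb2.-integrable setT (fun p => (complex.Im (f (p.1 +i* p.2)))%:E).

Definition cintegral (f : C -> C) : C :=
  Rintegral leb2 setT (fun p => complex.Re (f (p.1 +i* p.2))) +i*
  Rintegral leb2 setT (fun p => complex.Im (f (p.1 +i* p.2))).

Definition pochhammer (a : C) (k : nat) : C := \prod_(i < k) (a + i%:R).

End complex_analysis.

Section weierstrass.
Variable R : realType.
Local Notation C := R[i].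

Definition lattice (w1 w2 : C) : set C :=
  [set g | exists m n : int, g = m%:~R * w1 + n%:~R * w2].

Definition cell_area (w1 w2 : C) : R := complex.Im (w1^* * w2).

Definition wsigma (G : set C) (z : C) : C :=
  z * set_prod (G `\ 0)
        (fun g => (1 - z / g) * cexp (z / g + 2^-1 * (z / g) ^+ 2)).

(* The sequence [W] with
   [sigma z = \sum_r W r * z ^ (2 r + 1) / (2 r + 1)!] for all [z]. *)
Definition wcoef (G : set C) : nat -> C :=
  get [set W : nat -> C | forall z : C,
    series (fun r => W r * (z ^+ r.*2.+1 / (r.*2.+1)`!%:R)) @ \oo
      --> wsigma G z].

Definition wzeta (G : set C) (z : C) : C :=
  derive1 (wsigma G) z / wsigma G z.

Definition wchi (G : set C) (g : C) : C := if g / 2 \in G then 1 else -1.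

Definition wnu (w1 w2 : C) : C := (pi / cell_area w1 w2)%:C.

Definition wmu (w1 w2 : C) : C :=
  let G := lattice w1 w2 in
  'i / (cell_area w1 w2)%:C *
    (wzeta G (w1 / 2) * w2^* - wzeta G (w2 / 2) * w1^*).

Definition hgP (w1 w2 : C) (r : nat) (w : C) : C :=
  \sum_(k < r.+1)
    pochhammer (- r%:R) k / (pochhammer (3 / 2) k * k`!%:R) *
    (- (wnu w1 w2 ^+ 2 * w^* ^+ 2 / 2)) ^+ k * wmu w1 w2 ^+ (r - k).

Definition hgterm (w1 w2 : C) (r : nat) (g : C) : C :=
  hgP w1 w2 r g * wchi (lattice w1 w2) g * `|g| ^+ 2 *
    cexp (- (wnu w1 w2 / 2 * `|g| ^+ 2)).

Definition hgseries (w1 w2 : C) (r : nat) : C :=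
  wnu w1 w2 * ((r.*2.+1)`!%:R / (2 ^+ r * r`!%:R)) *
    set_sum (lattice w1 w2) (hgterm w1 w2 r).

End weierstrass.

(* Main.v *)
Require Import Defs.
From HB Require Import structures.
From mathcomp Require Import all_boot all_order all_algebra finmap.
From mathcomp Require Import complex ring lra zify.
From mathcomp Require Import all_classical all_reals all_analysis.
From mathcomp Require Import summability measurable_realfun.

Set Implicit Arguments.
Unset Strict Implicit.
Unset Printing Implicit Defensive.

Import Order.TTheory GRing.Theory Num.Theory numFieldNormedType.Exports.

Local Open Scope classical_set_scope.
Local Open Scope ring_scope.
Local Open Scope complex_scope.

(**
  Write [F z = exp (- mu / 2 * z ^ 2) * sigma z].  Comparing products over boxes
  of the lattice shifted by a half period shows that [sigma] is quasi-periodic,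
  and the choice of [mu] makes [F] satisfy
  [F (z + w) = - exp (k * nu * conj w * (z + w / 2)) * F z] for both periods [w],
  with an integer [k].  An entire function [f] obeying this law with [k = 1] and
  vanishing at [0] is a multiple of [F]: the modulus of [f ^ k / F] (or of a
  similar quotient) descends to the torus and attains its maximum.

  The two-variable series
  [P b z = \sum_g chi g * exp (- nu / 2 * |g| ^ 2 + nu * z * conj g - nu * b * g)]
  satisfies the law in [z], up to the factor [exp (nu * z * b)], and vanishes at
  [z = 0] and at [b = 0] by parity; hence it is
  [kap * exp (- nu * z * b) * F z * conj (F (conj b))].  It is not identically
  zero, and its first order term in [b] says that the theta series is a multiple
  of [F].  This gives (i), the constant being read off the first Taylor
  coefficient in [z]; the other coefficients give (iii).

  Consequently [k = 1] and [F] is [O (exp (nu / 2 * |w| ^ 2))], so that it is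
  reproduced by the Gaussian kernel of Fock space, which is (ii); the Taylor
  coefficients in [z] of the reproducing formula give (iv).
*)

(** * The real-valued modulus *)

(** Neither contour integrals nor counts of zeros occur. Classically Legendre's relation and the
    dimension of a space of theta functions come from the residue theorem; here commuting two
    translations only gives [exp (eta1 * w2 - eta2 * w1) = 1], hence an integer [k] of unknown value
    and sign. Passing from sigma to [F] leaves a multiplier built from [nu] and [conj w] alone, so
    that [|F z| * exp (- k * nu / 2 * |z| ^ 2)] is doubly periodic; such weights add under products,
    and powers are inserted to make the weights of numerator and denominator agree whatever [k] is.
    The second obstacle is that the theta series of (i) might vanish identically: being holomorphic
    in [z], it is not a Fourier series on the torus from which coefficients could be read. The extra
    variable [b] cures this, because for [b = conj z] every term is a unitary character times a
    nonzero constant. The factorization of [P] carries the nonvanishing over to [kap], and the law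
    of [P], whose multiplier is known explicitly, carries the value [k = 1] over to [F]. *)

Section modulus.
Variable R : realType.
Local Notation C := R[i].
Implicit Types (x y z w : C) (e : R).

(** The norm of [R[i]] takes values in [R[i]], which is only partially ordered; moving it to [R]
    makes suprema and real arithmetic available. *)
Definition nm z : R := complex.Re `|z|.

Lemma nmE z : `|z| = (nm z)%:C.
Proof. by rewrite /nm normc_def; reflexivity. Qed.

Lemma nm_ge0 z : 0 <= nm z.
Proof. by rewrite -lecR -nmE normr_ge0. Qed.

Lemma nm0 : nm 0 = 0.
Proof. by apply: complexI; rewrite -nmE normr0. Qed.

Lemma nm1 : nm 1 = 1.
Proof. by apply: complexI; rewrite -nmE normr1. Qed.

Lemma nm_eq0 z : (nm z == 0) = (z == 0).
Proof. by rewrite -(normr_eq0 z) nmE (inj_eq (@complexI R)). Qed.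

Lemma nm_gt0 z : (0 < nm z) = (z != 0).
Proof. by rewrite lt_def nm_ge0 andbT nm_eq0. Qed.

Lemma nmD x y : nm (x + y) <= nm x + nm y.
Proof. by rewrite -lecR rmorphD /= -!nmE ler_normD. Qed.

Lemma nmM x y : nm (x * y) = nm x * nm y.
Proof. by apply: complexI; rewrite rmorphM /= -!nmE normrM. Qed.

Lemma nmN x : nm (- x) = nm x.
Proof. by apply: complexI; rewrite -!nmE normrN. Qed.

Lemma nmB x y : nm (x - y) = nm (y - x).
Proof. by rewrite -nmN opprB. Qed.

Lemma nmV x : nm x^-1 = (nm x)^-1.
Proof. by apply: complexI; rewrite fmorphV /= -!nmE normfV. Qed.

Lemma nmX x n : nm (x ^+ n) = nm x ^+ n.
Proof. by apply: complexI; rewrite rmorphXn /= -!nmE normrX. Qed.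

Lemma nm_conj x : nm x^* = nm x.
Proof. by apply: complexI; rewrite -!nmE normcJ. Qed.

Lemma nm_real e : nm e%:C = `|e|.
Proof. by rewrite /nm normc_def /= expr0n addr0 sqrtr_sqr. Qed.

Lemma nm_nat n : nm n%:R = n%:R.
Proof. by rewrite /nm normr_nat -[n%:R]/((n%:R : C)) -(rmorph_nat (real_complex R)). Qed.

Lemma nm_sqr z : nm z ^+ 2 = complex.Re z ^+ 2 + complex.Im z ^+ 2.
Proof. by apply: complexI; rewrite add_Re2_Im2 rmorphXn /= -nmE. Qed.

Lemma nm_Re z : `|complex.Re z| <= nm z.
Proof.
by rewrite -(ler_pXn2r (n := 2)) ?nnegrE ?nm_ge0// nm_sqr real_normK ?num_real// lerDl sqr_ge0.
Qed.

Lemma nm_Im z : `|complex.Im z| <= nm z.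
Proof.
by rewrite -(ler_pXn2r (n := 2)) ?nnegrE ?nm_ge0// nm_sqr real_normK ?num_real// lerDr sqr_ge0.
Qed.

Lemma nm_i : nm 'i = 1.
Proof. by rewrite /nm normc_def /= expr0n add0r expr1n sqrtr1. Qed.

Lemma nm_le_ReIm z : nm z <= `|complex.Re z| + `|complex.Im z|.
Proof.
rewrite [z in nm z]complexE; apply: (le_trans (nmD _ _)).
by rewrite nmM nm_i mul1r !nm_real.
Qed.

Lemma nm_triB x y : nm x - nm y <= nm (x - y).
Proof. by rewrite lerBlDr -{1}(subrK y x) nmD. Qed.

Lemma nm_dist x y : `|nm x - nm y| <= nm (x - y).
Proof. by rewrite ler_norml nm_triB andbT lerNl opprB nmB nm_triB. Qed.

Lemma nm_sum (I : Type) (s : seq I) (P : pred I) (F : I -> C) :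
  nm (\sum_(i <- s | P i) F i) <= \sum_(i <- s | P i) nm (F i).
Proof.
elim/big_rec2: _ => [|i u v _ h]; first by rewrite nm0.
by apply: (le_trans (nmD _ _)); rewrite lerD2l.
Qed.

Lemma ReD x y : complex.Re (x + y) = complex.Re x + complex.Re y.
Proof. by case: x y => [? ?] [? ?]. Qed.
Lemma ImD x y : complex.Im (x + y) = complex.Im x + complex.Im y.
Proof. by case: x y => [? ?] [? ?]. Qed.
Lemma ReN x : complex.Re (- x) = - complex.Re x.
Proof. by case: x => [? ?]. Qed.
Lemma ImN x : complex.Im (- x) = - complex.Im x.
Proof. by case: x => [? ?]. Qed.
Lemma ReM x y : complex.Re (x * y) =
  complex.Re x * complex.Re y - complex.Im x * complex.Im y.
Proof. by case: x y => [? ?] [? ?]. Qed.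
Lemma ImM x y : complex.Im (x * y) =
  complex.Re x * complex.Im y + complex.Im x * complex.Re y.
Proof. by case: x y => [? ?] [? ?]. Qed.
Lemma Re_conj x : complex.Re x^* = complex.Re x.
Proof. by case: x. Qed.
Lemma Im_conj x : complex.Im x^* = - complex.Im x.
Proof. by case: x. Qed.

Lemma complex_eq x y : complex.Re x = complex.Re y ->
  complex.Im x = complex.Im y -> x = y.
Proof. by case: x y => [? ?] [? ?] /= -> ->. Qed.

Lemma nm_eps x y : (forall e, 0 < e -> nm (x - y) <= e) -> x = y.
Proof.
move=> h; apply/eqP; rewrite -subr_eq0 -nm_eq0; case: eqP => // /eqP n0.
have n1 : 0 < nm (x - y) / 2 by rewrite divr_gt0 // lt_def nm_ge0 n0.
have := h _ n1; lra.
Qed.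

Lemma cvgC (T : Type) (F : set_system T) {FF : Filter F} (f : T -> C) (l : C) :
  f @ F --> l <-> forall e, 0 < e -> \forall t \near F, nm (f t - l) < e.
Proof.
split=> [/cvgrPdist_lt h e e0|h].
  have := h e%:C; rewrite ltcR => /(_ e0); apply: filterS => t.
  by rewrite nmE ltcR nmB.
(* A positive [e] of [R[i]] has imaginary part 0, so complex tolerances reduce to real ones. *)
apply/cvgrPdist_lt => e; rewrite ltcE => /andP[/eqP i0 r0].
have -> : e = (complex.Re e)%:C by apply: complex_eq.
apply: filterS (h _ r0) => t.
by rewrite nmE ltcR nmB.
Qed.

End modulus.

(** * Unconditional sums and products *)

Section nets.
Variable R : realType.
Local Notation C := R[i].
Implicit Types (D : set C) (f : C -> C) (a : C -> R) (A : {fset C}) (e : R) (u v : {fset C} -> C) (l m s c : C).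

#[local] Instance totally_proper : ProperFilter (@totally C) := totally_filter.

Definition tends (u : {fset C} -> C) (l : C) :=
  forall e, 0 < e -> exists A0, forall A, fsubset A0 A -> nm (u A - l) < e.

Lemma tendsP u l : tends u l <-> u @ totally --> l.
Proof.
split=> [h|/(proj1 (cvgC _ _)) h].
  apply: (proj2 (cvgC _ _)) => e e0; have [A0 hA0] := h e e0.
  by exists A0 => // A /= /hA0.
by move=> e e0; have [A0 _ hA0] := h e e0; exists A0 => A /hA0.
Qed.

Lemma tends_uniq u l l' : tends u l -> tends u l' -> l = l'.
Proof.
move=> h h'; apply: nm_eps => e e0.
have e20 : 0 < e / 2 by lra.
have [A hA] := h _ e20; have [B hB] := h' _ e20.
have := hA (fsetU A B) (fsubsetUl _ _); have := hB (fsetU A B) (fsubsetUr _ _).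
have -> : l - l' = (l - u (fsetU A B)) + (u (fsetU A B) - l') by ring.
move=> h1 h2.
apply: (le_trans (nmD _ _)); rewrite (nmB l); lra.
Qed.

Lemma tends_lim u l : tends u l -> lim (u @ totally) = l.
Proof. by move/tendsP => h; apply: cvg_lim => //; exact: norm_hausdorff. Qed.

Lemma tends_cvg u l : tends u l -> cvg (u @ totally).
Proof. by move/tendsP => /cvgP. Qed.

Lemma tends_le u l l' A0 e : tends u l ->
  (forall A, fsubset A0 A -> nm (u A - l') <= e) -> nm (l - l') <= e.
Proof.
move=> h h'; apply/ler_addgt0Pr => d d0.
have [A hA] := h _ d0.
have := hA (fsetU A A0) (fsubsetUl _ _); have := h' (fsetU A A0) (fsubsetUr _ _).
have -> : l - l' = (l - u (fsetU A A0)) + (u (fsetU A A0) - l') by ring.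
move=> h1 h2; apply: (le_trans (nmD _ _)); rewrite (nmB l); lra.
Qed.

(** Real and imaginary part are 1-Lipschitz for [nm], so the completeness of [R] applies to each of
    them. *)
Lemma cauchyC (T : Type) (F : set_system T) {FF : ProperFilter F} (w : T -> C) :
  (forall e, 0 < e -> exists c, \forall t \near F, nm (w t - c) <= e) ->
  exists l, w @ F --> l.
Proof.
move=> h.
have key (p : C -> R) : (forall x y, `|p x - p y| <= nm (x - y)) -> cvg ((p \o w) @ F).
  move=> hp; apply: (@cauchy_cvg R); apply/cauchy_exP => e e0.
  have e20 : 0 < e / 2 by lra.
  have [c hc] := h _ e20; exists (p c).
  apply: filterS hc => t ht; rewrite /ball /= distrC.
  by apply: le_lt_trans (hp _ _) _; lra.
have hr : cvg (((fun z : C => complex.Re z) \o w) @ F).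
  by apply: key => x y; rewrite -ReN -ReD nm_Re.
have hi : cvg (((fun z : C => complex.Im z) \o w) @ F).
  by apply: key => x y; rewrite -ImN -ImD nm_Im.
exists (lim (((fun z : C => complex.Re z) \o w) @ F) +i*
        lim (((fun z : C => complex.Im z) \o w) @ F)).
apply: (proj2 (cvgC _ _)) => e e0.
have e20 : 0 < e / 2 by lra.
move/cvgrPdist_lt/(_ _ e20) : hr => hr; move/cvgrPdist_lt/(_ _ e20) : hi => hi.
near=> t.
have h1 : `|lim (((fun z : C => complex.Re z) \o w) @ F) - complex.Re (w t)| < e / 2 by near: t.
have h2 : `|lim (((fun z : C => complex.Im z) \o w) @ F) - complex.Im (w t)| < e / 2 by near: t.
rewrite distrC in h1; rewrite distrC in h2.
by apply: (le_lt_trans (nm_le_ReIm _)); rewrite ReD ImD ReN ImN /=; lra.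
Unshelve. all: by end_near. Qed.

Lemma tends_complete u :
  (forall e, 0 < e -> exists A0, forall A, fsubset A0 A -> nm (u A - u A0) <= e) ->
  exists l, tends u l.
Proof.
move=> h; have [e e0|l hl] := @cauchyC _ (@totally C) _ u.
  by have [A0 hA0] := h e e0; exists (u A0), A0 => // A /hA0.
by exists l; exact/tendsP.
Qed.

Lemma tendsD u v l m : tends u l -> tends v m -> tends (fun A => u A + v A) (l + m).
Proof.
move=> h h' e e0.
have e20 : 0 < e / 2 by lra.
have [A hA] := h _ e20; have [B hB] := h' _ e20.
exists (fsetU A B) => E; rewrite fsubUset => /andP[/hA h1 /hB h2].
have -> : u E + v E - (l + m) = (u E - l) + (v E - m) by ring.
by apply: (le_lt_trans (nmD _ _)); lra.
Qed.

Lemma tendsZ c u l : tends u l -> tends (fun A => c * u A) (c * l).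
Proof.
move=> h e e0.
have c0 : 0 < nm c + 1 by rewrite ltr_pwDr ?nm_ge0.
have [A hA] := h _ (divr_gt0 e0 c0).
exists A => E /hA; rewrite -mulrBr nmM ltr_pdivlMr// mulrC; apply: le_lt_trans.
by rewrite ler_wpM2r ?nm_ge0// lerDl.
Qed.

Lemma tends_conj u l : tends u l -> tends (fun A => (u A)^*) l^*.
Proof.
move=> h e e0; have [A hA] := h _ e0.
by exists A => E /hA; rewrite -rmorphB /= nm_conj.
Qed.

Lemma tends_ext u v l : u =1 v -> tends u l -> tends v l.
Proof. by move=> /funext ->. Qed.

Lemma tends_cst l : tends (fun=> l) l.
Proof. by move=> e e0; exists fset0 => A _; rewrite subrr nm0. Qed.

Definition has_sum D f s := tends (set_psum D f) s.

Definition has_prod D f s := tends (set_pprod D f) s.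

Lemma set_sumE D f s : has_sum D f s -> set_sum D f = s.
Proof. exact: tends_lim. Qed.

Lemma has_sum_summable D f s : has_sum D f s -> set_summable D f.
Proof. exact: tends_cvg. Qed.

Lemma has_sum_uniq D f s s' : has_sum D f s -> has_sum D f s' -> s = s'.
Proof. exact: tends_uniq. Qed.

Lemma eq_has_sum D f f' s : (forall g, D g -> f g = f' g) ->
  has_sum D f s -> has_sum D f' s.
Proof.
move=> h; apply: tends_ext => A; apply: eq_bigr => g /set_mem; exact: h.
Qed.

Lemma has_sumD D f f' s s' : has_sum D f s -> has_sum D f' s' ->
  has_sum D (fun g => f g + f' g) (s + s').
Proof.
move=> h h'; apply: tends_ext (tendsD h h') => A.
by rewrite /set_psum big_split.
Qed.

Lemma has_sumZ D c f s : has_sum D f s -> has_sum D (fun g => c * f g) (c * s).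
Proof.
move=> h; apply: tends_ext (tendsZ c h) => A.
by rewrite /set_psum big_distrr.
Qed.

Lemma has_sum_conj D f s : has_sum D f s -> has_sum D (fun g => (f g)^*) s^*.
Proof.
move=> h; apply: tends_ext (tends_conj h) => A.
by rewrite /set_psum rmorph_sum.
Qed.

Lemma has_sum0 D : has_sum D (fun=> 0) 0.
Proof. by apply: tends_ext (tends_cst 0) => A; rewrite /set_psum big1. Qed.

Lemma has_sum_sum (I : Type) (r : seq I) D (f : I -> C -> C) (s : I -> C) :
  (forall i, has_sum D (f i) (s i)) ->
  has_sum D (fun g => \sum_(i <- r) f i g) (\sum_(i <- r) s i).
Proof.
move=> h; elim: r => [|i r ih].
  by rewrite big_nil; apply: eq_has_sum (has_sum0 D) => g _; rewrite big_nil.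
rewrite big_cons; apply: eq_has_sum (has_sumD (h i) ih) => g _.
by rewrite big_cons.
Qed.

Lemma has_sum_reindex D f s (p q : C -> C) : cancel p q -> cancel q p ->
  (forall g, D (p g) <-> D g) -> has_sum D f s -> has_sum D (f \o p) s.
Proof.
move=> pq qp hD h e e0; have [A0 hA0] := h e e0.
exists (q @` A0)%fset => A hA.
have -> : set_psum D (f \o p) A = set_psum D f (p @` A)%fset.
  rewrite /set_psum [LHS]big_mkcond [RHS]big_mkcond big_imfset /=.
    apply: eq_bigr => g _; congr (if _ then _ else _).
    by apply/idP/idP => /set_mem /hD /mem_set.
  by move=> ? ? _ _ /(can_inj pq).
apply: hA0; apply/fsubsetP => g gA0.
rewrite -(qp g); apply: in_imfset; apply: (fsubsetP hA).
exact: in_imfset.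
Qed.

Lemma fset_perm A0 A : fsubset A0 A -> perm_eq A (A0 ++ (fsetD A A0)).
Proof.
move=> h; apply: uniq_perm.
- exact: fset_uniq.
- rewrite cat_uniq !fset_uniq /= andbT; apply/hasPn => g /=.
  by rewrite !inE => /andP[].
- move=> g; rewrite mem_cat !inE; case: (boolP (g \in A0)) => //= /(fsubsetP h) //.
Qed.

Definition bounded_sums D a M := forall A, \sum_(g <- A | g \in D) a g <= M.

Definition small_tail D a e A0 :=
  forall A, fdisjoint A A0 -> \sum_(g <- A | g \in D) a g <= e.

Lemma fdisj_setD A A0 : fdisjoint (fsetD A A0) A0.
Proof. by apply/fdisjointP => g; rewrite inE => /andP[]. Qed.

(** Take [A0] whose partial sum is within [e] of the supremum of all partial sums; a set disjoint
    from [A0] can add at most [e]. *)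
Lemma small_tail_exists D a M e : bounded_sums D a M -> 0 < e -> exists A0, small_tail D a e A0.
Proof.
move=> hM e0.
pose E := [set x | exists A, x = \sum_(g <- A | g \in D) a g]%classic.
have hE : has_sup E.
  split; first by exists (\sum_(g <- fset0 | g \in D) a g), fset0.
  by exists M => x [A ->].
have [x [A0 ->] hx] := sup_adherent e0 hE.
exists A0 => A hd.
have h : \sum_(g <- fsetU A A0 | g \in D) a g <= sup E.
  by apply: ub_le_sup; [exact: hE.2|exists (fsetU A A0)].
move: h; have -> : \sum_(g <- (fsetU A A0) | g \in D) a g =
    \sum_(g <- A0 | g \in D) a g + \sum_(g <- A | g \in D) a g.
  rewrite -big_cat /=; apply: perm_big.
  have := fset_perm (fsubsetUr A A0).
  have -> // : fsetD (fsetU A A0) A0 = A.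
  apply/fsetP => g; rewrite !inE.
  case: (boolP (g \in A0)) => h; last by rewrite orbF.
  by rewrite /=; apply/esym/negbTE; apply: contraL h => h; rewrite (fdisjointP hd).
move=> h; lra.
Qed.

Lemma psum_diff D f a e A0 A B : (forall g, D g -> nm (f g) <= a g) ->
  small_tail D a e A0 -> fsubset A0 A -> fsubset A B ->
  nm (set_psum D f B - set_psum D f A) <= e.
Proof.
move=> hf ht h0 h1; rewrite /set_psum (perm_big _ (fset_perm h1)) big_cat /=.
rewrite [X in nm X](_ : _ = \sum_(g <- (fsetD B A) | g \in D) f g); last by ring.
apply: le_trans (nm_sum _ _ _) _.
apply: (@le_trans _ _ (\sum_(g <- (fsetD B A) | g \in D) a g)).
  by apply: ler_sum => g /set_mem; exact: hf.
apply: ht; apply: fdisjointWr h0 _; exact: fdisj_setD.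
Qed.

Lemma psum_tail D f a e A0 A s : (forall g, D g -> nm (f g) <= a g) ->
  small_tail D a e A0 -> fsubset A0 A -> has_sum D f s ->
  nm (set_psum D f A - s) <= e.
Proof.
move=> hf ht h0 hs; rewrite nmB; apply: (tends_le (A0 := A) hs) => B hB.
exact: psum_diff ht _ _.
Qed.

Lemma has_sum_exists D f a M : (forall g, D g -> nm (f g) <= a g) ->
  bounded_sums D a M -> exists s, has_sum D f s.
Proof.
move=> hf hM; apply: tends_complete => e e0.
have [A0 hA0] := small_tail_exists hM e0.
by exists A0 => A hA; apply: psum_diff hA0 _ hA.
Qed.

Lemma has_sum_le D f a M s : (forall g, D g -> nm (f g) <= a g) ->
  bounded_sums D a M -> has_sum D f s -> nm s <= M.
Proof.
move=> hf hM hs; rewrite -[s]subr0; apply: (tends_le (A0 := fset0) hs) => A _.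
rewrite subr0; apply: le_trans (nm_sum _ _ _) _; apply: le_trans (hM A).
by apply: ler_sum => g /set_mem; exact: hf.
Qed.

(** Comparison with the product of the [1 + b i], itself at most the exponential of the sum. The
    induction needs the bound on the product next to the one on its distance to 1. *)
Lemma prod_dev (I : Type) (s : seq I) (P : pred I) (F : I -> C) (b : I -> R) :
  (forall i, P i -> nm (F i - 1) <= b i) ->
  nm (\prod_(i <- s | P i) F i - 1) <= expR (\sum_(i <- s | P i) b i) - 1 /\
  nm (\prod_(i <- s | P i) F i) <= expR (\sum_(i <- s | P i) b i).
Proof.
move=> h.
suff h1 : nm (\prod_(i <- s | P i) F i - 1) <= expR (\sum_(i <- s | P i) b i) - 1.
  split=> //; have := nm_triB (\prod_(i <- s | P i) F i) 1; rewrite nm1; lra.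
elim/big_rec2: _ => [|i x y Pi ih]; first by rewrite subrr nm0 expR0 subrr.
rewrite expRD.
have -> : F i * y - 1 = (F i - 1) * y + (y - 1) by ring.
apply: le_trans (nmD _ _) _; rewrite nmM.
have h1 := h i Pi; have h2 := expR_ge1Dx (b i).
have h3 := nm_triB y 1; rewrite nm1 in h3.
have h4 := nm_ge0 (F i - 1); have h5 := nm_ge0 y.
have h6 : nm (F i - 1) * nm y <= (expR (b i) - 1) * expR x.
  by apply: ler_pM => //; lra.
lra.
Qed.

Lemma expR_sub1_le (x : R) : 0 <= x -> x <= 1 / 2 -> expR x - 1 <= 2 * x.
Proof.
move=> x0 x1; have h := expR_ge1Dx (- x); rewrite expRN in h.
have e0 := expR_gt0 x.
have : (1 - x) * expR x <= 1 by rewrite -ler_pdivlMr// mul1r.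
nra.
Qed.

(** The error is relative to the product over [A]: the additional factors multiply it by a number
    within [2 * e] of 1. This relative form is what later shows that a limit is nonzero. *)
Lemma pprod_diff D f a e M A0 A B : (forall g, D g -> nm (f g - 1) <= a g) ->
  bounded_sums D a M -> small_tail D a e A0 -> 0 <= e -> e <= 1 / 2 ->
  fsubset A0 A -> fsubset A B ->
  nm (set_pprod D f B - set_pprod D f A) <= nm (set_pprod D f A) * (2 * e) /\
  nm (set_pprod D f A) <= expR M.
Proof.
move=> hf hM ht e0 e1 h0 h1; split; last first.
  rewrite /set_pprod; have [|_] := @prod_dev _ A (fun g => g \in D) f a.
    by move=> g /set_mem; exact: hf.
  move=> h; apply: le_trans h _; rewrite ler_expR; exact: hM.
rewrite /set_pprod (perm_big _ (fset_perm h1)) big_cat /=.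
rewrite -[X in _ - X]mulr1 -mulrBr nmM ler_wpM2l ?nm_ge0//.
have [|h _] := @prod_dev _ (fsetD B A) (fun g => g \in D) f a.
  by move=> g /set_mem; exact: hf.
apply: le_trans h _; apply: le_trans (expR_sub1_le e0 e1).
rewrite lerD2r ler_expR; apply: ht; apply: fdisjointWr h0 _; exact: fdisj_setD.
Qed.

Lemma pprod_tail D f a e M A0 A s : (forall g, D g -> nm (f g - 1) <= a g) ->
  bounded_sums D a M -> small_tail D a e A0 -> 0 <= e -> e <= 1 / 2 ->
  fsubset A0 A -> has_prod D f s ->
  nm (set_pprod D f A - s) <= expR M * (2 * e).
Proof.
move=> hf hM ht e0 e1 h0 hs; rewrite nmB; apply: (tends_le (A0 := A) hs) => B hB.
have [h2 h3] := pprod_diff hf hM ht e0 e1 h0 hB.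
by apply: le_trans h2 _; rewrite ler_wpM2r//; lra.
Qed.

Lemma has_prod_exists D f a M : (forall g, D g -> nm (f g - 1) <= a g) ->
  bounded_sums D a M -> exists s, has_prod D f s.
Proof.
move=> hf hM; apply: tends_complete => e e0.
have M0 := expR_gt0 M.
pose d := Num.min (1 / 2) (e / (2 * expR M)).
have d0 : 0 < d by rewrite /d lt_min !divr_gt0// mulr_gt0.
have [A0 hA0] := small_tail_exists hM d0.
exists A0 => A hA.
have [|h1 h2] := pprod_diff hf hM hA0 (ltW d0) _ (fsubset_refl A0) hA.
  by rewrite /d ge_min lexx.
apply: le_trans h1 _.
have : d <= e / (2 * expR M) by rewrite /d ge_min lexx orbT.
rewrite ler_pdivlMr ?mulr_gt0// => h3.
have := nm_ge0 (set_pprod D f A0); nra.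
Qed.

Lemma has_prod_neq0 D f a M s : (forall g, D g -> nm (f g - 1) <= a g) ->
  bounded_sums D a M -> has_prod D f s -> (forall g, D g -> f g != 0) -> s != 0.
Proof.
move=> hf hM hs f0.
(* With tail 1/8 the limit differs from a nonzero partial product by at most a quarter of its
   modulus. *)
have e0 : (0 : R) < 1 / 8 by rewrite divr_gt0.
have [A0 hA0] := small_tail_exists hM e0.
have p0 : 0 < nm (set_pprod D f A0).
  rewrite nm_gt0 /set_pprod prodf_seq_neq0; apply/allP => g _.
  by apply/implyP => /set_mem; exact: f0.
have : nm (s - set_pprod D f A0) <= nm (set_pprod D f A0) * (2 * (1 / 8)).
  apply: (tends_le (A0 := A0) hs) => B hB.
  by have [||//] := pprod_diff hf hM hA0 _ _ (fsubset_refl A0) hB; lra.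
move=> h; rewrite -nm_gt0.
have := nm_triB (set_pprod D f A0) s; rewrite nmB; lra.
Qed.

Lemma has_prod_eq0 D f s g : D g -> f g = 0 -> has_prod D f s -> s = 0.
Proof.
move=> Dg f0 hs; apply: nm_eps => e e0.
apply: (tends_le (A0 := [fset g]%fset) hs) => A.
rewrite fsub1set => gA; rewrite subr0 /set_pprod.
suff -> : \prod_(g <- A | g \in D) f g = 0 by rewrite nm0 ltW.
apply/eqP; rewrite prodf_seq_eq0; apply/hasP; exists g => //.
by rewrite f0 eqxx andbT; exact: mem_set.
Qed.

End nets.

(** * The complex exponential *)

Section exponential.
Variable R : realType.
Local Notation C := R[i].
Implicit Types (x y z w : C) (r t : R).

(** Generic in the field, so that complex partial sums can be dominated by the real ones of their
    moduli. *)
Definition exp_sum (K : numFieldType) n (x : K) : K :=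
  \sum_(k < n) x ^+ k / k`!%:R.

(** The defect of multiplicativity consists of the monomials with [i + j >= n], all with nonnegative
    coefficients. Hence the complex defect is dominated by the real one, which tends to 0. *)
Lemma exp_sumD (K : numFieldType) n (x y : K) :
  exp_sum n x * exp_sum n y - exp_sum n (x + y) =
  \sum_(i < n) \sum_(j < n | (n <= i + j)%N) (x ^+ i / i`!%:R) * (y ^+ j / j`!%:R).
Proof.
pose F i j := (x ^+ i / i`!%:R) * (y ^+ j / j`!%:R).
have e1 : exp_sum n (x + y) = \sum_(i < n) \sum_(j < n | ~~ (n <= i + j)%N) F i j.
  rewrite /exp_sum.
  transitivity (\sum_(k < n) \sum_(i < n | (i <= k)%N) F i (k - i)%N).
    apply: eq_bigr => k _.
    have -> : \sum_(i < n | (i <= k)%N) F i (k - i)%N = \sum_(i < k.+1) F i (k - i)%N.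
      rewrite (big_ord_widen n (fun i => F i (k - i)%N) (ltn_ord k)).
      by apply: eq_bigl => i; rewrite ltnS.
    rewrite addrC exprDn mulr_suml.
    apply: eq_bigr => i _; rewrite /F.
    have ik : (i <= k)%N by rewrite -ltnS.
    rewrite -(bin_fact ik) !natrM -mulr_natr.
    have hn m : (m`!%:R : K) != 0 by rewrite pnatr_eq0 -lt0n fact_gt0.
    have hb : ('C(k, i)%:R : K) != 0 by rewrite pnatr_eq0 -lt0n bin_gt0.
    by field; rewrite !hn hb.
  rewrite (exchange_big_dep xpredT) //=; apply: eq_bigr => i _.
  transitivity (\sum_(0 <= k < n | (i <= k)%N) F i (k - i)%N).
    by rewrite big_mkord.
  transitivity (\sum_(i <= k < n) F i (k - i)%N).
    by rewrite big_mkord [RHS]big_geq_mkord.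
  rewrite -{1}(add0n (i : nat)) big_addn big_mkord.
  rewrite (big_ord_widen n (fun k => F i (k + i - i)%N)) ?leq_subr//.
  apply: eq_big => [j|j _]; first by rewrite -ltnNge ltn_subRL.
  by rewrite addnK.
rewrite e1 /exp_sum mulr_suml -sumrB; apply: eq_bigr => i _.
rewrite mulr_sumr (bigID (fun j : 'I_n => (n <= i + j)%N)) /=.
by rewrite -/(F _ _) addrK.
Qed.

Lemma exp_sum_nm n z : nm (exp_sum n z) <= exp_sum n (nm z).
Proof.
apply: le_trans (nm_sum _ _ _) _; apply: ler_sum => k _.
by rewrite nmM nmX nmV nm_nat.
Qed.

Lemma exp_sumD_nm n x y : nm (exp_sum n x * exp_sum n y - exp_sum n (x + y)) <=
  exp_sum n (nm x) * exp_sum n (nm y) - exp_sum n (nm x + nm y).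
Proof.
rewrite !exp_sumD; apply: le_trans (nm_sum _ _ _) _; apply: ler_sum => i _.
apply: le_trans (nm_sum _ _ _) _; apply: ler_sum => j _.
by rewrite !nmM !nmX !nmV !nm_nat.
Qed.

Lemma exp_sum_cvg r : (exp_sum n r @[n --> \oo]) --> expR r.
Proof.
have -> : (fun n => exp_sum n r) = series (exp_coeff r).
  by apply/funext => n; rewrite /series /= big_mkord.
exact: is_cvg_series_exp_coeff.
Qed.

Definition slim (u : nat -> C) (l : C) :=
  forall e : R, 0 < e -> exists N, forall n, (N <= n)%N -> nm (u n - l) < e.

Lemma slimP (u : nat -> C) (l : C) : slim u l <-> u @ \oo --> l.
Proof.
split=> [h|/(proj1 (cvgC _ _)) h e /h [N _ hN]]; last by exists N => n /hN.
by apply: (proj2 (cvgC _ _)) => e /h [N hN]; exists N.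
Qed.

Lemma slimM (u v : nat -> C) (l m : C) : slim u l -> slim v m ->
  slim (fun n => u n * v n) (l * m).
Proof.
move=> hu hv e e0.
have k0 : 0 < 1 + nm m + nm l by have := nm_ge0 m; have := nm_ge0 l; lra.
pose d := Num.min 1 (e / (1 + nm m + nm l)).
have d0 : 0 < d by rewrite /d lt_min ltr01 divr_gt0.
have d1 : d <= 1 by rewrite /d ge_min lexx.
have d2 : d * (1 + nm m + nm l) <= e by rewrite -ler_pdivlMr// /d ge_min lexx orbT.
have [N hN] := hu _ d0; have [N' hN'] := hv _ d0.
exists (maxn N N') => n; rewrite geq_max => /andP[/hN h1 /hN' h2].
have -> : u n * v n - l * m = (u n - l) * (v n - m) + ((u n - l) * m + l * (v n - m)) by ring.
apply: le_lt_trans (nmD _ _) _; apply: (@lt_le_trans _ _ (d + (d * nm m + nm l * d))); last lra.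
apply: ltr_leD.
  rewrite nmM; have h3 := nm_ge0 (u n - l); have h4 := nm_ge0 (v n - m); nra.
apply: le_trans (nmD _ _) _; rewrite !nmM; apply: lerD.
  by rewrite ler_wpM2r ?nm_ge0// ltW.
by rewrite ler_wpM2l ?nm_ge0// ltW.
Qed.

Lemma slim_ReIm (u : nat -> C) (a b : R) :
  (complex.Re (u n) @[n --> \oo]) --> a -> (complex.Im (u n) @[n --> \oo]) --> b ->
  slim u (a +i* b).
Proof.
move=> /cvgrPdist_lt ha /cvgrPdist_lt hb e e0.
have e20 : 0 < e / 2 by lra.
have [N _ hN] := ha _ e20; have [N' _ hN'] := hb _ e20.
exists (maxn N N') => n; rewrite geq_max => /andP[/hN /= h1 /hN' /= h2].
rewrite distrC in h1; rewrite distrC in h2.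
by apply: (le_lt_trans (nm_le_ReIm _)); rewrite ReD ImD ReN ImN /=; lra.
Qed.

Lemma exp_sum_real n r : exp_sum n r%:C = (exp_sum n r)%:C.
Proof.
rewrite /exp_sum rmorph_sum; apply: eq_bigr => k _.
by rewrite rmorphM rmorphXn fmorphV rmorph_nat.
Qed.

Lemma mul_i r : 'i * r%:C = 0 +i* r :> C.
Proof. by apply: complex_eq; rewrite ?ReM ?ImM /=; ring. Qed.

Lemma exp_term_i k r : ('i * r%:C) ^+ k / k`!%:R = cos_coeff r k +i* sin_coeff r k :> C.
Proof.
have e2 : ('i : C) ^+ 2 = -1 by rewrite sqr_i.
rewrite exprMn.
have -> : ('i : C) ^+ k = if odd k then 'i * ((-1) ^+ k./2) else (-1) ^+ k./2.
  rewrite -{1}(odd_double_half k) exprD -mul2n exprM e2.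
  by case: (odd k); rewrite ?expr1 // expr0 mul1r.
have em n : (-1) ^+ n = ((-1) ^+ n : R)%:C :> C by rewrite rmorphXn rmorphN rmorph1.
rewrite /cos_coeff /sin_coeff /= em -rmorphXn -(rmorph_nat (real_complex R)) -fmorphV.
case: (odd k) (odd_double_half k) => /= hk; last first.
  by rewrite !mul0r mul1r -!rmorphM.
have hk2 : k.-1./2 = k./2 by rewrite -{1}hk /= doubleK.
rewrite hk2 !mul0r !mul1r -!mulrA -!rmorphM.
by rewrite mul_i.
Qed.

Lemma cexp_i_cvg r : slim (fun n => exp_sum n ('i * r%:C)) (cexp ('i * r%:C)).
Proof.
have -> : cexp ('i * r%:C) = cos r +i* sin r.
  rewrite /cexp ReM ImM /= !mul0r !mul1r subr0 add0r expR0 ?subr0 ?mul1r //.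
have hs n : exp_sum n ('i * r%:C) = series (cos_coeff r) n +i* series (sin_coeff r) n.
  elim: n => [|n ih]; first by rewrite /exp_sum big_ord0 !seriesEord /= !big_ord0.
  rewrite /exp_sum big_ord_recr /= -/(exp_sum n _) ih exp_term_i.
  by rewrite !seriesEord /= !big_ord_recr.
apply: slim_ReIm.
  under eq_fun do rewrite hs /=; rewrite unlock; exact: is_cvg_series_cos_coeff.
under eq_fun do rewrite hs /=; rewrite unlock; exact: is_cvg_series_sin_coeff.
Qed.

Lemma cexpD z w : cexp (z + w) = cexp z * cexp w.
Proof.
case: z w => [a b] [c d]; rewrite /cexp /= expRD cosD sinD.
by apply: complex_eq; rewrite !(ReM, ImM) /=; ring.
Qed.

Lemma cexp_real r : cexp r%:C = (expR r)%:C.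
Proof. by rewrite /cexp /= cos0 sin0 mulr1. Qed.

Lemma cexp0 : cexp 0 = 1 :> C.
Proof. by rewrite cexp_real expR0. Qed.

Lemma nm_cexp z : nm (cexp z) = expR (complex.Re z).
Proof.
rewrite /cexp nmM nm_real ger0_norm ?expR_ge0// -[RHS]mulr1; congr (_ * _).
apply/eqP; rewrite -(@eqrXn2 _ 2) ?nm_ge0 ?ler01// nm_sqr /= cos2Dsin2 expr1n //.
Qed.

Lemma cexp_neq0 z : cexp z != 0.
Proof. by rewrite -nm_gt0 nm_cexp expR_gt0. Qed.

Lemma cexpN z : cexp (- z) = (cexp z)^-1.
Proof.
by apply: (mulfI (cexp_neq0 z)); rewrite -cexpD subrr cexp0 divff ?cexp_neq0.
Qed.

Lemma cexpMn n z : cexp (n%:R * z) = cexp z ^+ n.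
Proof.
elim: n => [|n ih]; first by rewrite mul0r cexp0.
by rewrite mulrS mulrDl mul1r cexpD ih exprS.
Qed.

Lemma cexp_conj z : (cexp z)^* = cexp z^*.
Proof.
case: z => a b; rewrite /cexp /= cosN sinN.
by apply: complex_eq; rewrite ?Re_conj ?Im_conj !(ReM, ImM) /=; ring.
Qed.

(** [cexp] is given by real [expR], [cos] and [sin]. Their series yield the limit on the real and on
    the imaginary axis; the product of the two partial sums differs from the partial sum at [z] by
    the defect of [exp_sumD]. *)
Lemma exp_sum_cexp z : slim (fun n => exp_sum n z) (cexp z).
Proof.
pose x := complex.Re z; pose y := complex.Im z.
have ez : z = x%:C + 'i * y%:C by rewrite -complexE.
have h1 : slim (fun n => exp_sum n x%:C) (cexp x%:C).
  rewrite cexp_real.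
  by apply: slim_ReIm; under eq_fun do rewrite exp_sum_real /=; [exact: exp_sum_cvg|exact: cvg_cst].
have h2 := @cexp_i_cvg y.
have h3 := slimM h1 h2.
rewrite {2}ez cexpD => e e0.
have e20 : 0 < e / 2 by lra.
have [N hN] := h3 _ e20.
have h4 : (exp_sum n (nm x%:C) * exp_sum n (nm ('i * y%:C)) -
    exp_sum n (nm x%:C + nm ('i * y%:C)) @[n --> \oo]) --> (0 : R).
  rewrite -(subrr (expR (nm x%:C + nm ('i * y%:C)))) {1}expRD.
  apply: cvgB; last exact: exp_sum_cvg.
  by apply: cvgM; exact: exp_sum_cvg.
move/cvgrPdist_lt/(_ _ e20): h4 => [N' _ hN'].
exists (maxn N N') => n; rewrite geq_max => /andP[/hN h5 /hN' /= h6].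
have h7 := exp_sumD_nm n x%:C ('i * y%:C).
rewrite -ez in h7.
rewrite sub0r normrN in h6.
have h8 := ler_norm (exp_sum n (nm x%:C) * exp_sum n (nm ('i * y%:C)) -
    exp_sum n (nm x%:C + nm ('i * y%:C))).
set p := exp_sum n x%:C * _ in h5 h7.
have -> : exp_sum n z - cexp x%:C * cexp ('i * y%:C) =
  - (p - exp_sum n z) + (p - cexp x%:C * cexp ('i * y%:C)) by ring.
apply: le_lt_trans (nmD _ _) _; rewrite nmN; lra.
Qed.

Lemma exp_sum_le r n m : 0 <= r -> (n <= m)%N -> exp_sum n r <= exp_sum m r.
Proof.
move=> r0 nm; rewrite -(subnKC nm) /exp_sum big_split_ord /= lerDl.
by apply: sumr_ge0 => k _; rewrite divr_ge0 ?exprn_ge0.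
Qed.

Lemma exp_sum_le_expR r n : 0 <= r -> exp_sum n r <= expR r.
Proof.
move=> r0; have h := @exp_sum_cvg r.
rewrite -(cvg_lim _ h) //; apply: nondecreasing_cvgn_le; last exact: cvgP h.
by move=> m k; exact: exp_sum_le.
Qed.

Lemma cexp_dist z r n : nm z <= r -> nm (cexp z - exp_sum n z) <= expR r - exp_sum n r.
Proof.
move=> zr; have r0 : 0 <= r := le_trans (nm_ge0 _) zr.
apply/ler_addgt0Pr => e e0.
have [N hN] := @exp_sum_cexp z _ e0.
pose m := maxn N n.
have h1 := hN m (leq_maxl _ _).
have h2 : nm (exp_sum m z - exp_sum n z) <= exp_sum m r - exp_sum n r.
  have nm' : (n <= m)%N := leq_maxr _ _.
  rewrite -(subnKC nm') /exp_sum !big_split_ord /= [X in nm X]addrAC subrr add0r.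
  rewrite [X in _ <= X]addrAC subrr add0r.
  apply: le_trans (nm_sum _ _ _) _; apply: ler_sum => k _.
  rewrite nmM nmX nmV nm_nat ler_wpM2r ?invr_ge0//.
  by apply: lerXn2r; rewrite ?nnegrE ?nm_ge0.
have h3 := exp_sum_le_expR m r0.
have -> : cexp z - exp_sum n z = - (exp_sum m z - cexp z) + (exp_sum m z - exp_sum n z) by ring.
apply: le_trans (nmD _ _) _; rewrite nmN; lra.
Qed.

(** Term by term, from [n! k! <= (n + k)!]. *)
Lemma expR_tail r n : 0 <= r -> expR r - exp_sum n r <= r ^+ n / n`!%:R * expR r.
Proof.
move=> r0.
have h m : exp_sum (n + m) r - exp_sum n r <= r ^+ n / n`!%:R * expR r.
  rewrite /exp_sum big_split_ord /= addrAC subrr add0r.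
  apply: (@le_trans _ _ (r ^+ n / n`!%:R * exp_sum m r)); last first.
    by rewrite ler_wpM2l ?exp_sum_le_expR// divr_ge0 ?exprn_ge0.
  rewrite /exp_sum mulr_sumr; apply: ler_sum => k _.
  rewrite exprD mulrACA ler_wpM2l ?mulr_ge0 ?exprn_ge0//.
  rewrite -invfM lef_pV2 ?posrE ?mulr_gt0 ?ltr0n ?fact_gt0//.
  rewrite -natrM ler_nat; have := bin_fact (leq_addr k n).
  rewrite addKn => <-; rewrite leq_pmull// bin_gt0 leq_addr //.
apply/ler_addgt0Pr => e e0.
have := @exp_sum_cvg r; move/cvgrPdist_lt/(_ _ e0) => [N _ hN].
have := hN (n + N)%N (leq_addl _ _); rewrite /= => h1.
have h2 := ler_norm (expR r - exp_sum (n + N) r); have h3 := h N; lra.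
Qed.

Lemma cexp_taylor1 z : nm (cexp z - 1) <= nm z * expR (nm z).
Proof.
have := le_trans (cexp_dist 1 (lexx (nm z))) (expR_tail 1 (nm_ge0 z)).
by rewrite /exp_sum !big_ord1 !expr0 !divr1 expr1.
Qed.

Lemma cexp_taylor2 z : nm (cexp z - 1 - z) <= nm z ^+ 2 * expR (nm z).
Proof.
have := le_trans (cexp_dist 2 (lexx (nm z))) (expR_tail 2 (nm_ge0 z)).
rewrite /exp_sum !big_ord_recr !big_ord0 /= !expr0 !divr1 expr1 !add0r opprD addrA.
move/le_trans; apply.
rewrite ler_wpM2r ?expR_ge0// ler_piMr ?sqr_ge0// invf_le1 ?ler1n//.
Qed.

Lemma cexp_taylor3 z : nm (cexp z - 1 - z - z ^+ 2 / 2) <= nm z ^+ 3 * expR (nm z).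
Proof.
have := le_trans (cexp_dist 3 (lexx (nm z))) (expR_tail 3 (nm_ge0 z)).
rewrite /exp_sum !big_ord_recr !big_ord0 /= !expr0 !divr1 expr1 !add0r !opprD !addrA.
move/le_trans; apply.
rewrite ler_wpM2r ?expR_ge0// ler_piMr ?exprn_ge0 ?nm_ge0// invf_le1 ?ler1n//.
Qed.

Lemma cexp_pi : cexp ('i * pi%:C) = -1 :> C.
Proof.
rewrite /cexp ReM ImM /= !mul0r !mul1r subr0 add0r expR0 ?subr0 ?mul1r cospi sinpi.
by apply: complex_eq => /=; rewrite ?oppr0 // !mulr0.
Qed.

Lemma cexp_2pi : cexp (2 * ('i * pi%:C)) = 1 :> C.
Proof. by rewrite (cexpMn 2) cexp_pi sqrrN expr1n. Qed.

Lemma cexp_2pi_int (k : int) : cexp (k%:~R * (2 * ('i * pi%:C))) = 1 :> C.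
Proof.
case: k => n; first by rewrite [X in cexp (X * _)](_ : _ = n%:R) // cexpMn cexp_2pi expr1n.
by rewrite NegzE mulrNz mulNr cexpN [X in cexp (X * _)](_ : _ = n.+1%:R) // cexpMn cexp_2pi expr1n invr1.
Qed.

Lemma cos_neq1 r : 0 < r -> r < 2 * pi -> cos r != 1.
Proof.
move=> r0 r1.
have h : 0 < sin (r / 2) by apply: sin_gt0_pi; lra.
have -> : r = r / 2 *+ 2 by rewrite mulr2n; lra.
rewrite cos_mulr2n cos2sin2 lt_eqF // mulr2n.
have := mulr_gt0 h h; rewrite -expr2; lra.
Qed.

Lemma cexp_eq1 z : cexp z = 1 -> exists k : int, z = k%:~R * (2 * ('i * pi%:C)).
Proof.
move=> hz.
have re0 : complex.Re z = 0.
  have := congr1 (@nm R) hz; rewrite nm_cexp nm1 => /eqP; rewrite -expR0.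
  by move/eqP/expR_inj.
have pi0 : (0 : R) < 2 * pi by rewrite mulr_gt0 ?pi_gt0.
(* Removing [k] full turns leaves an angle in [[0, 2 pi)] with cosine 1, which must be 0. *)
pose k := Num.floor (complex.Im z / (2 * pi)).
exists k.
pose y := complex.Im z - k%:~R * (2 * pi).
have y0 : 0 <= y by rewrite subr_ge0 -ler_pdivlMr// floor_le.
have y1 : y < 2 * pi.
  have := floorD1_gt (complex.Im z / (2 * pi)).
  by rewrite -/k ltr_pdivrMr// intrD mulrDl mul1r /y ltrBlDr addrC.
have hy : cexp ('i * y%:C) = 1.
  have -> : 'i * y%:C = z - k%:~R * (2 * ('i * pi%:C)).
    have ez : z = 'i * (complex.Im z)%:C by rewrite [LHS]complexE re0 add0r.
    by rewrite /y rmorphB !rmorphM rmorph_int rmorph_nat mulrBr -ez; ring.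
  by rewrite cexpD hz cexpN cexp_2pi_int invr1 mulr1.
have cy : cos y = 1.
  have := congr1 (@complex.Re R) hy.
  by rewrite mul_i /cexp /= expR0 mul1r mul0r subr0.
have y00 : y = 0.
  apply/eqP; rewrite eq_le y0 andbT leNgt; apply/negP => y2.
  by have := cos_neq1 y2 y1; rewrite cy eqxx.
rewrite [LHS]complexE re0 add0r.
have -> : complex.Im z = k%:~R * (2 * pi) by move: y00; rewrite /y => /eqP; rewrite subr_eq0 => /eqP.
by rewrite !rmorphM rmorph_int rmorph_nat mulrCA; congr (_ * _); rewrite mulrCA.
Qed.

End exponential.

(** * Entire functions as locally uniform limits of polynomials *)

Section entire_functions.
Variable R : realType.
Local Notation C := R[i].
Implicit Types (x y z w c : C) (r e M : R) (f g : C -> C) (a b : nat -> C) (p q : {poly C}).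

(* Equivalent to the usual notion; this form passes to products and to locally
   uniform limits without Cauchy's theorem. *)
Definition entire f := forall r e, 0 < e ->
  exists p : {poly C}, forall z, nm z <= r -> nm (f z - p.[z]) <= e.

Lemma eq_entire f g : f =1 g -> entire f -> entire g.
Proof. by move=> /funext ->. Qed.

Lemma entire_poly p : entire (horner p).
Proof. by move=> r e e0; exists p => z _; rewrite subrr nm0 ltW. Qed.

Lemma entire_cst c : entire (fun=> c).
Proof. by apply: eq_entire (entire_poly c%:P) => z; rewrite hornerC. Qed.

Lemma entire_id : entire (fun z => z).
Proof. by apply: eq_entire (entire_poly 'X) => z; rewrite hornerX. Qed.

Lemma entireD f g : entire f -> entire g -> entire (fun z => f z + g z).
Proof.
move=> hf hg r e e0; have e20 : 0 < e / 2 by lra.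
have [p hp] := hf r _ e20; have [q hq] := hg r _ e20.
exists (p + q) => z zr; have h1 := hp z zr; have h2 := hq z zr.
have -> : f z + g z - (p + q).[z] = (f z - p.[z]) + (g z - q.[z]) by rewrite hornerD; ring.
by apply: le_trans (nmD _ _) _; lra.
Qed.

Lemma poly_bounded p r : exists M, 0 <= M /\ forall z, nm z <= r -> nm p.[z] <= M.
Proof.
exists (\sum_(i < size p) nm p`_i * `|r| ^+ i); split.
  by apply: sumr_ge0 => i _; rewrite mulr_ge0 ?nm_ge0 ?exprn_ge0.
move=> z zr; rewrite horner_coef; apply: le_trans (nm_sum _ _ _) _.
apply: ler_sum => i _; rewrite nmM nmX ler_wpM2l ?nm_ge0//.
apply: lerXn2r; rewrite ?nnegrE ?nm_ge0//; apply: le_trans zr (ler_norm _).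
Qed.

Lemma entire_bounded f r : entire f -> exists M, 0 <= M /\ forall z, nm z <= r -> nm (f z) <= M.
Proof.
move=> hf; have [p hp] := hf r 1 ltr01; have [M [M0 hM]] := poly_bounded p r.
exists (1 + M); split; first by lra.
move=> z zr; rewrite -[f z](subrK p.[z]); apply: le_trans (nmD _ _) _.
by apply: lerD; [exact: hp|exact: hM].
Qed.

Lemma entireM f g : entire f -> entire g -> entire (fun z => f z * g z).
Proof.
move=> hf hg r e e0.
have [M [M0 hM]] := entire_bounded r hf; have [M' [M'0 hM']] := entire_bounded r hg.
pose k := 1 + M + M'; have k0 : 0 < k by rewrite /k; lra.
pose d := Num.min 1 (e / k).
have d0 : 0 < d by rewrite /d lt_min ltr01 divr_gt0.
have d1 : d <= 1 by rewrite /d ge_min lexx.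
have d2 : d * k <= e by rewrite -ler_pdivlMr// /d ge_min lexx orbT.
have [p hp] := hf r _ d0; have [q hq] := hg r _ d0.
exists (p * q) => z zr; rewrite hornerM.
have -> : f z * g z - p.[z] * q.[z] =
  f z * (g z - q.[z]) + ((f z - p.[z]) * g z - (f z - p.[z]) * (g z - q.[z])) by ring.
apply: le_trans (nmD _ _) _.
have h3 : nm ((f z - p.[z]) * g z - (f z - p.[z]) * (g z - q.[z])) <= d * M' + d * d.
  apply: le_trans (nmD _ _) _; rewrite nmN !nmM.
  by apply: lerD; apply: ler_pM; rewrite ?nm_ge0 ?hp ?hq ?hM'.
have h4 : nm (f z * (g z - q.[z])) <= M * d.
  by rewrite nmM; apply: ler_pM; rewrite ?nm_ge0 ?hq ?hM.
rewrite /k in d2; nra.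
Qed.

Lemma entireZ c f : entire f -> entire (fun z => c * f z).
Proof. exact: entireM (entire_cst c). Qed.

Lemma entireB f g : entire f -> entire g -> entire (fun z => f z - g z).
Proof.
move=> hf hg; apply: eq_entire (entireD hf (entireZ (-1) hg)) => z.
by rewrite mulN1r.
Qed.

Lemma entireX f n : entire f -> entire (fun z => f z ^+ n).
Proof.
move=> hf; elim: n => [|n ih]; first by apply: eq_entire (entire_cst 1) => z; rewrite expr0.
by apply: eq_entire (entireM hf ih) => z; rewrite exprS.
Qed.

Lemma entire_sum (I : Type) (s : seq I) (P : pred I) (F : I -> C -> C) :
  (forall i, entire (F i)) -> entire (fun z => \sum_(i <- s | P i) F i z).
Proof.
move=> h; elim: s => [|i s ih].
  by apply: eq_entire (entire_cst 0) => z; rewrite big_nil.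
have [Pi|Pi] := boolP (P i).
  by apply: eq_entire (entireD (h i) ih) => z; rewrite big_cons Pi.
by apply: eq_entire ih => z; rewrite big_cons (negbTE Pi).
Qed.

Lemma entire_prod (I : Type) (s : seq I) (P : pred I) (F : I -> C -> C) :
  (forall i, entire (F i)) -> entire (fun z => \prod_(i <- s | P i) F i z).
Proof.
move=> h; elim: s => [|i s ih].
  by apply: eq_entire (entire_cst 1) => z; rewrite big_nil.
have [Pi|Pi] := boolP (P i).
  by apply: eq_entire (entireM (h i) ih) => z; rewrite big_cons Pi.
by apply: eq_entire ih => z; rewrite big_cons (negbTE Pi).
Qed.

Lemma entire_affine f c w : entire f -> entire (fun z => f (c * z + w)).
Proof.
move=> hf r e e0; have [p hp] := hf (nm c * `|r| + nm w) e e0.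
exists (p \Po (c *: 'X + w%:P)) => z zr.
rewrite horner_comp hornerD hornerZ hornerX hornerC; apply: hp.
apply: le_trans (nmD _ _) _; rewrite nmM lerD2r ler_wpM2l ?nm_ge0//.
exact: le_trans zr (ler_norm _).
Qed.

Lemma entire_shift f w : entire f -> entire (fun z => f (z + w)).
Proof. by move=> hf; apply: eq_entire (entire_affine 1 w hf) => z; rewrite mul1r. Qed.

Lemma entire_unif_lim f : (forall r e, 0 < e ->
  exists g, entire g /\ forall z, nm z <= r -> nm (f z - g z) <= e) -> entire f.
Proof.
move=> h r e e0; have e20 : 0 < e / 2 by lra.
have [g [hg hfg]] := h r _ e20; have [p hp] := hg r _ e20.
exists p => z zr; have h1 := hp z zr; have h2 := hfg z zr.
have -> : f z - p.[z] = (f z - g z) + (g z - p.[z]) by ring.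
by apply: le_trans (nmD _ _) _; lra.
Qed.

Lemma entire_cexp q : entire (fun z => cexp q.[z]).
Proof.
move=> r e e0; have [M [M0 hM]] := poly_bounded q r.
have := @exp_sum_cvg R M; move/cvgrPdist_lt/(_ _ e0) => [n _ hn].
exists ((\sum_(k < n) k`!%:R^-1 *: 'X^k) \Po q) => z zr.
have -> : ((\sum_(k < n) k`!%:R^-1 *: 'X^k) \Po q).[z] = exp_sum n q.[z].
  rewrite horner_comp horner_sum; apply: eq_bigr => k _.
  by rewrite hornerZ hornerXn mulrC.
apply: le_trans (cexp_dist n (hM z zr)) _.
apply: ltW; apply: le_lt_trans (hn n (leqnn n)); exact: ler_norm.
Qed.

Lemma entire_cexp_lin c w : entire (fun z => cexp (c * z + w)).
Proof.
apply: eq_entire (entire_cexp (c *: 'X + w%:P)) => z.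
by rewrite hornerD hornerZ hornerX hornerC.
Qed.

Definition root1 n : C := cexp (n%:R^-1 * (2 * ('i * pi%:C))).

Lemma two_pi_i_neq0 : 2 * ('i * pi%:C) != 0 :> C.
Proof.
rewrite -nm_gt0 !nmM nm_i nm_nat nm_real !mulr_gt0 ?normr_gt0 //.
by rewrite gt_eqF // pi_gt0.
Qed.

Lemma root1X n : (0 < n)%N -> root1 n ^+ n = 1.
Proof.
by move=> n0; rewrite /root1 -cexpMn mulVKf ?cexp_2pi // pnatr_eq0 -lt0n.
Qed.

Lemma root1_eq1 n m : (0 < n)%N -> root1 n ^+ m = 1 -> (n %| m)%N.
Proof.
move=> n0; rewrite /root1 -cexpMn => /cexp_eq1[k] h0.
have h : m%:R * n%:R^-1 = k%:~R :> C by apply: (mulIf two_pi_i_neq0); rewrite -mulrA h0.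
have n0' : (n%:R : C) != 0 by rewrite pnatr_eq0 -lt0n.
have : (m%:Z)%:~R = ((k * n%:Z)%:~R : C) by rewrite intrM -h -mulrA mulVf// mulr1.
move/intr_inj => h'.
by apply/dvdnP; exists `|k|%N; rewrite -(absz_nat m) h' abszM absz_nat.
Qed.

Lemma root1_sum n m : (0 < n)%N ->
  \sum_(j < n) (root1 n ^+ j) ^+ m = if (n %| m)%N then n%:R else 0.
Proof.
move=> n0; have x1 : (root1 n ^+ m) ^+ n = 1 by rewrite exprAC root1X// expr1n.
have -> : \sum_(j < n) (root1 n ^+ j) ^+ m = \sum_(j < n) (root1 n ^+ m) ^+ j.
  by apply: eq_bigr => j _; rewrite exprAC.
case: ifPn => [/dvdnP[k ->]|hm].
  rewrite mulnC exprM root1X// expr1n.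
  by under eq_bigr do rewrite expr1n; rewrite sumr_const card_ord.
have /(congr1 (fun z => z - 1)) := x1; rewrite subrX1 subrr => /eqP.
rewrite mulf_eq0 => /orP[|/eqP//]; rewrite subr_eq0 => /eqP /(root1_eq1 n0).
by rewrite (negbTE hm).
Qed.

Lemma nm_root1 n : (0 < n)%N -> nm (root1 n) = 1.
Proof.
move=> n0; apply/eqP; rewrite -(@eqrXn2 _ n) ?nm_ge0 ?ler01//.
by rewrite -nmX root1X// nm1 expr1n.
Qed.

(* Averaging against n-th roots of unity, for n beyond the degree, is an exact
   form of Cauchy's integral formula for polynomials. *)
Lemma poly_cauchy p r M n : 0 <= r ->
  (forall z, nm z <= r -> nm p.[z] <= M) -> nm p`_n * r ^+ n <= M.
Proof.
(* [N] exceeds [n] and the degree. For [k < N] the exponent [k + (N - n)] lies strictly between 0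
   and [2 N], so [N] divides it only when [k = n]. *)
move=> r0 hM; pose N := (size p + n).+1; pose u := root1 N.
have N0 : (0 < N)%N by [].
have nN : (n < N)%N by rewrite ltnS leq_addl.
have key : \sum_(j < N) p.[r%:C * u ^+ j] * (u ^+ j) ^+ (N - n) = p`_n * r%:C ^+ n * N%:R.
  have e1 (j : 'I_N) : p.[r%:C * u ^+ j] * (u ^+ j) ^+ (N - n) =
      \sum_(k < N) p`_k * r%:C ^+ k * (u ^+ j) ^+ (k + (N - n)).
    rewrite (@horner_coef_wide _ N) ?mulr_suml; last by rewrite leqW ?leq_addr.
    by apply: eq_bigr => k _; rewrite exprMn exprD !mulrA.
  under eq_bigr do rewrite e1.
  rewrite exchange_big /= (bigD1 (Ordinal nN)) //= -mulr_sumr root1_sum//.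
  rewrite subnKC ?(ltnW nN)// dvdnn big1 ?addr0// => k kn.
  rewrite -mulr_sumr root1_sum//.
  case: ifPn => [|_]; last by rewrite mulr0.
  move/dvdnP => [[|[|d]] hd].
  - by move: hd; rewrite mul0n => /eqP; rewrite addn_eq0 subn_eq0 leqNgt nN andbF.
  - by case/eqP: kn; apply: val_inj => /=; move: hd (ltn_ord k); lia.
  - by move: hd (ltn_ord k); nia.
have := congr1 (@nm R) key; rewrite !nmM nmX nm_real nm_nat ger0_norm// => h.
rewrite -(@ler_pM2r _ N%:R) ?ltr0n// -h; apply: le_trans (nm_sum _ _ _) _.
rewrite mulr_natr -[X in _ <= M *+ X](card_ord N) -sumr_const; apply: ler_sum => j _.
have nu k : nm (u ^+ k) = 1 by rewrite nmX nm_root1// expr1n.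
rewrite nmM nmX nu expr1n mulr1; apply: hM.
by rewrite nmM nu mulr1 nm_real ger0_norm.
Qed.

(** [a] is the Taylor sequence of [f] at 0. One polynomial approximates the function and, with the
    weight [r ^ n] of Cauchy's estimate, its coefficients; sums and scalar multiples preserve this
    form directly. *)
Definition coefs f a := forall r e, 0 < r -> 0 < e ->
  exists p : {poly C}, (forall z, nm z <= r -> nm (f z - p.[z]) <= e) /\
    forall n, nm (a n - p`_n) * r ^+ n <= e.

Lemma nat_gt r : exists n : nat, r < n%:R.
Proof. by exists (Num.bound `|r|); apply: le_lt_trans (ler_norm r) _; exact: archi_boundP. Qed.

(** Cauchy's estimate for the difference of two approximating polynomials makes their coefficients
    of each order a Cauchy sequence. Choosing [P k] on the disc of radius [k + 1] with error
    [1 / (k + 1)] serves all radii at once. *)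
Lemma entire_coefs f : entire f -> exists a, coefs f a.
Proof.
move=> hf.
have k0 (k : nat) : (0 : R) < k.+1%:R^-1 by rewrite invr_gt0.
have /choice [P hP] : forall k : nat, exists p : {poly C},
    forall z, nm z <= k.+1%:R -> nm (f z - p.[z]) <= k.+1%:R^-1.
  by move=> k; apply: hf.
have hd (k l n : nat) : (k <= l)%N ->
    nm ((P k)`_n - (P l)`_n) * k.+1%:R ^+ n <= 2 * k.+1%:R^-1.
  move=> kl; rewrite -coefB; apply: poly_cauchy => // z zk.
  rewrite hornerD hornerN.
  have -> : (P k).[z] - (P l).[z] = - (f z - (P k).[z]) + (f z - (P l).[z]) by ring.
  apply: le_trans (nmD _ _) _; rewrite nmN.
  have h1 := hP k z zk.
  have h2 : nm (f z - (P l).[z]) <= l.+1%:R^-1.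
    by apply: hP; apply: le_trans zk _; rewrite ler_nat.
  have h3 : (l.+1%:R^-1 : R) <= k.+1%:R^-1 by rewrite lef_pV2 ?posrE ?ltr0n// ler_nat.
  move: h1 h2 h3; set t := k.+1%:R^-1; set s := l.+1%:R^-1; lra.
have small e : 0 < e -> exists k : nat, 2 * k.+1%:R^-1 <= e.
  move=> e0; have [k hk] := nat_gt (2 / e); exists k.
  rewrite ler_pdivrMr ?ltr0n// mulrC -ler_pdivrMr//; apply: ltW.
  by apply: lt_le_trans hk _; rewrite ler_nat.
have /choice [a ha] : forall n : nat, exists l : C, slim (fun k => (P k)`_n) l.
  move=> n; have [e e0|l hl] := @cauchyC _ _ (@eventually) _ (fun k => (P k)`_n).
    have [k hk] := small e e0; exists (P k)`_n, k => // l /= kl.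
    rewrite nmB; apply: le_trans hk; apply: le_trans (hd k l n kl).
    by rewrite ler_peMr ?nm_ge0// exprn_ege1// ler1n.
  by exists l; apply/slimP.
exists a => r e r0 e0.
have [k1 hk1] := small e e0; have [k2 hk2] := nat_gt r.
pose k := maxn k1 k2.
have hke : 2 * k.+1%:R^-1 <= e.
  apply: le_trans hk1; rewrite ler_pM2l// lef_pV2 ?posrE ?ltr0n// ler_nat ltnS leq_maxl //.
have hkr : r <= k.+1%:R.
  by apply: le_trans (ltW hk2) _; rewrite ler_nat; apply: leqW; exact: leq_maxr.
exists (P k); split=> [z zr|n].
  apply: le_trans (hP k z (le_trans zr hkr)) _; apply: le_trans hke.
  by rewrite ler_peMl ?invr_ge0// ler1n.
apply: (@le_trans _ _ (nm (a n - (P k)`_n) * k.+1%:R ^+ n)).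
  rewrite ler_wpM2l ?nm_ge0//; apply: lerXn2r; rewrite ?nnegrE// ltW //.
apply: le_trans hke; rewrite -ler_pdivlMr ?exprn_gt0//.
apply/ler_addgt0Pr => d d0; have [N hN] := ha n d d0.
have := hN (maxn N k) (leq_maxl _ _).
have := hd k (maxn N k) n (leq_maxr _ _); rewrite -ler_pdivlMr ?exprn_gt0// nmB => h1 h2.
have -> : a n - (P k)`_n = - ((P (maxn N k))`_n - a n) + ((P (maxn N k))`_n - (P k)`_n) by ring.
apply: le_trans (nmD _ _) _; rewrite nmN (nmB _ (a n)) (nmB _ (P k)`_n).
by move: h1 h2; set X := _ / _ ^+ _; lra.
Qed.

Lemma coefs_entire f a : coefs f a -> entire f.
Proof.
move=> h r e e0; have [|p [hp _]] := h (`|r| + 1) e _ e0.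
  by rewrite ltr_pwDr.
exists p => z zr; apply: hp; apply: le_trans zr _.
by apply: le_trans (ler_norm r) _; rewrite lerDl.
Qed.

Lemma coefs_le f a r M n : coefs f a -> 0 < r ->
  (forall z, nm z <= r -> nm (f z) <= M) -> nm (a n) * r ^+ n <= M.
Proof.
move=> h r0 hM; apply/ler_addgt0Pr => e e0; have e20 : 0 < e / 2 by lra.
have [p [hp1 hp2]] := h r _ r0 e20.
have h1 : nm p`_n * r ^+ n <= M + e / 2.
  apply: poly_cauchy (ltW r0) _ => z zr; have h1 := hp1 z zr; have h2 := hM z zr.
  have -> : p.[z] = - (f z - p.[z]) + f z by ring.
  by apply: le_trans (nmD _ _) _; rewrite nmN; lra.
have h2 := hp2 n; have r1 : 0 < r ^+ n by rewrite exprn_gt0.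
rewrite -[a n](subrK p`_n); apply: le_trans (ler_wpM2r (ltW r1) (nmD _ _)) _.
by rewrite mulrDl; lra.
Qed.

Lemma coefsD f g a b : coefs f a -> coefs g b ->
  coefs (fun z => f z + g z) (fun n => a n + b n).
Proof.
move=> hf hg r e r0 e0; have e20 : 0 < e / 2 by lra.
have [p [hp1 hp2]] := hf r _ r0 e20; have [q [hq1 hq2]] := hg r _ r0 e20.
exists (p + q); split=> [z zr|n].
  have h1 := hp1 z zr; have h2 := hq1 z zr.
  have -> : f z + g z - (p + q).[z] = (f z - p.[z]) + (g z - q.[z]) by rewrite hornerD; ring.
  by apply: le_trans (nmD _ _) _; lra.
have h1 := hp2 n; have h2 := hq2 n.
have -> : a n + b n - (p + q)`_n = (a n - p`_n) + (b n - q`_n) by rewrite coefD; ring.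
have r1 : 0 < r ^+ n by rewrite exprn_gt0.
by apply: le_trans (ler_wpM2r (ltW r1) (nmD _ _)) _; rewrite mulrDl; lra.
Qed.

Lemma coefsZ c f a : coefs f a -> coefs (fun z => c * f z) (fun n => c * a n).
Proof.
move=> hf r e r0 e0.
have c0 : 0 < nm c + 1 by rewrite ltr_pwDr ?nm_ge0.
have [p [hp1 hp2]] := hf r _ r0 (divr_gt0 e0 c0).
have le1 t : 0 <= t -> t <= e / (nm c + 1) -> nm c * t <= e.
  by move=> t0; rewrite ler_pdivlMr// => h; have := nm_ge0 c; nra.
exists (c *: p); split=> [z zr|n].
  by rewrite hornerZ -mulrBr nmM; apply: le1; rewrite ?nm_ge0 ?hp1.
rewrite coefZ -mulrBr nmM -mulrA; apply: le1 (hp2 n).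
by rewrite mulr_ge0 ?nm_ge0 ?exprn_ge0 ?ltW.
Qed.

Lemma coefsB f g a b : coefs f a -> coefs g b ->
  coefs (fun z => f z - g z) (fun n => a n - b n).
Proof.
move=> hf hg; have := coefsD hf (coefsZ (-1) hg).
by under eq_fun do rewrite mulN1r; under [X in coefs _ X]eq_fun do rewrite mulN1r.
Qed.

Lemma coefs_poly p : coefs (horner p) (fun n => p`_n).
Proof.
move=> r e r0 e0; exists p; split=> [z _|n]; rewrite subrr nm0 ?mul0r ltW //.
Qed.

Lemma coefs_close f g a b r e n : coefs f a -> coefs g b -> 0 < r ->
  (forall z, nm z <= r -> nm (f z - g z) <= e) -> nm (a n - b n) * r ^+ n <= e.
Proof. by move=> hf hg r0 h; apply: (coefs_le _ (coefsB hf hg)). Qed.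

Lemma coefs_uniq f a b : coefs f a -> coefs f b -> a = b.
Proof.
move=> ha hb; apply/funext => n; apply: nm_eps => e e0.
have := @coefs_close _ _ _ _ 1 e n ha hb ltr01; rewrite expr1n mulr1; apply.
by move=> z _; rewrite subrr nm0 ltW.
Qed.

Lemma eq_coefs f g a : f =1 g -> coefs f a -> coefs g a.
Proof. by move=> /funext ->. Qed.

Lemma geo_half n : \sum_(k < n) (2^-1 : R) ^+ k <= 2.
Proof.
suff -> : \sum_(k < n) (2^-1 : R) ^+ k = 2 - 2 * 2^-1 ^+ n.
  have : (0 : R) <= 2^-1 ^+ n by rewrite exprn_ge0// invr_ge0.
  lra.
elim: n => [|n ih]; first by rewrite big_ord0 expr0; lra.
by rewrite big_ord_recr /= ih exprS; lra.
Qed.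

Lemma coefs_series f a z : coefs f a -> slim (fun n => \sum_(k < n) a k * z ^+ k) (f z).
Proof.
(* Doubling the radius turns the weight [r ^ k] into a gain [2 ^ - k], so the coefficient errors sum
   to at most twice [e / 4]. *)
move=> h e e0; pose r := 2 * nm z + 1.
have z0 := nm_ge0 z.
have r0 : 0 < r by rewrite /r; lra.
have e40 : 0 < e / 4 by lra.
have [p [hp1 hp2]] := h r _ r0 e40.
exists (size p) => n pn.
have h1 : nm (f z - p.[z]) <= e / 4 by apply: hp1; rewrite /r; lra.
have -> : \sum_(k < n) a k * z ^+ k - f z =
    \sum_(k < n) (a k - p`_k) * z ^+ k - (f z - p.[z]).
  rewrite (horner_coef_wide z pn).
  under [X in _ = X - _]eq_bigr do rewrite mulrBl.
  by rewrite sumrB; ring.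
apply: le_lt_trans (nmD _ _) _; rewrite nmN.
suff : nm (\sum_(k < n) (a k - p`_k) * z ^+ k) <= e / 4 * 2 by lra.
apply: le_trans (nm_sum _ _ _) _.
apply: (@le_trans _ _ (\sum_(k < n) e / 4 * 2^-1 ^+ k)); last first.
  by rewrite -mulr_sumr ler_wpM2l ?geo_half// ltW.
apply: ler_sum => k _; rewrite nmM nmX.
apply: (@le_trans _ _ (nm (a k - p`_k) * (r ^+ k * 2^-1 ^+ k))).
  rewrite ler_wpM2l ?nm_ge0// -exprMn; apply: lerXn2r; rewrite ?nnegrE ?nm_ge0// /r; lra.
by rewrite mulrA ler_wpM2r ?exprn_ge0 ?invr_ge0.
Qed.

Lemma slim_bounded (u : nat -> C) (l : C) : slim u l -> exists M, forall n, nm (u n) <= M.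
Proof.
move=> h; have [N hN] := h 1 ltr01.
exists (\sum_(k < N) nm (u k) + (nm l + 1)) => n.
have s0 : 0 <= \sum_(k < N) nm (u k) by apply: sumr_ge0 => k _; exact: nm_ge0.
case: (leqP N n) => hn.
  have h1 := hN n hn; have h2 := nm_triB (u n) l; lra.
rewrite (bigD1 (Ordinal hn)) //=.
have : 0 <= \sum_(k < N | k != Ordinal hn) nm (u k) by apply: sumr_ge0 => k _; exact: nm_ge0.
by have := nm_ge0 l; lra.
Qed.

Lemma slim_le (u : nat -> C) (l m : C) N e : slim u l ->
  (forall n, (N <= n)%N -> nm (u n - m) <= e) -> nm (l - m) <= e.
Proof.
move=> h h'; apply/ler_addgt0Pr => d d0; have [N' hN'] := h d d0.
have h1 := hN' _ (leq_maxr N N'); have h2 := h' _ (leq_maxl N N').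
set k := maxn N N' in h1 h2.
have -> : l - m = - (u k - l) + (u k - m) by ring.
by apply: le_trans (nmD _ _) _; rewrite nmN; lra.
Qed.

(** Abel's argument: convergence at the point [2 r] bounds the terms there, hence gives geometric
    decay on the disc of radius [r]. The approximating polynomial is a truncation of the series. *)
Lemma coefs_of_series f a :
  (forall z, slim (fun n => \sum_(k < n) a k * z ^+ k) (f z)) -> coefs f a.
Proof.
move=> h r e r0 e0.
have [M hM] := slim_bounded (h (2 * r)%:C).
have M0 : 0 <= M := le_trans (nm_ge0 _) (hM 0%N).
have ha k : nm (a k) * r ^+ k <= 2 * M * 2^-1 ^+ k.
  have -> : a k = (\sum_(j < k.+1) a j * (2 * r)%:C ^+ j - \sum_(j < k) a j * (2 * r)%:C ^+ j)
                  / (2 * r)%:C ^+ k.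
    rewrite big_ord_recr /= [X in X / _]addrAC subrr add0r mulfK// expf_neq0// -nm_eq0 nm_real.
    by rewrite normr_eq0; lra.
  rewrite nmM nmV nmX nm_real (@ger0_norm _ (2 * r)); last lra.
  rewrite exprMn invfM -!mulrA mulVf ?mulr1; last by rewrite expf_neq0 ?gt_eqF.
  rewrite mulrA exprVn ler_wpM2r ?invr_ge0 ?exprn_ge0//.
  apply: le_trans (nmD _ _) _; rewrite nmN; have := hM k; have := hM k.+1; lra.
pose B := 4 * M + 1; have B0 : 0 < B by rewrite /B; lra.
have [N hN] : exists N, B * 2^-1 ^+ N <= e.
  have [N hN] := nat_gt (B / e); exists N.
  have h2 : (N%:R : R) <= 2 ^+ N by rewrite -natrX ler_nat ltnW// ltn_expl.
  rewrite exprVn ler_pdivrMr ?exprn_gt0//; rewrite ltr_pdivrMr// in hN; nra.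
pose p := \poly_(k < N) a k; exists p; split=> [z zr|n].
  have -> : p.[z] = \sum_(k < N) a k * z ^+ k by rewrite horner_poly.
  apply: (slim_le (N := N) (h z)) => n Nn.
  rewrite -(subnKC Nn) big_split_ord /= addrAC subrr add0r.
  apply: le_trans (nm_sum _ _ _) _; apply: le_trans hN.
  apply: (@le_trans _ _ (\sum_(i < n - N) 2 * M * 2^-1 ^+ N * 2^-1 ^+ i)).
    apply: ler_sum => i _; rewrite nmM nmX -mulrA -exprD; apply: le_trans (ha _).
    by rewrite ler_wpM2l ?nm_ge0//; apply: lerXn2r; rewrite ?nnegrE ?nm_ge0//; exact: ltW.
  rewrite -mulr_sumr; have := geo_half (n - N).
  have : (0 : R) <= 2^-1 ^+ N by rewrite exprn_ge0// invr_ge0.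
  rewrite /B; set t := 2^-1 ^+ N; set s := \sum_(_ < _) _ => t0 s2.
  have : 2 * M * t * s <= 2 * M * t * 2 by rewrite ler_wpM2l// mulr_ge0// mulr_ge0.
  nra.
rewrite coef_poly; case: ltnP => hn; first by rewrite subrr nm0 mul0r ltW.
rewrite subr0; apply: le_trans (ha n) _; apply: le_trans hN.
have h3 : (2^-1 : R) ^+ n <= 2^-1 ^+ N by rewrite ler_wiXn2l// ?invr_ge0// invf_le1 ?ler1n.
have : (0 : R) <= 2^-1 ^+ n by rewrite exprn_ge0// invr_ge0.
rewrite /B; nra.
Qed.

(** The product is entire, so it has some Taylor sequence [c]. Multiplying approximating polynomials
    on the unit disc identifies [c] with the Cauchy product. *)
Lemma coefsM f g a b : coefs f a -> coefs g b ->
  coefs (fun z => f z * g z) (fun n => \sum_(i < n.+1) a i * b (n - i)%N).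
Proof.
move=> hf hg.
have [c hc] := entire_coefs (entireM (coefs_entire hf) (coefs_entire hg)).
suff -> : (fun n => \sum_(i < n.+1) a i * b (n - i)%N) = c by [].
have [M [M0 hM]] := entire_bounded 1 (coefs_entire hf).
have [M' [M'0 hM']] := entire_bounded 1 (coefs_entire hg).
have ha n : nm (a n) <= M by have := coefs_le n hf ltr01 hM; rewrite expr1n mulr1.
have hb n : nm (b n) <= M' by have := coefs_le n hg ltr01 hM'; rewrite expr1n mulr1.
have key (x y x' y' : C) d : nm x <= M -> nm y <= M' -> nm (x - x') <= d ->
    nm (y - y') <= d -> d <= 1 -> nm (x * y - x' * y') <= d * (M + M' + 1).
  move=> hx hy hx' hy' d1.
  have -> : x * y - x' * y' = x * (y - y') + ((x - x') * y - (x - x') * (y - y')) by ring.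
  apply: le_trans (nmD _ _) _.
  have h1 : nm (x * (y - y')) <= M * d by rewrite nmM; apply: ler_pM; rewrite ?nm_ge0.
  have h2 : nm ((x - x') * y - (x - x') * (y - y')) <= d * M' + d * d.
    apply: le_trans (nmD _ _) _; rewrite nmN !nmM.
    by apply: lerD; apply: ler_pM; rewrite ?nm_ge0.
  have := le_trans (nm_ge0 _) hx'; nra.
apply/funext => n; apply: nm_eps => e e0.
pose k := n.+2%:R * (M + M' + 1); have k0 : 0 < k by rewrite mulr_gt0 ?ltr0n//; lra.
pose d := Num.min 1 (e / k).
have d0 : 0 < d by rewrite /d lt_min ltr01 divr_gt0.
have d1 : d <= 1 by rewrite /d ge_min lexx.
have d2 : d * k <= e by rewrite -ler_pdivlMr// /d ge_min lexx orbT.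
have [p [hp1 hp2]] := hf 1 d ltr01 d0; have [q [hq1 hq2]] := hg 1 d ltr01 d0.
have h1 : nm (c n - (p * q)`_n) <= d * (M + M' + 1).
  have := @coefs_close _ _ _ _ 1 (d * (M + M' + 1)) n hc (coefs_poly (p * q)) ltr01.
  rewrite expr1n mulr1; apply => z z1; rewrite hornerM; apply: key => //.
  - exact: hM.
  - exact: hM'.
  - exact: hp1.
  - exact: hq1.
have h2 : nm (\sum_(i < n.+1) a i * b (n - i)%N - (p * q)`_n) <= n.+1%:R * (d * (M + M' + 1)).
  rewrite coefM -sumrB; apply: le_trans (nm_sum _ _ _) _.
  rewrite mulr_natl -[X in _ *+ X](card_ord n.+1) -sumr_const; apply: ler_sum => i _.
  apply: key => //.
    by have := hp2 i; rewrite expr1n mulr1.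
  by have := hq2 (n - i)%N; rewrite expr1n mulr1.
set s := \sum_(i < n.+1) _ in h2 *.
have -> : s - c n = (s - (p * q)`_n) - (c n - (p * q)`_n) by ring.
apply: le_trans (nmD _ _) _; rewrite nmN; apply: le_trans d2.
rewrite /k -[n.+2]addn1 natrD mulrDl mulrDr mul1r; apply: lerD => //.
by rewrite mulrCA.
Qed.

Lemma taylor f a k : coefs f a -> exists M, 0 <= M /\
  forall z, nm z <= 1 -> nm (f z - \sum_(n < k) a n * z ^+ n) <= M * nm z ^+ k.
Proof.
move=> h; have [M [M0 hM]] := entire_bounded 2 (coefs_entire h).
have ha n : nm (a n) <= M * 2^-1 ^+ n.
  have := coefs_le n h (ltr0Sn R 1) hM.
  by rewrite exprVn ler_pdivlMr// exprn_gt0.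
exists (M * 2); split; first by lra.
move=> z z1; apply: (slim_le (N := k) (coefs_series z h)) => n kn.
rewrite -(subnKC kn) big_split_ord /= addrAC subrr add0r.
apply: le_trans (nm_sum _ _ _) _.
apply: (@le_trans _ _ (\sum_(i < n - k) M * nm z ^+ k * 2^-1 ^+ i)).
  apply: ler_sum => i _; rewrite nmM nmX exprD -[X in _ <= X]mulrAC.
  apply: ler_pM; rewrite ?nm_ge0 ?mulr_ge0 ?exprn_ge0 ?nm_ge0//.
    apply: le_trans (ha _) _; rewrite ler_wpM2l// ler_wiXn2l// ?invr_ge0// ?invf_le1 ?ler1n//.
    exact: leq_addl.
  by rewrite ler_piMr ?exprn_ge0 ?nm_ge0// exprn_ile1 ?nm_ge0.
rewrite -mulr_sumr -mulrA [X in _ <= X]mulrAC -[X in _ <= X]mulrA.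
by rewrite ler_wpM2l// ler_wpM2l ?exprn_ge0 ?nm_ge0// geo_half.
Qed.

Lemma coefs0_eq0 f a : coefs f a -> (forall n, a n = 0) -> forall z, f z = 0.
Proof.
move=> h a0 z; apply: nm_eps => e e0; rewrite subr0 -[f z]subr0.
apply: (slim_le (N := 0%N) (coefs_series z h)) => n _.
by rewrite big1 ?subr0 ?nm0 ?ltW// => k _; rewrite a0 mul0r.
Qed.

End entire_functions.

(** * A maximum principle for quotients *)

Section maximum_principle.
Variable R : realType.
Local Notation C := R[i].
Implicit Types (x y z w c : C) (r e M : R) (f g : C -> C) (a b : nat -> C) (p q : {poly C}).

(* At a maximum [z0] of [|G / h|] the entire function [D = G - c h], with
   [c = G z0 / h z0], vanishes identically: otherwise [D (z0 + t)] is
   equivalent to [d t^k] and [|G / h|] increases in a direction [u] for which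
   [d u^k] is [c h z0]. *)
Lemma max_ratio f g z0 : entire f -> entire g -> g z0 != 0 ->
  (forall z, nm (f z) * nm (g z0) <= nm (f z0) * nm (g z)) ->
  forall z, f z = f z0 / g z0 * g z.
Proof.
move=> hf hg g0 hmax; set c := f z0 / g z0.
have ng0 : 0 < nm (g z0) by rewrite nm_gt0.
have hmax' z : nm (f z) <= nm c * nm (g z).
  by rewrite /c nmM nmV mulrAC ler_pdivlMr.
have [c0|c0] := eqVneq c 0.
  move=> z; rewrite c0 mul0r; apply/eqP; rewrite -nm_eq0 eq_le nm_ge0 andbT.
  by have := hmax' z; rewrite c0 nm0 mul0r.
pose D t := f (t + z0) - c * g (t + z0).
have hD : entire D := entireB (entire_shift z0 hf) (entireZ c (entire_shift z0 hg)).
have [d hd] := entire_coefs hD.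
have [b hb] := entire_coefs (entire_shift z0 hg).
have [d0|/existsNP /cid[n0 dn0]] := pselect (forall n, d n = 0).
  move=> z; have := coefs0_eq0 hd d0 (z - z0); rewrite /D subrK => /eqP.
  by rewrite subr_eq0 => /eqP.
exfalso.
have ex : exists n, d n != 0 by exists n0; apply/eqP.
pose k := ex_minn ex.
have [dk kmin] : d k != 0 /\ forall n, d n != 0 -> (k <= n)%N.
  by rewrite /k; case: ex_minnP => m hm1 hm2; split.
have [M [M0 hM]] := taylor k.+1 hd.
have [M' [M'0 hM']] := taylor 1 hb.
have hD1 t : nm t <= 1 -> nm (D t - d k * t ^+ k) <= M * nm t ^+ k.+1.
  move=> t1; have := hM t t1; rewrite big_ord_recr /= big1 ?add0r//.
  move=> i _; case: (eqVneq (d i) 0) => [->|/kmin]; first by rewrite mul0r.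
  by rewrite leqNgt ltn_ord.
have hg1 t : nm t <= 1 -> nm (g (t + z0) - g z0) <= M' * nm t.
  move=> t1; have := hM' t t1; rewrite big_ord1 !expr0 mulr1 expr1.
  suff -> : b 0%N = g z0 by [].
  have [B [B0 hB]] := taylor 1 hb.
  have := hB 0; rewrite big_ord1 expr0 mulr1 add0r nm0 => /(_ ler01).
  rewrite expr1 mulr0 => h; apply/esym/eqP; rewrite -subr_eq0 -nm_eq0 eq_le nm_ge0 andbT //.
have k_gt0 : (0 < k)%N.
  rewrite lt0n; apply: contraNneq dk => k0; rewrite k0 in hM hD1 *.
  have := hD1 0; rewrite nm0 ler01 expr1 mulr0 expr0 mulr1 => /(_ isT).
  rewrite /D add0r /c mulfVK// subrr sub0r nmN => h.
  by rewrite -nm_eq0 eq_le nm_ge0 h.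
pose u := k.-root (c * g z0 / d k).
have uk : d k * u ^+ k = c * g z0 by rewrite rootCK// mulrC mulfVK.
pose K := 2 * nm c * M' * nm u + M * nm u ^+ k.+1.
have nc := nm_ge0 c; have nu := nm_ge0 u.
have K0 : 0 <= K by rewrite /K addr_ge0// !mulr_ge0 ?exprn_ge0.
have cg0 : 0 < nm c * nm (g z0) by rewrite mulr_gt0// nm_gt0.
(* The first bound keeps [t = s u] in the unit disc; the second contradicts the inequality
   [nm c * nm (g z0) <= s * K] reached at the end. *)
pose s := Num.min (1 / (1 + nm u)) (nm c * nm (g z0) / (2 * (K + 1))).
have s0 : 0 < s by rewrite /s lt_min !divr_gt0//; lra.
have su : s * nm u <= 1.
  have : s * (1 + nm u) <= 1 by rewrite -ler_pdivlMr; [rewrite /s ge_min lexx|lra].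
  nra.
have sK : s * (2 * (K + 1)) <= nm c * nm (g z0).
  by rewrite -ler_pdivlMr; [rewrite /s ge_min lexx orbT|lra].
pose t := s%:C * u.
have nt : nm t = s * nm u by rewrite /t nmM nm_real gtr0_norm.
have t1 : nm t <= 1 by rewrite nt.
have h1 := hD1 t t1; have h2 := hg1 t t1; have h3 := hmax' (t + z0).
set gt := g (t + z0) in h2 h3 *.
have etk : d k * t ^+ k = s%:C ^+ k * (c * g z0) by rewrite /t exprMn mulrCA uk.
have sk : 0 < s ^+ k by rewrite exprn_gt0.
have h4 : f (t + z0) = c * ((1 + s%:C ^+ k) * gt - s%:C ^+ k * (gt - g z0)) + (D t - d k * t ^+ k).
  by rewrite etk /D -/gt; ring.
have h5 : nm c * ((1 + s ^+ k) * nm gt - s ^+ k * (M' * nm t)) - M * nm t ^+ k.+1 <= nm (f (t + z0)).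
  rewrite h4; apply: le_trans (_ : nm (c * ((1 + s%:C ^+ k) * gt - s%:C ^+ k * (gt - g z0))) -
    nm (D t - d k * t ^+ k) <= _); last first.
    by have := nm_triB (c * ((1 + s%:C ^+ k) * gt - s%:C ^+ k * (gt - g z0))) (- (D t - d k * t ^+ k)); rewrite nmN opprK.
  apply: lerB => //; rewrite nmM ler_wpM2l//.
  apply: le_trans (nm_triB _ _); rewrite !nmM.
  have -> : nm (1 + s%:C ^+ k) = 1 + s ^+ k.
    by rewrite -rmorphXn -(rmorph1 (real_complex R)) -rmorphD nm_real ger0_norm// addr_ge0// ltW.
  rewrite nmX nm_real gtr0_norm//; apply: lerB => //.
  by rewrite ler_wpM2l -?nt// ltW.
have h6 : s ^+ k * (nm c * nm gt) <= s ^+ k * (s * (nm c * M' * nm u + M * nm u ^+ k.+1)).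
  move: h5 h3; rewrite nt exprMn [s ^+ k.+1]exprS.
  set X := s ^+ k; set Y := nm u ^+ k.+1; set Z := nm gt; set F := nm (f _) => h5 h3.
  have -> : X * (s * (nm c * M' * nm u + M * Y)) =
    nm c * (X * (M' * (s * nm u))) + M * (s * X * Y) by ring.
  have : nm c * ((1 + X) * Z - X * (M' * (s * nm u))) - M * (s * X * Y) <= nm c * Z by lra.
  have -> : nm c * ((1 + X) * Z - X * (M' * (s * nm u))) =
    nm c * Z + X * (nm c * Z) - nm c * (X * (M' * (s * nm u))) by ring.
  lra.
rewrite ler_pM2l// in h6.
have h7 : nm (g z0) <= nm gt + M' * (s * nm u).
  have := nm_triB (g z0) gt; rewrite nmB -nt; lra.
have h8 : nm c * nm (g z0) <= nm c * nm gt + nm c * (M' * (s * nm u)).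
  by rewrite -mulrDr ler_wpM2l.
have h9 : nm c * nm (g z0) <= s * K.
  apply: le_trans h8 _; apply: le_trans (lerD h6 (lexx _)) _.
  rewrite /K; apply/eqP/eqP; rewrite le_eqVlt; apply/orP; left; apply/eqP; ring.
nra.
Qed.

Lemma max_on_cell (phi : C -> R) w1 w2 :
  (forall z e, 0 < e -> exists d, 0 < d /\ forall t, nm t <= d -> `|phi (z + t) - phi z| <= e) ->
  exists z0, forall s t : R, 0 <= s <= 1 -> 0 <= t <= 1 ->
    phi (s%:C * w1 + t%:C * w2) <= phi z0.
Proof.
move=> hphi.
pose psi (st : R * R) := phi (st.1%:C * w1 + st.2%:C * w2).
have hK : compact (`[0%R, 1%R]%classic `*` `[0%R, 1%R]%classic : set (R * R)).
  by apply: compact_setX; exact: segment_compact.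
have cpsi : continuous psi.
  move=> [s t]; apply/cvgrPdist_le => e e0.
  have [d [d0 hd]] := hphi (s%:C * w1 + t%:C * w2) e e0.
  pose k := nm w1 + nm w2 + 1.
  have k0 : 0 < k by rewrite /k; have := nm_ge0 w1; have := nm_ge0 w2; lra.
  near=> st.
  rewrite distrC.
  have h1 : `|s - st.1| < d / k.
    near: st; apply: (@cvgr_dist_lt _ _ _ (nbhs (s, t)) _ fst s); [exact: cvg_fst|exact: divr_gt0].
  have h2 : `|t - st.2| < d / k.
    near: st; apply: (@cvgr_dist_lt _ _ _ (nbhs (s, t)) _ snd t); [exact: cvg_snd|exact: divr_gt0].
  have := hd ((st.1 - s)%:C * w1 + (st.2 - t)%:C * w2).
  rewrite /psi /=.
  have -> : s%:C * w1 + t%:C * w2 + ((st.1 - s)%:C * w1 + (st.2 - t)%:C * w2) =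
     st.1%:C * w1 + st.2%:C * w2 by rewrite !rmorphB /=; ring.
  apply; apply: le_trans (nmD _ _) _; rewrite !nmM !nm_real.
  rewrite distrC in h1; rewrite distrC in h2.
  have e1 : `|st.1 - s| * nm w1 <= d / k * nm w1 by rewrite ler_wpM2r ?nm_ge0// ltW.
  have e2 : `|st.2 - t| * nm w2 <= d / k * nm w2 by rewrite ler_wpM2r ?nm_ge0// ltW.
  have e3 : d / k * k = d by rewrite mulfVK// gt_eqF.
  have dk0 : 0 < d / k by rewrite divr_gt0.
  move: e3; rewrite {2}/k !mulrDr mulr1; lra.
have [| |[s0 t0] _ hst] := @compact_EVT_max _ R psi _ _ hK.
- by exists (0, 0); split; rewrite /= in_itv /= lexx ler01.
- exact: continuous_subspaceT.
exists (s0%:C * w1 + t0%:C * w2) => s t hs ht.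
by apply: (hst (s, t)); apply/mem_set; split; rewrite /= in_itv.
Unshelve. all: by end_near. Qed.

Lemma entire_cont f z e : entire f -> 0 < e ->
  exists d, 0 < d /\ forall t, nm t <= d -> nm (f (z + t) - f z) <= e.
Proof.
move=> hf e0; have [a ha] := entire_coefs (entire_shift z hf).
have [M [M0 hM]] := taylor 1 ha.
have a0 : a 0%N = f z.
  have := hM 0; rewrite big_ord1 expr0 mulr1 add0r nm0 => /(_ ler01).
  rewrite expr1 mulr0 => h; apply/esym/eqP; rewrite -subr_eq0 -nm_eq0 eq_le nm_ge0 andbT //.
exists (Num.min 1 (e / (M + 1))); split; first by rewrite lt_min ltr01 divr_gt0//; lra.
move=> t; rewrite le_min => /andP[t1 t2].
have := hM t t1; rewrite big_ord1 expr0 mulr1 expr1 a0 (addrC t) => h; apply: le_trans h _.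
rewrite ler_pdivlMr in t2; last lra.
have := nm_ge0 t; nra.
Qed.

Lemma quotient_cont f g z e : entire f -> entire g -> g z != 0 -> 0 < e ->
  exists d, 0 < d /\ forall t, nm t <= d ->
    `|nm (f (z + t)) / nm (g (z + t)) - nm (f z) / nm (g z)| <= e.
Proof.
move=> hf hg g0 e0.
have b0 : 0 < nm (g z) by rewrite nm_gt0.
have a0 := nm_ge0 (f z).
pose k := nm (f z) + nm (g z); have k0 : 0 < k by rewrite /k; lra.
pose d := Num.min (nm (g z) / 2) (e * nm (g z) ^+ 2 / (2 * k)).
have d0 : 0 < d by rewrite /d lt_min !divr_gt0 ?mulr_gt0 ?exprn_gt0.
have d1 : d <= nm (g z) / 2 by rewrite /d ge_min lexx.
have d2 : d * (2 * k) <= e * nm (g z) ^+ 2.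
  by rewrite -ler_pdivlMr ?mulr_gt0// /d ge_min lexx orbT.
have [df [df0 hdf]] := entire_cont z hf d0; have [dg [dg0 hdg]] := entire_cont z hg d0.
exists (Num.min df dg); split; first by rewrite lt_min df0.
move=> t; rewrite le_min => /andP[/hdf h1 /hdg h2].
have {}h1 := le_trans (nm_dist _ _) h1; have {}h2 := le_trans (nm_dist _ _) h2.
set a := nm (f (z + t)) in h1 *; set b := nm (g (z + t)) in h2 *.
move: h1 h2 d1 d2 a0 b0; rewrite /k; set a' := nm (f z); set b' := nm (g z) => h1 h2 d1 d2 a0 b0.
have bb : b' / 2 <= b by move: h2; rewrite ler_norml => /andP[]; lra.
have bp : 0 < b by lra.
have -> : a / b - a' / b' = ((a - a') * b' - a' * (b - b')) / (b * b').
  by field; rewrite !gt_eqF.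
have bb0 : 0 < b * b' by rewrite mulr_gt0.
rewrite normrM normfV (gtr0_norm bb0).
rewrite ler_pdivrMr ?mulr_gt0//.
apply: le_trans (ler_normB _ _) _; rewrite !normrM (ger0_norm a0) (gtr0_norm b0).
have e1 : `|a - a'| * b' <= d * b' by rewrite ler_wpM2r// ltW.
have e2 : a' * `|b - b'| <= a' * d by rewrite ler_wpM2l.
rewrite expr2 in d2.
have : e * (b' * b') <= e * (2 * (b * b')) by rewrite ler_pM2l//; nra.
nra.
Qed.

Lemma basis_coords w1 w2 z : cell_area w1 w2 != 0 ->
  z = (complex.Im (z^* * w2) / cell_area w1 w2)%:C * w1 +
      (complex.Im (w1^* * z) / cell_area w1 w2)%:C * w2.
Proof.
rewrite /cell_area; case: w1 w2 z => [a b] [c d] [x y] S0.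
rewrite ImM /= in S0.
by apply: complex_eq; rewrite !(ReD, ImD, ReM, ImM) /=; field.
Qed.

Lemma int_periodic (T : Type) (phi : C -> T) w (k : int) z :
  (forall z, phi (z + w) = phi z) -> phi (z + k%:~R * w) = phi z.
Proof.
move=> h; have hn (n : nat) z' : phi (z' + n%:R * w) = phi z'.
  elim: n z' => [|n ih] z'; first by rewrite mul0r addr0.
  by rewrite mulrSr mulrDl mul1r addrA h ih.
case: k => n; first exact: hn.
by rewrite NegzE mulrNz mulNr -{2}(subrK (n.+1%:R * w) z) hn.
Qed.

Lemma periodic_max (phi : C -> R) w1 w2 : cell_area w1 w2 != 0 ->
  (forall z, phi (z + w1) = phi z) -> (forall z, phi (z + w2) = phi z) ->
  (forall z e, 0 < e -> exists d, 0 < d /\ forall t, nm t <= d -> `|phi (z + t) - phi z| <= e) ->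
  exists z0, forall z, phi z <= phi z0.
Proof.
move=> S0 h1 h2 /(@max_on_cell _ w1 w2)[z0 hz0]; exists z0 => z.
rewrite [z](basis_coords _ S0).
set s := _ / _; set t := _ / _.
have -> : s%:C * w1 + t%:C * w2 = (s - (Num.floor s)%:~R)%:C * w1 + (t - (Num.floor t)%:~R)%:C * w2
  + (Num.floor s)%:~R * w1 + (Num.floor t)%:~R * w2 by rewrite !rmorphB /= !rmorph_int; ring.
rewrite !int_periodic //; apply: hz0.
  by have /andP[h3 h4] := floor_itv s; rewrite intrD in h4; apply/andP; split; lra.
by have /andP[h3 h4] := floor_itv t; rewrite intrD in h4; apply/andP; split; lra.
Qed.

(** Since [x / 0 = 0], the quotient of moduli is 0 at the zeros of [g], and the last hypothesis is
    its continuity there. It therefore attains a maximum on the cell, and [max_ratio] applies. *)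
Lemma periodic_ratio f g w1 w2 : cell_area w1 w2 != 0 -> entire f -> entire g ->
  (forall z, nm (f (z + w1)) / nm (g (z + w1)) = nm (f z) / nm (g z)) ->
  (forall z, nm (f (z + w2)) / nm (g (z + w2)) = nm (f z) / nm (g z)) ->
  (exists z, g z != 0) -> (forall z, g z = 0 -> f z = 0) ->
  (forall z e, g z = 0 -> 0 < e -> exists d, 0 < d /\
     forall t, nm t <= d -> nm (f (z + t)) / nm (g (z + t)) <= e) ->
  exists c, forall z, f z = c * g z.
Proof.
move=> S0 hf hg p1 p2 [z1 g1] fg0 h0.
pose phi z := nm (f z) / nm (g z).
have phi0 z : 0 <= phi z by rewrite divr_ge0 ?nm_ge0.
have phig z : g z = 0 -> phi z = 0 by move=> gz; rewrite /phi gz nm0 invr0 mulr0.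
have [z e e0|z0 hz0] := @periodic_max phi w1 w2 S0 p1 p2.
  have [gz|gz] := eqVneq (g z) 0; last exact: quotient_cont.
  have [d [d0 hd]] := h0 z e gz e0; exists d; split=> // t /hd ht.
  by rewrite (phig z gz) subr0 ger0_norm.
(* If the maximum sits at a zero of [g], it equals 0, so the point [z1] is a maximum as well. *)
have [z2 [g2 hz2]] : exists z2, g z2 != 0 /\ forall z, phi z <= phi z2.
  have [gz|gz] := eqVneq (g z0) 0; last by exists z0.
  exists z1; split=> // z; rewrite phig // in hz0.
  exact: le_trans (hz0 z) (phi0 z1).
exists (f z2 / g z2) => z; apply: max_ratio => // {}z.
have [gz|gz] := eqVneq (g z) 0; first by rewrite gz fg0// nm0 mul0r mulr0.
have := hz2 z; rewrite /phi ler_pdivrMr ?nm_gt0// mulrAC ler_pdivlMr ?nm_gt0//.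
Qed.

End maximum_principle.

(** * Lattice sums *)

Section lattice_sums.
Variable R : realType.
Local Notation C := R[i].
Implicit Types (z g : C) (r t : R) (k n : nat).

Lemma sub_sum_le (T : eqType) (s t : seq T) (f : T -> R) :
  uniq s -> {subset s <= t} -> (forall x, 0 <= f x) ->
  \sum_(x <- s) f x <= \sum_(x <- t) f x.
Proof.
move=> us st f0; elim: s us t st => [|x s ih] /= => [_|/andP[xs us]] t st.
  by rewrite big_nil; apply: sumr_ge0.
have xt : x \in t by apply: st; rewrite mem_head.
rewrite big_cons (perm_big _ (perm_to_rem xt)) big_cons lerD2l; apply: ih => // y ys.
apply: rem_mem; last by apply: st; rewrite in_cons ys orbT.
by apply: contraNneq xs => <-.
Qed.

Lemma bounded_sums_le (D D' : set C) (a a' : C -> R) (K M : R) :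
  0 <= K -> (forall g, 0 <= a g) -> D' `<=` D -> (forall g, D' g -> a' g <= K * a g) ->
  bounded_sums D a M -> bounded_sums D' a' (K * M).
Proof.
move=> K0 a0 sD h hM A.
apply: (@le_trans _ _ (\sum_(g <- A | g \in D') K * a g)).
  by apply: ler_sum => g /set_mem; exact: h.
rewrite -mulr_sumr ler_wpM2l//; apply: le_trans (hM A).
rewrite big_mkcond [leRHS]big_mkcond; apply: ler_sum => g _.
case: ifP => [/set_mem /sD /mem_set -> //|_]; by case: ifP.
Qed.

Lemma sum_inv_sqr n : \sum_(k < n) ((1 + k%:R : R) ^+ 2)^-1 <= 2.
Proof.
suff : \sum_(k < n) ((1 + k%:R : R) ^+ 2)^-1 <= 2 - 2 * (1 + n%:R)^-1.
  have : (0 : R) <= (1 + n%:R)^-1 by rewrite invr_ge0 addr_ge0.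
  lra.
elim: n => [|n ih]; first by rewrite big_ord0 addr0 invr1; lra.
rewrite big_ord_recr /= -[n.+1]addn1 natrD.
apply: le_trans (lerD ih (lexx _)) _.
have : (0 : R) <= n%:R by [].
move: (n%:R : R) => x x0.
rewrite -subr_ge0.
have -> : 2 - 2 / (1 + (x + 1)) - (2 - 2 / (1 + x) + ((1 + x) ^+ 2)^-1) =
  x / ((1 + (x + 1)) * (1 + x) ^+ 2) by field; apply/andP; split; lra.
by rewrite divr_ge0// mulr_ge0 ?exprn_ge0//; lra.
Qed.

(** Telescoping: with [x = r + k] the term is at most $2x^{-2}-2(x+1)^{-2}$, because $3x^2\ge 1$. *)
Lemma sum_inv_cube r n : 1 <= r -> \sum_(k < n) ((r + k%:R : R) ^+ 3)^-1 <= 2 * (r ^+ 2)^-1.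
Proof.
move=> r1.
suff : \sum_(k < n) ((r + k%:R : R) ^+ 3)^-1 <= 2 * (r ^+ 2)^-1 - 2 * ((r + n%:R) ^+ 2)^-1.
  have : (0 : R) <= ((r + n%:R) ^+ 2)^-1 by rewrite invr_ge0 sqr_ge0.
  lra.
elim: n => [|n ih]; first by rewrite big_ord0 addr0 subrr.
rewrite big_ord_recr /= -[n.+1]addn1 natrD.
apply: le_trans (lerD ih (lexx _)) _.
have : (0 : R) <= n%:R by [].
move: (n%:R : R) => x x0.
rewrite -subr_ge0.
have -> : 2 / r ^+ 2 - 2 / (r + (x + 1)) ^+ 2 - (2 / r ^+ 2 - 2 / (r + x) ^+ 2 + ((r + x) ^+ 3)^-1)
  = (3 * (r + x) ^+ 2 - 1) / ((r + (x + 1)) ^+ 2 * (r + x) ^+ 3).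
  by field; apply/and3P; split; lra.
by rewrite divr_ge0// ?mulr_ge0 ?exprn_ge0//; nra.
Qed.

(** The common majorant of all lattice series and products below. Exponent 3 is the order of a
    Weierstrass factor minus 1 and is summable in rank 2; the [1 +] keeps the term at 0 finite. *)
Definition a3 (g : C) : R := ((1 + nm g) ^+ 3)^-1.

Lemma a3_ge0 g : 0 <= a3 g.
Proof. by rewrite invr_ge0 exprn_ge0// addr_ge0 ?nm_ge0. Qed.

(** Powers are absorbed by $(1+t)^{k+3}\le (k+3)!\,e^{1+t}$, and the resulting linear exponent by
    completing the square against [c * t ^ 2]. *)
Lemma gauss_a3 (c B : R) k : 0 < c ->
  exists K, 0 <= K /\ forall g, nm g ^+ k * expR (B * nm g - c * nm g ^+ 2) <= K * a3 g.
Proof.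
move=> c0; pose K := (k + 3)`!%:R * expR (1 + (B + 1) ^+ 2 / (4 * c)).
exists K; split; first by rewrite mulr_ge0 ?expR_ge0.
move=> g; have := nm_ge0 g; rewrite /a3; move: (nm g) => t t0.
have p0 : 0 < (1 + t) ^+ 3 by rewrite exprn_gt0//; lra.
rewrite ler_pdivlMr// mulrAC.
have h1 : t ^+ k * (1 + t) ^+ 3 <= (k + 3)`!%:R * expR (1 + t).
  apply: (@le_trans _ _ ((1 + t) ^+ (k + 3))).
    rewrite exprD ler_wpM2r ?exprn_ge0//; [lra|apply: lerXn2r; rewrite ?nnegrE; lra].
  have := exp_sum_le_expR (k + 3).+1 (_ : 0 <= 1 + t).
  rewrite mulrC -ler_pdivrMr ?ltr0n ?fact_gt0// => /(_ ltac:(lra)); apply: le_trans.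
  rewrite /exp_sum big_ord_recr /= lerDr; apply: sumr_ge0 => j _.
  by rewrite divr_ge0// exprn_ge0//; lra.
apply: le_trans (ler_wpM2r (expR_ge0 _) h1) _.
rewrite -mulrA -expRD ler_wpM2l// ler_expR.
rewrite -addrA lerD2l -subr_ge0.
have -> : (B + 1) ^+ 2 / (4 * c) - (t + (B * t - c * t ^+ 2)) =
   (2 * c * t - (B + 1)) ^+ 2 / (4 * c) by field; lra.
by rewrite divr_ge0 ?sqr_ge0//; lra.
Qed.

Definition wfactor (x : C) : C := (1 - x) * cexp (x + 2^-1 * x ^+ 2).

(** With [w = x + x ^ 2 / 2] one has $(1-x)(1+w+w^2/2)=1-x^3(1/2+3x/8+x^2/8)$: the orders 1 and 2
    cancel. The rest of the exponential is of order [w ^ 3]. *)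
Lemma wfactor_bound r : exists K, 0 <= K /\
  forall x, nm x <= r -> nm (wfactor x - 1) <= K * nm x ^+ 3.
Proof.
pose q := 1 + `|r| / 2; pose P := 2^-1 + 3 * `|r| / 8 + `|r| ^+ 2 / 8.
have r0 : 0 <= `|r| by [].
have q0 : 0 <= q by rewrite /q; lra.
exists (P + (1 + `|r|) * (q ^+ 3 * expR (`|r| * q))); split.
  rewrite /P !addr_ge0 ?mulr_ge0 ?exprn_ge0 ?expR_ge0 ?addr_ge0//.
move=> x xr; have {}xr : nm x <= `|r| := le_trans xr (ler_norm r).
have x0 := nm_ge0 x.
have n2 : nm (2^-1 : C) = 2^-1 by rewrite nmV nm_nat.
pose w := x + 2^-1 * x ^+ 2.
have nw : nm w <= nm x * q.
  apply: le_trans (nmD _ _) _; rewrite nmM n2 nmX /q; nra.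
have e1 : wfactor x - 1 = - (x ^+ 3 * (2^-1 + 3 * x / 8 + x ^+ 2 / 8)) +
   (1 - x) * (cexp w - 1 - w - w ^+ 2 / 2).
  by rewrite /wfactor -/w; set E := cexp w; rewrite /w; field.
rewrite e1; apply: le_trans (nmD _ _) _; rewrite nmN nmM nmX (nmM (1 - x)).
have h1 : nm (2^-1 + 3 * x / 8 + x ^+ 2 / 8) <= P.
  apply: le_trans (nmD _ _) _; apply: lerD; last first.
    rewrite nmM nmX nmV nm_nat ler_wpM2r ?invr_ge0//; apply: lerXn2r; rewrite ?nnegrE //.
  apply: le_trans (nmD _ _) _; apply: lerD; first by rewrite n2.
  by rewrite !nmM nmV !nm_nat ler_wpM2r ?invr_ge0// ler_wpM2l.
have h2 : nm (1 - x) <= 1 + `|r|.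
  by apply: le_trans (nmD _ _) _; rewrite nmN nm1 lerD2l.
have h3 : nm (cexp w - 1 - w - w ^+ 2 / 2) <= nm x ^+ 3 * (q ^+ 3 * expR (`|r| * q)).
  apply: le_trans (cexp_taylor3 w) _; rewrite mulrA -exprMn.
  apply: ler_pM; rewrite ?exprn_ge0 ?nm_ge0 ?expR_ge0//.
    by apply: lerXn2r; rewrite ?nnegrE ?nm_ge0 ?mulr_ge0.
  by rewrite ler_expR; apply: le_trans nw _; rewrite ler_wpM2r.
have h4 : nm x ^+ 3 * nm (2^-1 + 3 * x / 8 + x ^+ 2 / 8) <= nm x ^+ 3 * P.
  by rewrite ler_wpM2l ?exprn_ge0.
have h5 : nm (1 - x) * nm (cexp w - 1 - w - w ^+ 2 / 2) <=
    (1 + `|r|) * (nm x ^+ 3 * (q ^+ 3 * expR (`|r| * q))).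
  by apply: ler_pM; rewrite ?nm_ge0.
apply: le_trans (lerD h4 h5) _.
by rewrite [X in _ + X]mulrCA -mulrDr mulrC.
Qed.

End lattice_sums.

(** * Lattice points: coordinates, lower bounds for the modulus, summability *)

Section lattice_geometry.
Variable R : realType.
Local Notation C := R[i].
Variables w1 w2 : C.
Hypothesis S0 : cell_area w1 w2 != 0.
Local Notation G := (lattice w1 w2).
Implicit Types (z g : C) (r t : R).

Lemma lattice_coord2 (m n : int) :
  complex.Im (w1^* * (m%:~R * w1 + n%:~R * w2)) = n%:~R * cell_area w1 w2.
Proof.
have -> : w1^* * (m%:~R * w1 + n%:~R * w2) =
    (m%:~R : R)%:C * (w1^* * w1) + (n%:~R : R)%:C * (w1^* * w2) by rewrite !rmorph_int; ring.
rewrite ImD ![complex.Im (_%:C * _)]ImM /= !mul0r !addr0 /cell_area.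
by case: w1 => a b; rewrite [complex.Im (_^* * _)]ImM /=; ring.
Qed.

Lemma lattice_coord1 (m n : int) :
  complex.Im ((m%:~R * w1 + n%:~R * w2)^* * w2) = m%:~R * cell_area w1 w2.
Proof.
have -> : (m%:~R * w1 + n%:~R * w2)^* * w2 =
    (m%:~R : R)%:C * (w1^* * w2) + (n%:~R : R)%:C * (w2^* * w2).
  by rewrite rmorphD !rmorphM /= !rmorph_int; ring.
rewrite ImD ![complex.Im (_%:C * _)]ImM /= !mul0r !addr0 /cell_area.
have -> : complex.Im (w2^* * w2) = 0 by case: w2 => a b; rewrite ImM /=; ring.
by rewrite mulr0 addr0.
Qed.

Lemma lattice_inj (m n m' n' : int) :
  m%:~R * w1 + n%:~R * w2 = m'%:~R * w1 + n'%:~R * w2 -> m = m' /\ n = n'.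
Proof.
move=> h; split.
  have := congr1 (fun g => complex.Im (g^* * w2)) h; rewrite !lattice_coord1.
  by move/(mulIf S0)/intr_inj.
have := congr1 (fun g => complex.Im (w1^* * g)) h; rewrite !lattice_coord2.
by move/(mulIf S0)/intr_inj.
Qed.

Lemma lattice0 : G 0.
Proof. by exists 0, 0; rewrite !mul0r addr0. Qed.

Lemma lattice_w1 : G w1.
Proof. by exists 1, 0; rewrite mul0r addr0 mul1r. Qed.

Lemma lattice_w2 : G w2.
Proof. by exists 0, 1; rewrite mul0r add0r mul1r. Qed.

Lemma latticeD g g' : G g -> G g' -> G (g + g').
Proof. by move=> [m [n ->]] [m' [n' ->]]; exists (m + m'), (n + n'); rewrite !intrD; ring. Qed.

Lemma latticeN g : G g -> G (- g).
Proof. by move=> [m [n ->]]; exists (- m), (- n); rewrite !intrN; ring. Qed.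

Lemma latticeDr g g' : G g' -> (G (g + g') <-> G g).
Proof.
move=> h; split=> h'; last exact: latticeD.
by rewrite -(addrK g' g); apply: latticeD => //; exact: latticeN.
Qed.

Lemma latticeNE g : G (- g) <-> G g.
Proof. by split=> /latticeN; rewrite ?opprK. Qed.

(** A lower bound for the nonzero lattice norms rather than their minimum. It comes from adding the
    estimates of the two coordinates, which makes [lattice_nm] linear in [|m| + |n|]. *)
Definition latmin : R := `|cell_area w1 w2| / (nm w1 + nm w2).

Lemma nm_basis_gt0 : 0 < nm w1 + nm w2.
Proof.
rewrite lt_neqAle eq_sym addr_ge0 ?nm_ge0// andbT; apply: contraNneq S0 => h.
have /eqP : nm w1 = 0 by have := nm_ge0 w1; have := nm_ge0 w2; lra.
by rewrite nm_eq0 /cell_area => /eqP ->; rewrite ImM /= oppr0 !mul0r addr0.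
Qed.

Lemma latmin_gt0 : 0 < latmin.
Proof. by rewrite divr_gt0 ?nm_basis_gt0 ?normr_gt0. Qed.

Lemma lattice_nm (m n : int) :
  latmin * (`|m|%:R + `|n|%:R) <= nm (m%:~R * w1 + n%:~R * w2).
Proof.
set g := m%:~R * w1 + _.
have h1 : `|m|%:R * `|cell_area w1 w2| <= nm g * nm w2.
  rewrite -nm_conj -nmM natr_absz intr_norm -normrM -(lattice_coord1 m n); exact: nm_Im.
have h2 : `|n|%:R * `|cell_area w1 w2| <= nm g * nm w1.
  rewrite [leRHS]mulrC -(nm_conj w1) -nmM natr_absz intr_norm -normrM -(lattice_coord2 m n); exact: nm_Im.
rewrite /latmin mulrAC ler_pdivrMr ?nm_basis_gt0//; lra.
Qed.

Lemma lattice_nm_ge g : G g -> g != 0 -> latmin <= nm g.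
Proof.
move=> [m [n ->]] g0; apply: le_trans (lattice_nm m n).
rewrite ler_peMr ?(ltW latmin_gt0)// -natrD ler1n addn_gt0 !absz_gt0.
by apply: contraNT g0; rewrite negb_or !negbK => /andP[/eqP -> /eqP ->]; rewrite !mul0r addr0.
Qed.

Lemma sum_absz (h : nat -> R) N :
  \sum_(i <- [seq Posz k | k <- iota 0 N] ++ [seq - Posz k | k <- iota 0 N]) h `|i|%N =
  2 * \sum_(k < N) h k.
Proof.
rewrite big_cat /= !big_map.
have -> : \sum_(k <- iota 0 N) h `|- Posz k|%N = \sum_(k <- iota 0 N) h k.
  by apply: eq_bigr => k _; rewrite abszN.
by rewrite mulr2n mulrDl mul1r -!(big_mkord xpredT h) /index_iota subn0.
Qed.

(** The points of [A] lie in a square of indices, where [lattice_nm] reduces the sum to that of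
    $(1+k+l)^{-3}$. Summing over [l] and then over [k] gives a bound independent of the square. *)
Lemma lattice_bounded_sums : exists M, 0 <= M /\ bounded_sums G (@a3 R) M.
Proof.
pose d := Num.min 1 latmin.
have d0 : 0 < d by rewrite lt_min ltr01 latmin_gt0.
exists (4 * (d ^+ 3)^-1 * 4); split; first by rewrite !mulr_ge0// invr_ge0 exprn_ge0// ltW.
move=> A.
rewrite -big_filter; set s := [seq g <- A | g \in G].
have /choice [idx hidx] : forall g, exists mn : int * int, G g -> g = mn.1%:~R * w1 + mn.2%:~R * w2.
  move=> g; have [[m [n ->]]|h] := pselect (G g); first by exists (m, n).
  by exists (0, 0).
pose N := (\sum_(g <- s) (`|(idx g).1| + `|(idx g).2|)).+1%N.
(* The index 0 is listed twice; this is harmless in an upper bound and gives the exact factor 2 of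
   [sum_absz]. *)
pose I := [seq Posz k | k <- iota 0 N] ++ [seq - Posz k | k <- iota 0 N].
have hI (m : int) : (`|m| < N)%N -> m \in I.
  move=> mN; rewrite mem_cat; apply/orP.
  have [m0|m0] := leP 0 m.
    by left; apply/mapP; exists `|m|%N; [rewrite mem_iota|rewrite gez0_abs].
  by right; apply/mapP; exists `|m|%N; [rewrite mem_iota|rewrite ltz0_abs// opprK].
apply: (@le_trans _ _ (\sum_(g <- [seq i%:~R * w1 + j%:~R * w2 | i <- I, j <- I]) a3 g)).
  apply: sub_sum_le; [by rewrite filter_uniq// fset_uniq| |by move=> g; exact: a3_ge0].
  move=> g gs; have /set_mem Gg : g \in G by move: gs; rewrite mem_filter => /andP[].
  rewrite (hidx g Gg); apply/allpairsP; exists (idx g); split=> //; apply: hI.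
    rewrite ltnS (big_rem g) //=; lia.
  rewrite ltnS (big_rem g) //=; lia.
rewrite big_allpairs_dep /=.
pose b k l : R := (d ^+ 3)^-1 * ((1 + k%:R + l%:R) ^+ 3)^-1.
apply: (@le_trans _ _ (\sum_(i <- I) \sum_(j <- I) b `|i|%N `|j|%N)).
  apply: ler_sum => i _; apply: ler_sum => j _.
  have p1 : 0 < d * (1 + `|i|%:R + `|j|%:R) by rewrite mulr_gt0 ?ltr_wpDr.
  have p2 : 0 < 1 + nm (i%:~R * w1 + j%:~R * w2) by rewrite ltr_wpDr ?nm_ge0.
  rewrite /b -invfM -exprMn /a3 lef_pV2 ?posrE ?exprn_gt0//.
  have d1 : d <= 1 by rewrite ge_min lexx.
  have d2 : d <= latmin by rewrite ge_min lexx orbT.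
  have h := lattice_nm i j.
  have i0 : (0 : R) <= `|i|%:R by []. have j0 : (0 : R) <= `|j|%:R by [].
  apply: lerXn2r; rewrite ?nnegrE.
  - by rewrite mulr_ge0 ?addr_ge0// ltW.
  - by rewrite addr_ge0 ?nm_ge0.
  - by rewrite -addrA mulrDr mulr1; apply: lerD => //; apply: le_trans h; rewrite ler_wpM2r// addr_ge0.
under eq_bigr => i _ do rewrite (sum_absz (fun l => b `|i|%N l)).
rewrite (sum_absz (fun k => 2 * \sum_(l < N) b k l)).
apply: (@le_trans _ _ (2 * \sum_(k < N) 2 * ((d ^+ 3)^-1 * (2 * ((1 + k%:R) ^+ 2)^-1)))).
  rewrite ler_wpM2l//; apply: ler_sum => k _; rewrite ler_wpM2l// /b -mulr_sumr.
  rewrite ler_wpM2l ?invr_ge0 ?exprn_ge0 ?(ltW d0)//; apply: sum_inv_cube.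
  by rewrite lerDl.
have -> : \sum_(k < N) 2 * ((d ^+ 3)^-1 * (2 * ((1 + k%:R : R) ^+ 2)^-1)) =
    4 * (d ^+ 3)^-1 * \sum_(k < N) ((1 + k%:R : R) ^+ 2)^-1.
  by rewrite mulr_sumr; apply: eq_bigr => k _; ring.
have := sum_inv_sqr R N; set x := \sum_(k < N) _ => x2.
have y0 : 0 <= (d ^+ 3)^-1 by rewrite invr_ge0 exprn_ge0// ltW.
have : (d ^+ 3)^-1 * x <= (d ^+ 3)^-1 * 2 by rewrite ler_wpM2l.
lra.
Qed.

End lattice_geometry.

(** * The Weierstrass product *)

Section sigma.
Variable R : realType.
Local Notation C := R[i].
Variables w1 w2 : C.
Hypothesis S0 : cell_area w1 w2 != 0.
Local Notation G := (lattice w1 w2).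
Implicit Types (z g : C) (r t : R).

Lemma wfactor_sums r : exists K M, [/\ 0 <= K, 0 <= M,
  bounded_sums (G `\ 0) (fun g => K * a3 g) M &
  forall z g, nm z <= r -> (G `\ 0) g -> nm (wfactor (z / g) - 1) <= K * a3 g].
Proof.
have d0 := latmin_gt0 S0; set d := latmin w1 w2 in d0.
have [K [K0 hK]] := wfactor_bound (`|r| / d).
have [M [M0 hM]] := lattice_bounded_sums S0.
(* As [nm g >= d], $1/|g|\le (1+1/d)/(1+|g|)$, whence the last factor. *)
pose K' := K * `|r| ^+ 3 * (1 + d^-1) ^+ 3.
have di : 0 < d^-1 by rewrite invr_gt0.
have K'0 : 0 <= K' by rewrite !mulr_ge0 ?exprn_ge0//; lra.
exists K', (K' * M); split=> //; first by rewrite mulr_ge0.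
  apply: (bounded_sums_le (a := @a3 R) _ _ _ _ hM) => //; exact: a3_ge0.
move=> z g zr [Gg /= /eqP g0].
have gd : d <= nm g := lattice_nm_ge S0 Gg g0.
have zr' : nm z <= `|r| := le_trans zr (ler_norm r).
have g1 : 0 < nm g := lt_le_trans d0 gd.
have gi : (nm g)^-1 <= d^-1 by rewrite lef_pV2.
apply: le_trans (hK _ _) _.
  rewrite nmM nmV; apply: ler_pM; rewrite ?nm_ge0 ?invr_ge0 ?nm_ge0//.
have -> : K' * a3 g = K * (`|r| ^+ 3 * ((1 + d^-1) ^+ 3 * a3 g)) by rewrite /K'; ring.
rewrite ler_wpM2l// nmM nmV exprMn.
apply: ler_pM; rewrite ?exprn_ge0 ?nm_ge0 ?invr_ge0 ?nm_ge0//.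
  by apply: lerXn2r; rewrite ?nnegrE ?nm_ge0.
rewrite /a3 -exprVn -exprMn; apply: lerXn2r; rewrite ?nnegrE ?invr_ge0 ?nm_ge0//.
  by rewrite mulr_ge0 ?invr_ge0 ?addr_ge0 ?nm_ge0// ltW.
rewrite ler_pdivlMr ?ltr_wpDr ?nm_ge0// mulrDr mulr1 mulVf ?gt_eqF//; lra.
Qed.

Definition wprod z : C := set_prod (G `\ 0) (fun g => wfactor (z / g)).

Lemma wsigmaE z : wsigma G z = z * wprod z.
Proof. by []. Qed.

Lemma has_wprod z : has_prod (G `\ 0) (fun g => wfactor (z / g)) (wprod z).
Proof.
have [K [M [K0 M0 hM hb]]] := wfactor_sums (nm z).
have [s hs] := has_prod_exists (fun g => hb z g (lexx _)) hM.
by rewrite /wprod /set_prod (tends_lim hs).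
Qed.

Lemma entire_wfactor : entire (@wfactor R).
Proof.
apply: entireM.
  by apply: (@entireB R (fun=> 1) (fun z => z)); [exact: entire_cst|exact: entire_id].
apply: eq_entire (entire_cexp ('X + 2^-1 *: 'X^2)) => z.
by rewrite hornerD hornerZ hornerXn hornerX.
Qed.

Lemma entire_wprod : entire wprod.
Proof.
apply: entire_unif_lim => r e e0.
have [K [M [K0 M0 hM hb]]] := wfactor_sums r.
have M1 := expR_gt0 M.
pose d := Num.min (1 / 2) (e / (2 * expR M)).
have d0 : 0 < d by rewrite lt_min !divr_gt0// mulr_gt0.
have d1 : d <= 1 / 2 by rewrite ge_min lexx.
have d2 : d * (2 * expR M) <= e by rewrite -ler_pdivlMr ?mulr_gt0// ge_min lexx orbT.
have [A hA] := small_tail_exists hM d0.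
exists (fun z => set_pprod (G `\ 0) (fun g => wfactor (z / g)) A); split.
  apply: entire_prod => g.
  apply: eq_entire (entire_affine g^-1 0 entire_wfactor) => z.
  by rewrite addr0 mulrC.
move=> z zr; rewrite nmB.
apply: le_trans (pprod_tail (fun g => hb z g zr) hM hA (ltW d0) d1 (fsubset_refl A) (has_wprod z)) _.
lra.
Qed.

Lemma entire_wsigma : entire (wsigma G).
Proof. by apply: (@entireM R (fun z => z) wprod); [exact: entire_id|exact: entire_wprod]. Qed.

Lemma wfactor0 : wfactor 0 = 1 :> C.
Proof. by rewrite /wfactor expr0n mulr0 addr0 cexp0 subr0 mulr1. Qed.

Lemma wfactor_eq0 x : (wfactor x == 0 :> C) = (x == 1).
Proof. by rewrite /wfactor mulf_eq0 (negbTE (cexp_neq0 _)) orbF subr_eq0 eq_sym. Qed.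

Lemma wprod0 : wprod 0 = 1.
Proof.
apply: tends_uniq (has_wprod 0) _; apply: tends_ext (tends_cst 1) => A.
by rewrite /set_pprod big1// => g _; rewrite mul0r wfactor0.
Qed.

Lemma wsigma_eq0 z : wsigma G z = 0 <-> G z.
Proof.
rewrite wsigmaE; split=> [/eqP|Gz].
  rewrite mulf_eq0 => /orP[/eqP ->|h]; first exact: lattice0.
  have [K [M [K0 M0 hM hb]]] := wfactor_sums (nm z).
  apply: contrapT => Gz; move/negP: h; apply.
  apply/negP/(has_prod_neq0 (fun g => hb z g (lexx _)) hM (has_wprod z)) => g [Gg /= /eqP g0].
  rewrite wfactor_eq0; apply/eqP => h; apply: Gz.
  by rewrite -(mulfVK g0 z) h mul1r.
have [->|z0] := eqVneq z 0; first by rewrite mul0r.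
have Dz : (G `\ 0) z by split=> //=; apply/eqP.
by rewrite (has_prod_eq0 Dz _ (has_wprod z)) ?mulr0//; apply/eqP; rewrite wfactor_eq0 divff.
Qed.

Lemma has_prod_reindex (D : set C) (f : C -> C) (s : C) (p q : C -> C) :
  cancel p q -> cancel q p -> (forall g, D (p g) <-> D g) ->
  has_prod D f s -> has_prod D (f \o p) s.
Proof.
move=> pq qp hD h e e0; have [A0 hA0] := h e e0.
exists (q @` A0)%fset => A hA.
have -> : set_pprod D (f \o p) A = set_pprod D f (p @` A)%fset.
  rewrite /set_pprod [LHS]big_mkcond [RHS]big_mkcond big_imfset /=.
    apply: eq_bigr => g _; congr (if _ then _ else _).
    by apply/idP/idP => /set_mem /hD /mem_set.
  by move=> ? ? _ _ /(can_inj pq).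
apply: hA0; apply/fsubsetP => g gA0.
rewrite -(qp g); apply: in_imfset; apply: (fsubsetP hA).
exact: in_imfset.
Qed.

Lemma wprodN z : wprod (- z) = wprod z.
Proof.
have h := has_prod_reindex (@opprK C) (@opprK C) _ (has_wprod (- z)).
apply: tends_uniq (h _) _.
  move=> g; split=> -[/latticeNE Gg g0]; split=> //=.
    by move=> e; apply: g0; rewrite e /= oppr0.
  by move=> e; apply: g0; rewrite -(opprK g) e /= oppr0.
apply: tends_ext (has_wprod z) => A; apply: eq_bigr => g _ /=.
by rewrite invrN mulrNN.
Qed.

Lemma wsigmaN z : wsigma G (- z) = - wsigma G z.
Proof. by rewrite !wsigmaE wprodN mulNr. Qed.

Lemma wsigma_near0 : exists M : R, 0 <= M /\
  forall t : C, nm t <= 1 -> nm (wsigma G t - t) <= M * nm t ^+ 2.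
Proof.
have [a ha] := entire_coefs entire_wprod.
have [M [M0 hM]] := taylor 1 ha.
have a0 : a 0%N = 1.
  have := hM 0; rewrite big_ord1 expr0 mulr1 wprod0 nm0 => /(_ ler01).
  rewrite expr1 mulr0 => h; apply/esym/eqP; rewrite -subr_eq0 -nm_eq0 eq_le nm_ge0 andbT //.
exists M; split=> // t t1; have := hM t t1.
rewrite big_ord1 expr0 mulr1 a0 expr1 => h.
have -> : wsigma G t - t = t * (wprod t - 1) by rewrite wsigmaE; ring.
rewrite nmM; have := nm_ge0 t; nra.
Qed.

Lemma has_prod_seq (D : set C) (f : C -> C) (s : C) (B : nat -> {fset C}) :
  (forall A : {fset C}, (forall g, g \in A -> D g) ->
     exists N, forall n, (N <= n)%N -> fsubset A (B n)) ->
  has_prod D f s -> slim (fun n => set_pprod D f (B n)) s.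
Proof.
move=> hB hs e e0; have [A hA] := hs e e0.
(* Elements of [A] outside [D] are not counted, so only the part of [A] in [D] has to be absorbed by
   [B n]. *)
have [|N hN] := hB [fset g in A | g \in D]%fset.
  by move=> g; rewrite !inE => /andP[_ /set_mem].
exists N => n /hN hAB.
have -> : set_pprod D f (B n) = set_pprod D f (fsetU A (B n)).
  rewrite /set_pprod -big_filter -[RHS]big_filter; apply: perm_big.
  apply: uniq_perm; rewrite ?filter_uniq ?fset_uniq// => g.
  rewrite !mem_filter inE; case: (boolP (g \in D)) => //= gD.
  have [gA|] //= := boolP (g \in A).
  by apply: (fsubsetP hAB); rewrite !inE gA.
by apply: hA; exact: fsubsetUl.
Qed.

End sigma.

(** * Quasi-periodicity of sigma *)

Section quasi_period.
Variable R : realType.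
Local Notation C := R[i].
Implicit Types (z g t : C) (N : nat).

Lemma cexp_sum (I : Type) (s : seq I) (P : pred I) (F : I -> C) :
  cexp (\sum_(i <- s | P i) F i) = \prod_(i <- s | P i) cexp (F i).
Proof. by elim/big_rec2: _ => [|i x y _ <-]; rewrite ?cexp0 ?cexpD. Qed.

Lemma slim_cst (l : C) : slim (fun=> l) l.
Proof. by move=> e e0; exists 0%N => n _; rewrite subrr nm0. Qed.

Lemma slim_uniq (u : nat -> C) (l m : C) : slim u l -> slim u m -> l = m.
Proof.
move=> hl hm; apply: nm_eps => e e0; have [N hN] := hm e e0.
by apply: (slim_le hl (N := N)) => n /hN /ltW.
Qed.

Lemma eq_slim (u v : nat -> C) (l : C) : u =1 v -> slim u l -> slim v l.
Proof. by move=> /funext ->. Qed.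

Lemma slimV (u : nat -> C) (l : C) : l != 0 -> slim u l -> slim (fun n => (u n)^-1) l^-1.
Proof.
move=> l0 h e e0; have nl : 0 < nm l by rewrite nm_gt0.
pose d := Num.min (nm l / 2) (e * nm l ^+ 2 / 4).
have d0 : 0 < d by rewrite lt_min !divr_gt0// mulr_gt0// exprn_gt0.
have d1 : d <= nm l / 2 by rewrite ge_min lexx.
have d2 : d <= e * nm l ^+ 2 / 4 by rewrite ge_min lexx orbT.
have [N hN] := h d d0; exists N => n /hN hn.
have un : nm l / 2 <= nm (u n) by have := nm_triB l (u n); rewrite nmB; lra.
have u0 : u n != 0 by rewrite -nm_gt0; lra.
have -> : (u n)^-1 - l^-1 = (l - u n) / (u n * l) by field; rewrite l0 u0.
rewrite nmM nmV nmM nmB ltr_pdivrMr ?mulr_gt0 ?nm_gt0//.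
have : e * (nm l / 2 * nm l) <= e * (nm (u n) * nm l) by rewrite ler_pM2l// ler_pM2r.
have : 0 < e * (nm l * nm l) by rewrite !mulr_gt0.
rewrite expr2 in d2; lra.
Qed.

Lemma slim_entire (f : C -> C) (u : nat -> C) (l : C) : entire f -> slim u l ->
  slim (fun n => f (u n)) (f l).
Proof.
move=> hf h e e0; have e20 : 0 < e / 2 by lra.
have [d [d0 hd]] := entire_cont l hf e20; have [N hN] := h d d0.
exists N => n /hN hn; have := hd (u n - l) (ltW hn).
by rewrite [l + _]addrC subrK; lra.
Qed.

Lemma cexp_real_lim (u : nat -> C) (q : C) : q != 0 -> slim (fun n => cexp (u n)) q ->
  (complex.Re (u n) @[n --> \oo]) --> ln (nm q).
Proof.
move=> q0 h.
have nq : 0 < nm q by rewrite nm_gt0.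
have h1 : (nm (cexp (u n)) @[n --> \oo]) --> nm q.
  apply/cvgrPdist_lt => e /h [N hN]; exists N => // n /= /hN; apply: le_lt_trans.
  by rewrite distrC nm_dist.
have -> : (fun n => complex.Re (u n)) = (@ln R) \o (fun n => nm (cexp (u n))).
  by apply/funext => n /=; rewrite nm_cexp expRK.
by apply: (cvg_comp _ _ h1); exact: continuous_ln.
Qed.

Lemma wfactor1_bound (x : C) : nm x <= 1 ->
  nm ((1 - x) * cexp x - 1) <= (1 + 2 * expR 1) * nm x ^+ 2.
Proof.
move=> x1; have x0 := nm_ge0 x.
have -> : (1 - x) * cexp x - 1 = - x ^+ 2 + (1 - x) * (cexp x - 1 - x) by ring.
apply: le_trans (nmD _ _) _; rewrite nmN nmX nmM mulrDl mul1r lerD2l.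
have h1 : nm (1 - x) <= 2 by apply: le_trans (nmD _ _) _; rewrite nm1 nmN; lra.
rewrite -mulrA; apply: ler_pM; rewrite ?nm_ge0//.
apply: le_trans (cexp_taylor2 x) _; rewrite mulrC ler_wpM2r ?exprn_ge0//.
by rewrite ler_expR.
Qed.

Variables w1 w2 : C.
Hypothesis S0 : cell_area w1 w2 != 0.
Local Notation G := (lattice w1 w2).

Definition offset N (k : 'I_(N.*2.+1)) : int := k%:Z - N%:Z.

Lemma offset_rev N (k : 'I_(N.*2.+1)) : offset (rev_ord k) = - offset k.
Proof. by rewrite /offset /=; have := ltn_ord k; lia. Qed.

Lemma offset_inj N : injective (@offset N).
Proof. by move=> i j; rewrite /offset => h; apply: val_inj => /=; lia. Qed.

Lemma offsetP N (m : int) : (`|m| <= N)%N -> exists k : 'I_(N.*2.+1), offset k = m.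
Proof.
move=> mN; have h : (absz (m + N%:Z)%R < N.*2.+1)%N by lia.
by exists (Ordinal h); rewrite /offset /=; lia.
Qed.

Definition box_seq N : seq C :=
  [seq (offset j)%:~R * w1 + (offset i)%:~R * w2 | i <- enum 'I_(N.*2.+1), j <- enum 'I_(N.*2.+1)].

Lemma box_seq_uniq N : uniq (box_seq N).
Proof.
apply: allpairs_uniq; rewrite ?enum_uniq// => -[i j] [i' j'] _ _ /=.
by move/(lattice_inj S0) => [/offset_inj -> /offset_inj ->].
Qed.

Lemma box_seqP N g : reflect (exists i j : 'I_(N.*2.+1),
  g = (offset j)%:~R * w1 + (offset i)%:~R * w2) (g \in box_seq N).
Proof.
rewrite /box_seq; apply: (iffP allpairsP) => [[[i j] /= [_ _ ->]]|[i [j ->]]]; first by exists i, j.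
by exists (i, j); split; rewrite ?mem_enum.
Qed.

Lemma box_seqN N g : (- g \in box_seq N) = (g \in box_seq N).
Proof.
by apply/idP/idP => /box_seqP[i [j e]]; apply/box_seqP; exists (rev_ord i), (rev_ord j);
  rewrite !offset_rev !intrN; [rewrite -(opprK g) e|rewrite e]; ring.
Qed.

Lemma prod_box (F : C -> C) N : \prod_(g <- box_seq N) F g =
  \prod_(i < N.*2.+1) \prod_(j < N.*2.+1) F ((offset j)%:~R * w1 + (offset i)%:~R * w2).
Proof.
rewrite big_allpairs_dep big_enum /=; apply: eq_bigr => i _; rewrite big_enum //.
Qed.

Definition sigma_box N z := z * \prod_(g <- box_seq N | g != 0) wfactor (z / g).

Lemma sigma_box_lim z : slim (sigma_box ^~ z) (wsigma G z).
Proof.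
rewrite wsigmaE; apply: slimM; first exact: slim_cst.
pose B N := [fset g in box_seq N]%fset.
have := @has_prod_seq R (G `\ 0) (fun g => wfactor (z / g)) _ B _ (has_wprod S0 z).
move=> h; apply: eq_slim (h _) => [N|A hA].
  rewrite /set_pprod -big_filter -[RHS]big_filter; apply: perm_big.
  apply: uniq_perm; rewrite ?filter_uniq ?fset_uniq ?box_seq_uniq// => g.
  rewrite !mem_filter !inE; case: (boolP (g \in box_seq N)) => gb; rewrite ?andbF ?andbT//.
  apply/idP/idP => [/set_mem[_ /= /eqP]//|g0].
  apply/mem_set; split; last exact/eqP.
  by move/box_seqP: gb => [i [j ->]]; exists (offset j), (offset i).
have /choice [idx hidx] : forall g, exists mn : int * int, G g -> g = mn.1%:~R * w1 + mn.2%:~R * w2.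
  move=> g; have [[m [n ->]]|hg] := pselect (G g); first by exists (m, n).
  by exists (0, 0).
exists (\sum_(g <- A) (`|(idx g).1| + `|(idx g).2|))%N => n hn.
apply/fsubsetP => g gA; rewrite !inE; have [Gg _] := hA g gA.
have hb : (`|(idx g).1| + `|(idx g).2| <= n)%N.
  by apply: leq_trans hn; rewrite (big_rem g) //= leq_addr.
have [j hj] : exists j : 'I_(n.*2.+1), offset j = (idx g).1 by apply: offsetP; lia.
have [i hi] : exists i : 'I_(n.*2.+1), offset i = (idx g).2 by apply: offsetP; lia.
by apply/box_seqP; exists i, j; rewrite hi hj; exact: hidx.
Qed.

Definition box_sum N : C := \sum_(g <- box_seq N | g != 0) g^-1 ^+ 2.

Definition box_cst N : C := \prod_(g <- box_seq N | g != 0) - g^-1.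

Definition box_prod N z : C := \prod_(g <- box_seq N) (z - g).

Lemma mem0_box N : 0 \in box_seq N.
Proof.
have [k hk] := @offsetP N 0 (leq0n N).
by apply/box_seqP; exists k, k; rewrite hk !mul0r addr0.
Qed.

Lemma box_sum1 N : \sum_(g <- box_seq N | g != 0) g^-1 = 0 :> C.
Proof.
set s := \sum_(g <- _ | _) _.
have h : s = - s.
  rewrite /s [LHS](perm_big [seq - g | g <- box_seq N]) /=.
    rewrite big_map -sumrN.
    by apply: eq_big => [g|g _]; rewrite ?oppr_eq0// invrN.
  apply: uniq_perm; first exact: box_seq_uniq.
    by rewrite map_inj_uniq ?box_seq_uniq//; exact: (@oppr_inj C).
  move=> g; apply/idP/mapP => [gb|[g' gb ->]]; last by rewrite box_seqN.
  by exists (- g); rewrite ?opprK ?box_seqN.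
have : 2 * s = 0 by rewrite mulrDl mul1r {1}h addNr.
by move/eqP; rewrite mulf_eq0 pnatr_eq0 /= => /eqP.
Qed.

(** The box is symmetric, so [box_sum1] kills the linear exponents. What remains is a polynomial
    times the exponential of a multiple of [z ^ 2], both easy to shift. *)
Lemma sigma_boxE N z :
  sigma_box N z = box_cst N * cexp (z ^+ 2 / 2 * box_sum N) * box_prod N z.
Proof.
rewrite /sigma_box.
have -> : \prod_(g <- box_seq N | g != 0) wfactor (z / g) =
  \prod_(g <- box_seq N | g != 0) (z - g) * box_cst N *
    cexp (z * \sum_(g <- box_seq N | g != 0) g^-1) * cexp (z ^+ 2 / 2 * box_sum N).
  rewrite mulr_sumr /box_sum mulr_sumr !cexp_sum /box_cst -!big_split /=.
  apply: eq_bigr => g g0; rewrite /wfactor cexpD.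
  have -> : 2^-1 * (z / g) ^+ 2 = z ^+ 2 / 2 * g^-1 ^+ 2 by rewrite exprMn; ring.
  have -> : 1 - z / g = (z - g) * - g^-1 by field.
  by rewrite mulrA.
rewrite box_sum1 mulr0 cexp0 mulr1 /box_prod (bigD1_seq 0) ?mem0_box ?box_seq_uniq//= subr0.
ring.
Qed.

(** The row by which the boxes shifted by plus and minus [w1 / 2] differ at one edge; the opposite
    edge is its negative. *)
Definition half_row N (k : 'I_(N.*2.+1)) : C :=
  (N%:R + 2^-1) * w1 + (offset k)%:~R * w2.

Lemma half_row_nm N k : latmin w1 w2 * (N.+1%:R / 2) <= nm (@half_row N k).
Proof.
have d0 := latmin_gt0 S0.
have := lattice_nm S0 (N.*2.+1)%:Z (2 * offset k).
have -> : (N.*2.+1)%:Z%:~R * w1 + (2 * offset k)%:~R * w2 = 2 * half_row k.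
  rewrite /half_row intrM -[(N.*2.+1)%:Z%:~R]/((N.*2.+1)%:R : C) -addn1 natrD -muln2 natrM.
  by rewrite -[2%:~R]/(2 : C); field.
rewrite nmM nm_nat => h.
have : latmin w1 w2 * (N.+1%:R : R) <= 2 * nm (half_row k); last lra.
apply: le_trans h; rewrite ler_pM2l// -natrD ler_nat /=; lia.
Qed.

Lemma half_row_neq0 N k : @half_row N k != 0.
Proof.
rewrite -nm_gt0; apply: lt_le_trans (half_row_nm k).
by rewrite mulr_gt0 ?latmin_gt0// divr_gt0.
Qed.

Lemma natr_doubleS N : (N.*2.+1)%:R = 2 * N%:R + 1 :> C.
Proof. by rewrite -addn1 natrD -muln2 natrM mulrC. Qed.

(** Shifting by [w1] trades one edge row of the box for the opposite one, and all other factors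
    cancel. The sign comes from the odd number [2 N + 1] of points in a row; it becomes the sign in
    the quasi-periodicity of sigma. *)
Lemma box_prod_shift N t :
  box_prod N (t + w1 / 2) * \prod_(k < N.*2.+1) (half_row k - t) =
  - (box_prod N (t - w1 / 2) * \prod_(k < N.*2.+1) (half_row k + t)).
Proof.
pose a (i : 'I_(N.*2.+1)) (k : nat) : C :=
  t + w1 / 2 - (k%:R - N%:R) * w1 - (offset i)%:~R * w2.
have ho (k : 'I_(N.*2.+1)) : (offset k)%:~R = k%:R - N%:R :> C by rewrite /offset intrB.
have e1 : box_prod N (t + w1 / 2) = \prod_i \prod_(k < N.*2.+1) a i k.
  rewrite /box_prod prod_box; apply: eq_bigr => i _; apply: eq_bigr => k _.
  by rewrite /a (ho k); ring.
have e2 : box_prod N (t - w1 / 2) = \prod_i \prod_(k < N.*2.+1) a i k.+1.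
  rewrite /box_prod prod_box; apply: eq_bigr => i _; apply: eq_bigr => k _.
  by rewrite /a (ho k) -addn1 natrD; field.
have e3 : \prod_(k < N.*2.+1) (half_row k + t) = \prod_i a i 0%N.
  rewrite (reindex_inj rev_ord_inj) /=; apply: eq_bigr => i _.
  by rewrite /a /half_row offset_rev intrN; field.
have e4 : - \prod_(k < N.*2.+1) (half_row k - t) = \prod_i a i N.*2.+1.
  transitivity (\prod_(k < N.*2.+1) - (half_row k - t)).
    rewrite prodrN card_ord /= -signr_odd /= odd_double expr1 mulN1r //.
  apply: eq_bigr => i _.
  by rewrite /a /half_row natr_doubleS; field.
rewrite e1 e2 e3 -[X in _ * X]opprK e4 mulrN -!big_split; congr (- _).
apply: eq_bigr => i _ /=.
by rewrite big_ord_recl [in RHS]big_ord_recr /=; under [in RHS]eq_bigr do rewrite /=; ring.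
Qed.

Definition row_prod N t : C := \prod_(k < N.*2.+1) ((1 - t / half_row k) * cexp (t / half_row k)).

Definition row_sum N : C := \sum_(k < N.*2.+1) (half_row k)^-1.

(** Finite form of the quasi-period: [2 * row_sum N] comes from normalizing the two edge rows by
    exponentials, [w1 * box_sum N] from shifting the quadratic exponent. *)
Definition eta_seq N : C := 2 * row_sum N + w1 * box_sum N.

Lemma row_prodE N t : \prod_(k < N.*2.+1) (half_row k - t) =
  \prod_(k < N.*2.+1) (half_row k) * row_prod N t * cexp (- (t * row_sum N)).
Proof.
rewrite /row_prod /row_sum mulr_sumr -sumrN cexp_sum -!big_split /=.
apply: eq_bigr => k _; rewrite cexpN.
have h := half_row_neq0 k; have h' := cexp_neq0 (t / half_row k).
by field; rewrite h h'.
Qed.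

Lemma sigma_box_shift N t :
  sigma_box N (t + w1 / 2) * row_prod N t =
  - (sigma_box N (t - w1 / 2) * row_prod N (- t) * cexp (t * eta_seq N)).
Proof.
have h := box_prod_shift N t.
have e1 : \prod_(k < N.*2.+1) (half_row k + t) =
   \prod_(k < N.*2.+1) (half_row k) * row_prod N (- t) * cexp (t * row_sum N).
  have -> : t * row_sum N = - (- t * row_sum N) by ring.
  by rewrite -row_prodE; apply: eq_bigr => k _; rewrite opprK.
rewrite row_prodE e1 cexpN in h.
have p0 : \prod_(k < N.*2.+1) @half_row N k != 0 by apply/prodf_neq0 => k _; exact: half_row_neq0.
rewrite !sigma_boxE.
have -> : cexp ((t + w1 / 2) ^+ 2 / 2 * box_sum N) =
  cexp ((t - w1 / 2) ^+ 2 / 2 * box_sum N) * cexp (t * (w1 * box_sum N)).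
  by rewrite -cexpD; congr cexp; field.
have -> : cexp (t * eta_seq N) = cexp (t * row_sum N) ^+ 2 * cexp (t * (w1 * box_sum N)).
  by rewrite -cexpMn -cexpD; congr cexp; rewrite /eta_seq; ring.
have c0 := cexp_neq0 (t * row_sum N).
move: h c0 p0; set X := cexp (t * row_sum N); set P := \prod_(k < _) _ => h c0 p0.
have {}h : box_prod N (t + w1 / 2) * row_prod N t =
   - (box_prod N (t - w1 / 2) * row_prod N (- t) * X ^+ 2).
  apply: (mulfI p0); apply: (mulIf (invr_neq0 c0)).
  transitivity (box_prod N (t + w1 / 2) * (P * row_prod N t / X)); first by ring.
  by rewrite h; field.
set A := cexp _; set B := cexp _.
transitivity (box_cst N * A * B * (box_prod N (t + w1 / 2) * row_prod N t)); first by ring.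
by rewrite h; ring.
Qed.

(** There are [2 N + 1] factors, and each is within a multiple of $N^{-2}$ of 1, since the row
    recedes linearly in [N]. *)
Lemma row_prod_lim t : slim (row_prod ^~ t) 1.
Proof.
move=> e e0.
have d0 := latmin_gt0 S0; set d := latmin w1 w2 in d0.
pose q := 2 * nm t / d; have q0 : 0 <= q by rewrite /q !mulr_ge0 ?nm_ge0 ?invr_ge0// ltW.
pose K := (1 + 2 * expR 1) * q ^+ 2 * 2.
have ex0 := expR_ge0 (1 : R).
have K0 : 0 <= K by rewrite /K mulr_ge0// mulr_ge0 ?exprn_ge0//; lra.
have [N0 hN0] := nat_gt (q + 2 * K + 2 * K / e).
have Ke : 0 <= 2 * K / e by rewrite divr_ge0 ?(ltW e0)// mulr_ge0.
exists N0 => N NN.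
have hN : q + 2 * K + 2 * K / e < N.+1%:R.
  by apply: lt_le_trans hN0 _; rewrite ler_nat ltnW.
have n0 : (0 : R) < N.+1%:R by [].
have hx k : nm (t / @half_row N k) <= q / N.+1%:R.
  rewrite nmM nmV /q ler_pdivrMr ?nm_gt0 ?half_row_neq0//.
  have := half_row_nm k; rewrite -/d => h.
  have {1}-> : nm t = 2 * nm t / d / N.+1%:R * (d * (N.+1%:R / 2)).
    by field; rewrite !gt_eqF.
  by rewrite ler_wpM2l// -/q divr_ge0.
have q1 : q / N.+1%:R <= 1 by rewrite ler_pdivrMr// mul1r; lra.
pose b := (1 + 2 * expR 1) * (q / N.+1%:R) ^+ 2.
have [|h _] := @prod_dev R 'I_(N.*2.+1) (index_enum _) xpredT
  (fun k => (1 - t / half_row k) * cexp (t / half_row k)) (fun=> b).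
  move=> k _; apply: le_trans (wfactor1_bound (le_trans (hx k) q1)) _.
  rewrite /b; apply: ler_wpM2l; first lra.
  by apply: lerXn2r (hx k); rewrite nnegrE ?nm_ge0// divr_ge0// ltW.
apply: le_lt_trans h _.
have sb : \sum_(k < N.*2.+1) b <= K / N.+1%:R.
  rewrite sumr_const card_ord -[b *+ _]mulr_natr /b /K exprMn.
  have -> : (1 + 2 * expR 1) * q ^+ 2 * 2 / N.+1%:R =
    (1 + 2 * expR 1) * (q ^+ 2 * N.+1%:R^-1 ^+ 2) * (2 * N.+1%:R) by field; rewrite gt_eqF.
  apply: ler_wpM2l; first by apply: mulr_ge0; [lra|rewrite mulr_ge0 ?exprn_ge0// invr_ge0].
  by rewrite -natrM ler_nat mul2n doubleS.
have s0 : 0 <= \sum_(k < N.*2.+1) b.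
  by apply: sumr_ge0 => k _; rewrite /b mulr_ge0 ?sqr_ge0//; lra.
have k1 : K / N.+1%:R <= 1 / 2 by rewrite ler_pdivrMr//; lra.
have k2 : 2 * (K / N.+1%:R) < e.
  have h2 : 2 * K / e < N.+1%:R by lra.
  by rewrite ltr_pdivrMr// [ltRHS]mulrC in h2; rewrite mulrA ltr_pdivrMr.
apply: le_lt_trans (expR_sub1_le s0 (le_trans sb k1)) _.
by apply: le_lt_trans k2; rewrite ler_pM2l.
Qed.

Lemma half_notin_lattice : ~ G (w1 / 2).
Proof.
move=> [m [n h]].
have : (1 : int)%:~R * w1 + (0 : int)%:~R * w2 = (2 * m)%:~R * w1 + (2 * n)%:~R * w2.
  by rewrite !intrM mul0r addr0 mul1r -!mulrA -mulrDr -h; field.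
by move/(lattice_inj S0) => [h1 _]; move: h1; lia.
Qed.

Lemma near_half_notin t : nm t < latmin w1 w2 / 2 -> ~ G (t - w1 / 2).
Proof.
move=> ht h; have Gt : G (2 * t).
  have -> : 2 * t = (t - w1 / 2) + ((t - w1 / 2) + w1) by field.
  by apply: latticeD => //; apply: latticeD => //; exact: lattice_w1.
have [t0|t0] := eqVneq (2 * t) 0.
  apply: half_notin_lattice; apply/latticeNE.
  by move: t0 h => /eqP; rewrite mulf_eq0 pnatr_eq0 /= => /eqP ->; rewrite add0r.
have := lattice_nm_ge S0 Gt t0; rewrite nmM nm_nat; lra.
Qed.

(** For small [t] sigma vanishes at neither [t + w1 / 2] nor [t - w1 / 2], so [sigma_box_shift] can
    be solved for the exponential. *)
Lemma cexp_eta_lim t : nm t < latmin w1 w2 / 2 ->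
  exists q, q != 0 /\ slim (fun N => cexp (t * eta_seq N)) q.
Proof.
move=> ht.
have s1 : wsigma G (t - w1 / 2) != 0.
  by apply/eqP => /(wsigma_eq0 S0); exact: near_half_notin.
have s2 : wsigma G (t + w1 / 2) != 0.
  apply/eqP => /(wsigma_eq0 S0) h; apply: (@near_half_notin (- t)); first by rewrite nmN.
  by rewrite -opprD; apply/latticeNE.
exists (- (wsigma G (t + w1 / 2) * 1 * (wsigma G (t - w1 / 2) * 1)^-1)); split.
  by rewrite oppr_eq0 !mulr1 mulf_neq0 ?invr_eq0.
have h1 := slimM (sigma_box_lim (t + w1 / 2)) (row_prod_lim t).
have h2 := slimM (sigma_box_lim (t - w1 / 2)) (row_prod_lim (- t)).
have h2n : wsigma G (t - w1 / 2) * 1 != 0 by rewrite mulr1.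
have h3 := slimM (slim_cst (-1)) (slimM h1 (slimV h2n h2)).
rewrite mulN1r in h3.
have nb : 0 < nm (wsigma G (t - w1 / 2) * 1) by rewrite nm_gt0.
have [N0 hN0] := h2 _ nb.
move=> e e0; have [N1 hN1] := h3 e e0; exists (maxn N0 N1) => N.
rewrite geq_max => /andP[/hN0 b0 /hN1].
have {}b0 : sigma_box N (t - w1 / 2) * row_prod N (- t) != 0.
  apply: contraTneq b0 => ->; by rewrite sub0r nmN ltxx.
rewrite sigma_box_shift.
set B := sigma_box _ _ * _ in b0 *; set E := cexp _.
by have -> : -1 * (- (B * E) / B) = E by field.
Qed.

(** Logarithms of moduli at a real [s] and at [i s] give the limits of the real and the imaginary
    part separately, so no branch of the complex logarithm has to be chosen. *)
Lemma eta_seq_lim : exists eta, slim eta_seq eta.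
Proof.
have d0 := latmin_gt0 S0.
pose s := latmin w1 w2 / 4; have s0 : 0 < s by rewrite divr_gt0.
have [|q1 [q10 h1]] := @cexp_eta_lim s%:C.
  by rewrite nm_real gtr0_norm// /s; lra.
have [|q2 [q20 h2]] := @cexp_eta_lim ('i * s%:C).
  by rewrite nmM nm_i mul1r nm_real gtr0_norm// /s; lra.
have {}h1 := cexp_real_lim q10 h1; have {}h2 := cexp_real_lim q20 h2.
exists ((s^-1 * ln (nm q1)) +i* (- s^-1 * ln (nm q2))); apply: slim_ReIm.
  have -> : (fun n => complex.Re (eta_seq n)) = (fun n => s^-1 * complex.Re (s%:C * eta_seq n)).
    by apply/funext => n; rewrite ReM /= mul0r subr0 mulKf ?gt_eqF.
  by apply: cvgM; [exact: cvg_cst|exact: h1].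
have -> : (fun n => complex.Im (eta_seq n)) = (fun n => - s^-1 * complex.Re ('i * s%:C * eta_seq n)).
  apply/funext => n; rewrite mul_i ReM /= mul0r sub0r mulrNN mulKf ?gt_eqF//.
by apply: cvgM; [exact: cvg_cst|exact: h2].
Qed.

Lemma wsigma_shift : exists eta, forall t,
  wsigma G (t + w1 / 2) = - cexp (t * eta) * wsigma G (t - w1 / 2).
Proof.
have [eta heta] := eta_seq_lim; exists eta => t.
have h1 := slimM (sigma_box_lim (t + w1 / 2)) (row_prod_lim t).
have h2 := slimM (sigma_box_lim (t - w1 / 2)) (row_prod_lim (- t)).
have h3 : slim (fun N => cexp (t * eta_seq N)) (cexp (t * eta)).
  have := slim_entire (entire_cexp_lin t 0) heta.
  by rewrite addr0; apply: eq_slim => N; rewrite addr0.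
have h4 := slimM (slim_cst (-1)) (slimM h2 h3).
have {}h4 : slim (fun N => sigma_box N (t + w1 / 2) * row_prod N t)
    (-1 * (wsigma G (t - w1 / 2) * 1 * cexp (t * eta))).
  by apply: eq_slim h4 => N; rewrite sigma_box_shift mulN1r.
have := slim_uniq h1 h4; rewrite !mulr1 => ->; ring.
Qed.

End quasi_period.

(** * Local expansions: derivative, order of vanishing, identity theorem *)

Section coefficients.
Variable R : realType.
Local Notation C := R[i].
Implicit Types (z w c t : C) (f g : C -> C) (a b : nat -> C).

Lemma coefs_at0 f a : coefs f a -> a 0%N = f 0.
Proof.
move=> ha; have [M [M0 hM]] := taylor 1 ha.
have := hM 0; rewrite big_ord1 expr0 mulr1 nm0 => /(_ ler01).
rewrite expr1 mulr0 => h; apply/esym/eqP; rewrite -subr_eq0 -nm_eq0 eq_le nm_ge0 andbT //.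
Qed.

Lemma coefs_cexp c : coefs (fun z => cexp (c * z)) (fun n => c ^+ n / n`!%:R).
Proof.
apply: coefs_of_series => z; apply: eq_slim (exp_sum_cexp (c * z)) => n.
by apply: eq_bigr => k _; rewrite exprMn mulrAC.
Qed.

Lemma coefs_opp f a : coefs f a -> coefs (fun z => f (- z)) (fun n => (-1) ^+ n * a n).
Proof.
move=> ha; apply: coefs_of_series => z; apply: eq_slim (coefs_series (- z) ha) => n.
by apply: eq_bigr => k _; rewrite [(- z) ^+ k]exprNn mulrCA mulrA.
Qed.

Lemma derive1_coef f a z : coefs (fun t => f (t + z)) a -> derive1 f z = a 1%N.
Proof.
move=> ha; have [M [M0 hM]] := taylor 2 ha.
have a0 : a 0%N = f z by rewrite (coefs_at0 ha) add0r.
rewrite /derive1; apply: cvg_lim; first exact: norm_hausdorff.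
apply: (proj2 (cvgC _ _)) => e e0.
pose d := Num.min 1 (e / (M + 1)).
have d0 : 0 < d by rewrite lt_min ltr01 divr_gt0//; lra.
have d1 : d <= 1 by rewrite ge_min lexx.
have d2 : d * (M + 1) <= e by rewrite -ler_pdivlMr; [rewrite ge_min lexx orbT|lra].
exists d%:C; first by rewrite /= ltcR.
move=> h /=; rewrite sub0r normrN nmE ltcR => hd h0.
have h1 := hM h (le_trans (ltW hd) d1).
have nh : 0 < nm h by rewrite nm_gt0.
rewrite !big_ord_recr big_ord0 /= add0r expr0 mulr1 expr1 a0 in h1.
have -> : h^-1 *: (f (h + z) - f z) - a 1%N = h^-1 * (f (h + z) - (f z + a 1%N * h)).
  by rewrite -[_ *: _]/(_ * _); field.
rewrite nmM nmV mulrC ltr_pdivrMr//.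
have h2 : nm h * (M + 1) <= e.
  by apply: le_trans d2; rewrite ler_wpM2r//; [lra|exact: ltW].
apply: le_lt_trans h1 _; rewrite expr2; nra.
Qed.

Lemma linear_vanish c M : 0 <= M -> (forall t, nm t <= 1 -> nm c * nm t <= M * nm t ^+ 2) -> c = 0.
Proof.
move=> M0 h; apply/eqP; rewrite -nm_eq0 eq_le nm_ge0 andbT; apply/ler_addgt0Pr => e e0.
pose d := Num.min 1 (e / (M + 1)).
have d0 : 0 < d by rewrite lt_min ltr01 divr_gt0//; lra.
have d1 : d <= 1 by rewrite ge_min lexx.
have d2 : d * (M + 1) <= e by rewrite -ler_pdivlMr; [rewrite ge_min lexx orbT|lra].
have := h d%:C; rewrite nm_real gtr0_norm// => /(_ d1); rewrite expr2 mulrA ler_pM2r//; nra.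
Qed.

Lemma zero_upper f z : entire f -> f z = 0 -> exists M, 0 <= M /\
  forall t, nm t <= 1 -> nm (f (z + t)) <= M * nm t.
Proof.
move=> hf fz; have [a ha] := entire_coefs (entire_shift z hf).
have [M [M0 hM]] := taylor 1 ha; exists M; split=> // t t1.
by have := hM t t1; rewrite big_ord1 (coefs_at0 ha) add0r fz mul0r subr0 expr1 addrC.
Qed.

Lemma ratio_small f g z (A m d : R) : 0 <= A -> 0 < m -> 0 < d ->
  (forall t, nm t <= d -> nm (f (z + t)) <= A * nm t ^+ 2) ->
  (forall t, nm t <= d -> m * nm t <= nm (g (z + t))) ->
  forall e : R, 0 < e -> exists d', 0 < d' /\
     forall t, nm t <= d' -> nm (f (z + t)) / nm (g (z + t)) <= e.
Proof.
move=> A0 m0 d0 hf hg e e0; pose d' := Num.min d (e * m / (A + 1)).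
have d'0 : 0 < d' by rewrite lt_min d0 divr_gt0 ?mulr_gt0//; lra.
exists d'; split=> // t td.
have td1 : nm t <= d by apply: le_trans td _; rewrite ge_min lexx.
have td2 : nm t * (A + 1) <= e * m.
  by rewrite -ler_pdivlMr; [apply: le_trans td _; rewrite ge_min lexx orbT|lra].
have h1 := hf t td1; have h2 := hg t td1.
have t0 := nm_ge0 t.
have [g0|g0] := eqVneq (nm (g (z + t))) 0; first by rewrite g0 invr0 mulr0 ltW.
rewrite ler_pdivrMr ?lt_def ?g0 ?nm_ge0//.
have : A * nm t ^+ 2 <= e * (m * nm t) by rewrite expr2; nra.
have : e * (m * nm t) <= e * nm (g (z + t)) by rewrite ler_pM2l.
lra.
Qed.

(** Strong induction on the Taylor coefficients at [z0]: if the earlier ones vanish, the [n]-th is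
    at most [M * t] for every small [t] on the segment. *)
Lemma entire_identity f z0 (d : R) : entire f -> 0 < d ->
  (forall t : R, 0 < t -> t <= d -> f (z0 + t%:C) = 0) -> forall z, f z = 0.
Proof.
move=> hf d0 h z.
have [a ha] := entire_coefs (entire_shift z0 hf).
suff a0 n : a n = 0 by have := coefs0_eq0 ha a0 (z - z0); rewrite subrK.
elim/ltn_ind: n => n ih.
have [M [M0 hM]] := taylor n.+1 ha.
have m0 : 0 < Num.min 1 d by rewrite lt_min ltr01.
have key (t : R) : 0 < t -> t <= Num.min 1 d -> nm (a n) <= M * t.
  rewrite le_min => t0 /andP[t1 td].
  have := hM t%:C; rewrite nm_real gtr0_norm// => /(_ t1).
  rewrite big_ord_recr /= big1 ?add0r; last by move=> i _; rewrite ih// mul0r.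
  by rewrite (addrC t%:C z0) h// sub0r nmN nmM nmX nm_real gtr0_norm// exprS mulrA ler_pM2r// exprn_gt0.
apply: (@linear_vanish _ M) => // t t1.
have [->|t0] := eqVneq t 0; first by rewrite nm0 expr0n !mulr0.
rewrite expr2 mulrA ler_wpM2r ?nm_ge0//.
have [td|td] := leP (nm t) (Num.min 1 d); first by apply: key; rewrite ?nm_gt0.
apply: le_trans (key _ m0 (lexx _)) _; by rewrite ler_wpM2l// ltW.
Qed.

End coefficients.

(** * Functions with the quasi-periodicity of theta series *)

Section gauged_sigma.
Variable R : realType.
Local Notation C := R[i].
Variables w1 w2 : C.
Hypothesis S1 : 0 < cell_area w1 w2.
Local Notation G := (lattice w1 w2).
Local Notation S := (cell_area w1 w2).
Local Notation nu := (wnu w1 w2).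
Local Notation mu := (wmu w1 w2).
Implicit Types (z g t : C) (f h : C -> C).

Lemma S_neq0 : S != 0. Proof. by rewrite gt_eqF. Qed.
Local Notation S0 := S_neq0.

Lemma lattice_swap : lattice w2 w1 = G.
Proof. by apply/seteqP; split=> g [m [n ->]]; exists n, m; rewrite addrC. Qed.

Lemma cell_area_swap : cell_area w2 w1 = - S.
Proof. by rewrite /cell_area !ImM !Re_conj !Im_conj; ring. Qed.

(** The shift by [w1] for the exchanged basis. The exchange reverses the orientation, which is why
    the preceding sections assume a nonzero rather than a positive area. *)
Lemma wsigma_shift2 : exists eta, forall t,
  wsigma G (t + w2 / 2) = - cexp (t * eta) * wsigma G (t - w2 / 2).
Proof.
have S0' : cell_area w2 w1 != 0 by rewrite cell_area_swap oppr_eq0 S0.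
by have [eta h] := wsigma_shift S0'; exists eta => t; rewrite -lattice_swap h.
Qed.

Lemma half2_notin : ~ G (w2 / 2).
Proof.
have S0' : cell_area w2 w1 != 0 by rewrite cell_area_swap oppr_eq0 S0.
by rewrite -lattice_swap; exact: half_notin_lattice.
Qed.

(** Oddness turns the shift relation into $\sigma(w/2+z)=e^{z\eta}\sigma(w/2-z)$; comparing the
    coefficients of [z] yields the logarithmic derivative at [w / 2]. It links the zeta values in
    [mu] to the quasi-periods. *)
Lemma wzeta_half w eta : wsigma G (w / 2) != 0 ->
  (forall t, wsigma G (t + w / 2) = - cexp (t * eta) * wsigma G (t - w / 2)) ->
  wzeta G (w / 2) = eta / 2.
Proof.
move=> s0 h.
have [a ha] := entire_coefs (entire_shift (w / 2) (entire_wsigma S0)).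
have hb := coefsM (coefs_cexp eta) (coefs_opp ha).
have {}hb := coefs_uniq ha (eq_coefs _ hb).
have a0 : a 0%N = wsigma G (w / 2) by rewrite (coefs_at0 ha) add0r.
have : a 1%N = eta * a 0%N - a 1%N.
  rewrite {1}hb => [|z]; last by rewrite /= [RHS]h mulNr -mulrN -(wsigmaN S0) opprB (mulrC z) (addrC (- z)).
  rewrite !big_ord_recr big_ord0 /= add0r !expr0 !expr1 !divr1.
  by rewrite !mul1r mulN1r addrC.
rewrite /wzeta (derive1_coef ha) -a0 in s0 * => e1.
have -> : a 1%N = eta * a 0%N / 2.
  have : a 1%N + a 1%N = eta * a 0%N by rewrite {1}e1 subrK.
  by move=> <-; field.
by field.
Qed.

Lemma conj_area : w1^* * w2 - w1 * w2^* = 2 * 'i * S%:C.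
Proof.
rewrite /cell_area; case: w1 w2 => [a b] [c d].
by apply: complex_eq; rewrite !(ReD, ImD, ReN, ImN, ReM, ImM, Re_conj, Im_conj) /=; ring.
Qed.

Lemma SC_neq0 : S%:C != 0 :> C.
Proof. by rewrite -nm_eq0 nm_real normr_eq0 S0. Qed.

Lemma i_neq0 : 'i != 0 :> C.
Proof. by rewrite -nm_eq0 nm_i oner_eq0. Qed.

(* The functional equation of the theta series with semi-character [wchi], with
   multiplier [al] (equal to [nu] for the theta series). *)
Definition law (al : C) f := forall w, (w = w1 \/ w = w2) ->
  forall z, f (z + w) = - cexp (al * w^* * (z + w / 2)) * f z.

Definition gsigma z := cexp (- (mu / 2 * z ^+ 2)) * wsigma G z.

(* Legendre's relation holds here only up to the integer [k]; that [k = 1] is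
   never needed. *)
Lemma gsigma_law : exists k : int, law (k%:~R * nu) gsigma.
Proof.
have [eta1 h1] := wsigma_shift S0; have [eta2 h2] := wsigma_shift2.
have s1 : wsigma G (w1 / 2) != 0.
  by apply/eqP => /(wsigma_eq0 S0); exact: (half_notin_lattice S0).
have s2 : wsigma G (w2 / 2) != 0.
  by apply/eqP => /(wsigma_eq0 S0); exact: half2_notin.
have emu : mu = 'i / S%:C * (eta1 / 2 * w2^* - eta2 / 2 * w1^*).
  by rewrite /wmu (wzeta_half s1 h1) (wzeta_half s2 h2).
have h1' z : wsigma G (z + w1) = - cexp ((z + w1 / 2) * eta1) * wsigma G z.
  by have := h1 (z + w1 / 2); rewrite addrK => <-; congr wsigma; field.
have h2' z : wsigma G (z + w2) = - cexp ((z + w2 / 2) * eta2) * wsigma G z.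
  by have := h2 (z + w2 / 2); rewrite addrK => <-; congr wsigma; field.
(* Translating [w1 / 2] by the two periods in either order gives two multipliers, which agree
   because sigma does not vanish there. *)
have leg : cexp (eta1 * w2 - eta2 * w1) = 1.
  pose z := w1 / 2; have e1 : z + w1 + w2 = z + w2 + w1 by ring.
  have h0 := congr1 (wsigma G) e1; rewrite h2' h1' h1' h2' in h0.
  have h : cexp ((z + w1 + w2 / 2) * eta2 + (z + w1 / 2) * eta1) =
           cexp ((z + w2 + w1 / 2) * eta1 + (z + w2 / 2) * eta2).
    apply: (mulIf s1); rewrite !cexpD.
    by move: h0; rewrite -/z !mulNr !mulrN !opprK !mulrA.
  have : cexp ((z + w2 + w1 / 2) * eta1 + (z + w2 / 2) * eta2) /
         cexp ((z + w1 + w2 / 2) * eta2 + (z + w1 / 2) * eta1) = 1.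
    by rewrite -h divff// cexp_neq0.
  by rewrite -cexpN -cexpD => <-; congr cexp; ring.
have [k hk] := cexp_eq1 leg; exists k.
have iS := SC_neq0; have ii := i_neq0.
have i2 : 'i * 'i = -1 :> C by rewrite -expr2 sqr_i.
have enu : k%:~R * nu = (eta1 * w2 - eta2 * w1) / (2 * 'i * S%:C).
  rewrite hk /wnu rmorphM fmorphV /=; field; rewrite ii iS //.
have ca := conj_area.
(* This is what [mu] is made for: each quasi-period splits as [mu * w + k * nu * conj w], and the
   exponential factor in [gsigma] absorbs the first part. *)
have ev : eta1 = mu * w1 + k%:~R * nu * w1^*.
  rewrite enu emu.
  transitivity (eta1 * (w1^* * w2 - w1 * w2^*) / (2 * 'i * S%:C)); first by rewrite ca; field; rewrite ii iS.
  have -> : 'i / S%:C = - (1 / ('i * S%:C)) :> C.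
    by apply: (mulIf (mulf_neq0 ii iS)); rewrite mulNr mulfVK ?mulf_neq0//; rewrite mulrACA i2; field.
  by field; rewrite ii iS.
have ev2 : eta2 = mu * w2 + k%:~R * nu * w2^*.
  rewrite enu emu.
  transitivity (eta2 * (w1^* * w2 - w1 * w2^*) / (2 * 'i * S%:C)); first by rewrite ca; field; rewrite ii iS.
  have -> : 'i / S%:C = - (1 / ('i * S%:C)) :> C.
    by apply: (mulIf (mulf_neq0 ii iS)); rewrite mulNr mulfVK ?mulf_neq0//; rewrite mulrACA i2; field.
  by field; rewrite ii iS.
have key (A B D E s : C) : A * B = D * E -> A * (- B * s) = - D * (E * s).
  by move=> h; transitivity (- (A * B) * s); [ring|rewrite h; ring].
move=> w [->|->] z; rewrite /gsigma ?h1' ?h2'; apply: key; rewrite -!cexpD; congr cexp.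
  by rewrite ev; field.
by rewrite ev2; field.
Qed.

Lemma nm_sqrD z w : nm (z + w) ^+ 2 - nm z ^+ 2 = 2 * complex.Re (w^* * (z + w / 2)).
Proof.
rewrite !nm_sqr; have -> : w / 2 = (2^-1 : R)%:C * w by rewrite fmorphV rmorph_nat mulrC.
case: z w => [a b] [c d].
by rewrite !(ReD, ImD, ReM, ImM, Re_conj, Im_conj) /=; field.
Qed.

(** The modulus form of [law]: phases are forgotten, but the weight [r] adds under products and is
    multiplied by 4 under doubling of the argument. Quotients of equal weight are periodic in
    modulus. *)
Definition gper (r : R) f := forall g, G g -> forall z,
  nm (f (z + g)) * expR (- (r / 2 * nm (z + g) ^+ 2)) = nm (f z) * expR (- (r / 2 * nm z ^+ 2)).

Lemma gper_gen (r : R) f :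
  (forall w, (w = w1 \/ w = w2) -> forall z,
    nm (f (z + w)) = expR (r * complex.Re (w^* * (z + w / 2))) * nm (f z)) -> gper r f.
Proof.
move=> h g [m [n ->]] z.
pose phi z := nm (f z) * expR (- (r / 2 * nm z ^+ 2)).
have hw w : (w = w1 \/ w = w2) -> forall z, phi (z + w) = phi z.
  move=> hw z'; rewrite /phi h// mulrAC mulrC -expRD; congr (_ * expR _).
  have := nm_sqrD z' w; set A := complex.Re _; set B := nm (z' + w) ^+ 2; set D := nm z' ^+ 2.
  move=> e; have -> : A = (B - D) / 2 by rewrite e; field.
  by field.
rewrite -/(phi _) -/(phi z) addrA (int_periodic n); last by apply: hw; right.
by rewrite int_periodic//; apply: hw; left.
Qed.

Lemma law_gper (r : R) f : law r%:C f -> gper r f.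
Proof.
move=> h; apply: gper_gen => w hw z; rewrite h// nmM nmN nm_cexp -mulrA.
by congr (expR _ * _); rewrite ReM /= mul0r subr0.
Qed.

Lemma gperM (r s : R) f h : gper r f -> gper s h -> gper (r + s) (fun z => f z * h z).
Proof.
move=> hf hh g Gg z; rewrite !nmM !mulrDl !opprD !expRD.
have := hf g Gg z; have := hh g Gg z => e1 e2.
by rewrite mulrACA [in RHS]mulrACA e1 e2.
Qed.

Lemma gper_cst (c : C) : gper 0 (fun=> c).
Proof. by move=> g Gg z; rewrite !mul0r. Qed.

Lemma gperX (r : R) f n : gper r f -> gper (n%:R * r) (fun z => f z ^+ n).
Proof.
move=> hf; elim: n => [|n ih].
  by rewrite mul0r; move=> g Gg z; rewrite !expr0 !mul0r.
rewrite mulrSr mulrDl mul1r addrC.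
by have := gperM hf ih; under eq_fun do rewrite -exprS.
Qed.

Lemma gper_double (r : R) f : gper r f -> gper (4 * r) (fun z => f (2 * z)).
Proof.
move=> hf g Gg z; have G2 : G (2 * g).
  by rewrite mulrDl mul1r; apply: latticeD.
have := hf _ G2 (2 * z); rewrite -mulrDr !nmM nm_nat !exprMn.
have e (x : R) : r / 2 * (2 ^+ 2 * x) = 4 * r / 2 * x by field.
by rewrite !e.
Qed.

Lemma gper_zero (r : R) f g z : gper r f -> G g -> f (z + g) = 0 <-> f z = 0.
Proof.
move=> hf Gg; have := hf g Gg z => h; split=> e; move: h; rewrite e nm0 mul0r.
  by move/esym/eqP; rewrite mulf_eq0 (gt_eqF (expR_gt0 _)) orbF nm_eq0 => /eqP.
by move/eqP; rewrite mulf_eq0 (gt_eqF (expR_gt0 _)) orbF nm_eq0 => /eqP.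
Qed.

Lemma gper_ratio (r : R) f h : entire f -> entire h -> gper r f -> gper r h ->
  (exists z, h z != 0) -> (forall z, h z = 0 -> f z = 0) ->
  (forall z (e : R), h z = 0 -> 0 < e -> exists d : R, 0 < d /\
     forall t, nm t <= d -> nm (f (z + t)) / nm (h (z + t)) <= e) ->
  exists c, forall z, f z = c * h z.
Proof.
move=> ef eh pf ph; have key w : G w -> forall z,
    nm (f (z + w)) / nm (h (z + w)) = nm (f z) / nm (h z).
  move=> Gw z; have := pf w Gw z; have := ph w Gw z.
  set A := expR _; set B := expR _ => e1 e2.
  have A0 : A != 0 by rewrite gt_eqF// expR_gt0.
  have B0 : B != 0 by rewrite gt_eqF// expR_gt0.
  have -> : nm (f (z + w)) = nm (f z) * (B / A) by rewrite mulrA -e2 mulfK.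
  have -> : nm (h (z + w)) = nm (h z) * (B / A) by rewrite mulrA -e1 mulfK.
  by rewrite -mulf_div divff ?mulr1// mulf_neq0// invr_eq0.
apply: (periodic_ratio S0) => //; apply: key; [exact: lattice_w1|exact: lattice_w2].
Qed.

Lemma entire_gsigma : entire gsigma.
Proof.
apply: entireM; last exact: (entire_wsigma S0).
apply: eq_entire (entire_cexp (- (mu / 2) *: 'X^2)) => z.
by rewrite hornerZ hornerXn mulNr.
Qed.

Lemma gsigma_eq0 z : gsigma z = 0 <-> G z.
Proof.
rewrite -(wsigma_eq0 S0) /gsigma; split=> [/eqP|->]; last by rewrite mulr0.
by rewrite mulf_eq0 (negbTE (cexp_neq0 _)) => /eqP.
Qed.

Lemma gsigma_near0 : exists M : R, 0 <= M /\
  forall t, nm t <= 1 -> nm (gsigma t - t) <= M * nm t ^+ 2.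
Proof.
have [M [M0 hM]] := wsigma_near0 S0.
pose c := - (mu / 2); pose E := expR (nm c).
have E0 : 0 < E := expR_gt0 _.
exists (nm c * E * (M + 1) + M); split; first by rewrite addr_ge0// !mulr_ge0 ?nm_ge0 ?(ltW E0)//; lra.
move=> t t1; have t0 := nm_ge0 t.
have -> : gsigma t - t = (cexp (c * t ^+ 2) - 1) * wsigma G t + (wsigma G t - t).
  by rewrite /gsigma /c mulNr; ring.
have t2 : nm t ^+ 2 <= 1 by rewrite exprn_ile1.
apply: le_trans (nmD _ _) _; rewrite [leRHS]mulrDl; apply: lerD; last exact: hM.
rewrite nmM.
have h1 : nm (cexp (c * t ^+ 2) - 1) <= nm c * nm t ^+ 2 * E.
  apply: le_trans (cexp_taylor1 _) _; rewrite nmM nmX ler_wpM2l ?mulr_ge0 ?nm_ge0 ?exprn_ge0//.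
  by rewrite ler_expR ler_piMr ?nm_ge0.
have h2 : nm (wsigma G t) <= M + 1.
  have := hM t t1; have := nm_triB (wsigma G t) t; nra.
have := ler_pM (nm_ge0 _) (nm_ge0 _) h1 h2; lra.
Qed.

(** Local estimates at a lattice point thereby follow from those at 0. For [nm t <= 1] the exponent
    changes by at most a multiple of $|z|(2+|z|)$. *)
Lemma gper_comparable (r : R) f z : gper r f -> G z -> exists B : R, 0 < B /\
  forall t, nm t <= 1 -> B^-1 * nm (f t) <= nm (f (z + t)) <= B * nm (f t).
Proof.
move=> hper Gz; pose B := `|r| / 2 * (2 * nm z + nm z ^+ 2).
exists (expR B); split; first exact: expR_gt0.
move=> t t1; have t0 := nm_ge0 t; have z0 := nm_ge0 z.
have := hper z Gz t; rewrite [t + z]addrC.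
set X := expR (- (r / 2 * nm t ^+ 2)); set Y := expR _ => e1.
have -> : nm (f (z + t)) = X / Y * nm (f t).
  by rewrite mulrAC [X * _]mulrC -e1 mulfK// gt_eqF// expR_gt0.
have : `|r / 2 * (nm (z + t) ^+ 2 - nm t ^+ 2)| <= B.
  have h4 : `|nm (z + t) ^+ 2 - nm t ^+ 2| <= 2 * nm z + nm z ^+ 2.
    have h5 := nmD z t; have h6 := nm_dist (z + t) t.
    have e2 : nm (z + t) ^+ 2 - nm t ^+ 2 = (nm (z + t) - nm t) * (nm (z + t) + nm t) by ring.
    rewrite addrK in h6; rewrite e2 normrM (ger0_norm (_ : 0 <= nm (z + t) + nm t)) ?addr_ge0 ?nm_ge0//.
    have := normr_ge0 (nm (z + t) - nm t); have := nm_ge0 (z + t); nra.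
  rewrite normrM /B; apply: ler_pM => //.
  by rewrite normrM (@ger0_norm _ 2^-1) ?invr_ge0.
rewrite ler_norml => /andP[h1 h2].
have e3 : X / Y = expR (r / 2 * (nm (z + t) ^+ 2 - nm t ^+ 2)).
  by rewrite /X /Y -expRN -expRD; congr expR; ring.
by rewrite e3 -expRN !ler_wpM2r ?nm_ge0 ?ler_expR.
Qed.

Lemma gsigma_lower z : G z -> exists m d : R, [/\ 0 < m, 0 < d &
  forall t, nm t <= d -> m * nm t <= nm (gsigma (z + t))].
Proof.
move=> Gz; have [k hk] := gsigma_law.
have hper : gper (k%:~R * (pi / S)) gsigma.
  by apply: law_gper; rewrite rmorphM /= rmorph_int.
have [B [B0 hB]] := gper_comparable hper Gz.
have [M [M0 hM]] := gsigma_near0.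
exists (B^-1 * 2^-1), (Num.min 1 (2^-1 / (M + 1))); split.
- by rewrite mulr_gt0 ?invr_gt0.
- by rewrite lt_min ltr01 divr_gt0 ?invr_gt0//; lra.
move=> t; rewrite le_min => /andP[t1]; rewrite ler_pdivlMr; last lra.
move=> t2; have t0 := nm_ge0 t.
have /andP[h1 _] := hB t t1; apply: le_trans h1.
rewrite -mulrA ler_wpM2l ?invr_ge0 ?(ltW B0)//.
have := hM t t1; have := nm_triB t (gsigma t); rewrite nmB expr2; nra.
Qed.

Lemma double_zero_upper (u v : C -> C) z n : entire u -> entire v -> u z = 0 -> (2 <= n)%N ->
  exists A : R, 0 <= A /\ forall t, nm t <= 1 -> nm (u (z + t) ^+ n * v (z + t)) <= A * nm t ^+ 2.
Proof.
move=> eu ev uz n2; have [M [M0 hM]] := zero_upper eu uz.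
have [B [B0 hB]] := entire_bounded (nm z + 1) ev.
exists (M ^+ n * B); split; first by rewrite mulr_ge0 ?exprn_ge0.
move=> t t1; have t0 := nm_ge0 t; rewrite nmM nmX mulrAC; apply: ler_pM; rewrite ?exprn_ge0 ?nm_ge0//.
  apply: (@le_trans _ _ ((M * nm t) ^+ n)).
    by apply: lerXn2r (hM t t1); rewrite nnegrE ?nm_ge0// mulr_ge0.
  by rewrite exprMn ler_wpM2l ?exprn_ge0// ler_wiXn2l.
by apply: hB; apply: le_trans (nmD _ _) _; rewrite lerD2l.
Qed.

(** The quotient is a constant, and at a zero of [h] the bounds [A * nm t ^+ 2] and [m * nm t] force
    this constant to be 0. *)
Lemma gper_double_zero (r : R) f h : entire f -> entire h -> gper r f -> gper r h ->
  (exists z, h z != 0) -> (exists z, h z = 0) ->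
  (forall z, h z = 0 -> exists A m d : R, [/\ 0 <= A, 0 < m, 0 < d,
     forall t, nm t <= d -> nm (f (z + t)) <= A * nm t ^+ 2 &
     forall t, nm t <= d -> m * nm t <= nm (h (z + t))]) ->
  forall z, f z = 0.
Proof.
move=> ef eh pf ph hn0 [z0 hz0] hb.
have [z hz|z e hz e0|c hc] := gper_ratio ef eh pf ph hn0.
- have [A [m [d [A0 m0 d0 h1 _]]]] := hb z hz.
  have := h1 0; rewrite nm0 addr0 expr0n mulr0 => /(_ (ltW d0)) h2.
  by apply/eqP; rewrite -nm_eq0 eq_le nm_ge0 h2.
- have [A [m [d [A0 m0 d0 h1 h2]]]] := hb z hz.
  exact: (ratio_small A0 m0 d0).
have [A [m [d [A0 m0 d0 h1 h2]]]] := hb z0 hz0.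
suff c0 : c = 0 by move=> z; rewrite hc c0 mul0r.
apply/eqP; rewrite -nm_eq0 eq_le nm_ge0 andbT; apply/ler_addgt0Pr => e e0; rewrite add0r.
pose x := Num.min d (e * m / (A + 1)).
have x0 : 0 < x by rewrite lt_min d0 divr_gt0 ?mulr_gt0//; lra.
have xd : x <= d by rewrite ge_min lexx.
have xA : x * (A + 1) <= e * m by rewrite -ler_pdivlMr; [rewrite ge_min lexx orbT|lra].
have nx : nm x%:C = x by rewrite nm_real gtr0_norm.
have := h1 x%:C; have := h2 x%:C; rewrite nx hc nmM => /(_ xd) h3 /(_ xd) h4.
have nc := nm_ge0 c.
have h5 : nm c * (m * x) <= A * x ^+ 2.
  by apply: le_trans h4; rewrite ler_wpM2l.
have h6 : nm c * m <= A * x.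
  by rewrite -(ler_pM2r x0) -!mulrA -expr2.
rewrite -(ler_pM2r m0); nra.
Qed.

(** For [k <= 0] the product of [gsigma] with the power [|k|] of [f] has weight 0, so it is
    constant, equal to its value 0 at the origin; off the lattice [gsigma] can be divided out. For
    [k = 0] this is a contradiction. *)
Lemma nonpos_law_eq0 (k : int) f : k <= 0 -> law (k%:~R * nu) gsigma ->
  entire f -> gper (pi / S) f -> forall z, ~ G z -> f z = 0.
Proof.
move=> k0 hk ef pf z nGz.
have pF : gper (k%:~R * (pi / S)) gsigma.
  by apply: law_gper; rewrite rmorphM /= rmorph_int.
have Fz : gsigma z != 0 by apply/eqP => /gsigma_eq0.
have p0 : gper 0 (fun z => gsigma z * f z ^+ `|k|%N).
  have := gperM pF (gperX `|k|%N pf).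
  rewrite -mulrDl natr_absz ler0_norm// rmorphN addrN mul0r; exact.
have [|||c hc] := gper_ratio (entireM entire_gsigma (entireX `|k|%N ef)) (entire_cst 1) p0 (gper_cst 1).
- by exists 0; exact: oner_neq0.
- by move=> ? /eqP; rewrite oner_eq0.
- by move=> ? ? /eqP; rewrite oner_eq0.
have c0 : c = 0.
  by have := hc 0; rewrite mulr1 => <-; rewrite (proj2 (gsigma_eq0 0)) ?mul0r//; exact: lattice0.
have /eqP := hc z; rewrite c0 mul0r mulf_eq0 (negbTE Fz) /= expf_eq0 => /andP[_ /eqP//].
Qed.

Lemma off_lattice_eq0 f : entire f -> (forall z, ~ G z -> f z = 0) -> forall z, f z = 0.
Proof.
move=> ef h; have l0 := latmin_gt0 S0.
apply: (@entire_identity _ _ 0 (latmin w1 w2 / 2) ef); first by rewrite divr_gt0.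
move=> t t0 td; rewrite add0r; apply: h => Gt.
have tn : t%:C != 0 by rewrite -nm_eq0 nm_real normr_eq0 gt_eqF.
by have := lattice_nm_ge S0 Gt tn; rewrite nm_real gtr0_norm//; lra.
Qed.

(** Split on the unknown [k]. For [k = 1], [f] minus its first Taylor coefficient times [gsigma] has
    a double zero at 0, hence on the lattice; for [k >= 2] the power [f ^ k] has the weight of
    [gsigma] and multiple zeros. In the remaining cases [f] is 0. *)
Lemma law_zero_multiple f : entire f -> law nu f -> f 0 = 0 ->
  exists c, forall z, f z = c * gsigma z.
Proof.
move=> ef lf f0; have pf : gper (pi / S) f by exact: law_gper.
have fG z : G z -> f z = 0 by move=> Gz; rewrite -(add0r z); apply/(gper_zero 0 pf).
have [k hk] := gsigma_law.
have pF : gper (k%:~R * (pi / S)) gsigma.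
  by apply: law_gper; rewrite rmorphM /= rmorph_int.
have ex1 : exists z, gsigma z != 0.
  by exists (w1 / 2); apply/eqP => /gsigma_eq0; exact: (half_notin_lattice S0).
have ex0 : exists z, gsigma z = 0 by exists 0; apply/gsigma_eq0; exact: lattice0.
have [k0|] := leP k 0.
  exists 0 => z; rewrite mul0r; apply: off_lattice_eq0 => // {}z.
  exact: nonpos_law_eq0 k0 hk ef pf z.
case: k hk pF => // -[//|[|n]] hk pF _.
- rewrite mul1r in pF.
  have e1 : (Posz 1)%:~R * nu = nu by rewrite mul1r.
  rewrite e1 in hk.
  have [a ha] := entire_coefs ef.
  exists (a 1%N) => z; apply/eqP; rewrite -subr_eq0; apply/eqP; move: z.
  have lG : law nu (fun z => f z - a 1%N * gsigma z).
    by move=> w hw z; rewrite lf// hk//; ring.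
  have pG := law_gper lG.
  have eG := entireB ef (entireZ (a 1%N) entire_gsigma).
  apply: (gper_double_zero eG entire_gsigma pG pF ex1 ex0) => z /gsigma_eq0 Gz.
  have [m [d [m0 d0 hm]]] := gsigma_lower Gz.
  have [B [B0 hB]] := gper_comparable pG Gz.
  have [M [M0 hM]] := taylor 2 ha.
  have [M' [M'0 hM']] := gsigma_near0.
  exists (B * (M + nm (a 1%N) * M')), m, (Num.min 1 d); split=> //.
  + by rewrite mulr_ge0 ?(ltW B0)// addr_ge0// mulr_ge0 ?nm_ge0.
  + by rewrite lt_min ltr01.
  + move=> t; rewrite le_min => /andP[t1 _].
    have /andP[_ h1] := hB t t1; apply: le_trans h1 _; rewrite -mulrA ler_wpM2l ?(ltW B0)//.
    have := hM t t1; have := hM' t t1.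
    rewrite !big_ord_recr big_ord0 /= add0r expr0 mulr1 expr1 (coefs_at0 ha) f0 add0r => h2 h3.
    have -> : f t - a 1%N * gsigma t = (f t - a 1%N * t) - a 1%N * (gsigma t - t) by ring.
    apply: le_trans (nmD _ _) _; rewrite nmN [leRHS]mulrDl; apply: lerD => //.
    by rewrite nmM -mulrA ler_wpM2l ?nm_ge0.
  + by move=> t; rewrite le_min => /andP[_]; exact: hm.
exists 0 => z; rewrite mul0r.
suff /eqP : f z ^+ n.+2 = 0 by rewrite expf_eq0 => /eqP.
move: z; apply: (gper_double_zero (entireX n.+2 ef) entire_gsigma (gperX n.+2 pf) pF ex1 ex0).
move=> z /gsigma_eq0 Gz.
have [m [d [m0 d0 hm]]] := gsigma_lower Gz.
have [A [A0 hA]] := @double_zero_upper f (fun=> 1) z n.+2 ef (entire_cst 1) (fG z Gz) isT.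
exists A, m, (Num.min 1 d); split=> //; first by rewrite lt_min ltr01.
  by move=> t; rewrite le_min => /andP[t1 _]; have := hA t t1; rewrite mulr1.
by move=> t; rewrite le_min => /andP[_]; exact: hm.
Qed.

(* [f] is odd under the reflections in the half periods, so [f^(2k) F^2] has
   at least a double zero at each simple zero of [F (2 z)]. *)
Lemma even_law_eq0 f : entire f -> law nu f -> (forall z, f (- z) = f z) -> forall z, f z = 0.
Proof.
move=> ef lf fN.
have pf : gper (pi / S) f by exact: law_gper.
(* At [- w / 2] the multiplier is [-1], and evenness gives [f (w / 2) = - f (w / 2)]. *)
have half w : (w = w1 \/ w = w2) -> f (w / 2) = 0.
  move=> hw; have := lf w hw (- (w / 2)).
  have -> : - (w / 2) + w = w / 2 by field.
  rewrite addNr mulr0 cexp0 fN mulN1r => /eqP; rewrite -subr_eq0 opprK -mulr2n.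
  by rewrite mulrn_eq0 /= => /eqP.
(* The signs of two applications of [law] cancel, but by [conj_area] their exponents add up to
   [- i pi], so the value is again its own opposite. *)
have half12 : f ((w1 + w2) / 2) = 0.
  pose u := - ((w1 + w2) / 2).
  have e1 : f (u + w1 + w2) = f ((w1 + w2) / 2) by congr f; rewrite /u; field.
  have := lf w2 (or_intror erefl) (u + w1); rewrite (lf w1 (or_introl erefl)) e1 /u fN.
  rewrite !mulNr mulrN opprK mulrA -cexpD.
  have -> : nu * w2^* * (- ((w1 + w2) / 2) + w1 + w2 / 2) + nu * w1^* * (- ((w1 + w2) / 2) + w1 / 2)
     = - ('i * pi%:C).
    transitivity (- (nu / 2 * (w1^* * w2 - w1 * w2^*))).
      by move: w1^* w2^* (wnu w1 w2) => a b n; field.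
    rewrite (conj_area) /wnu rmorphM fmorphV /=; field; exact: SC_neq0.
  rewrite cexpN cexp_pi invrN1 mulN1r => /eqP; rewrite -subr_eq0 opprK -mulr2n.
  by rewrite mulrn_eq0 /= => /eqP.
have fz0 z : G (2 * z) -> ~ G z -> f z = 0.
  move=> [m [n e]] nG.
  have ez : z = (m%:~R * w1 + n%:~R * w2) / 2 by rewrite -e; field.
  have hh (x : int) : x = 2 * (x %/ 2)%Z + (x %% 2)%Z by lia.
  have [p0|[p1|[p2|p3]]] : ((m %% 2)%Z = 0 /\ (n %% 2)%Z = 0) \/ ((m %% 2)%Z = 1 /\ (n %% 2)%Z = 0) \/
    ((m %% 2)%Z = 0 /\ (n %% 2)%Z = 1) \/ ((m %% 2)%Z = 1 /\ (n %% 2)%Z = 1) by lia.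
  - case: nG; exists (m %/ 2)%Z, (n %/ 2)%Z.
    by rewrite ez [in LHS](hh m) [in LHS](hh n) p0.1 p0.2 !addr0 !intrM; field.
  - have -> : z = w1 / 2 + ((m %/ 2)%Z%:~R * w1 + (n %/ 2)%Z%:~R * w2).
      by rewrite ez {1}(hh m) {1}(hh n) p1.1 p1.2 addr0 intrD !intrM; field.
    by apply/(gper_zero _ pf); [exists (m %/ 2)%Z, (n %/ 2)%Z|apply: half; left].
  - have -> : z = w2 / 2 + ((m %/ 2)%Z%:~R * w1 + (n %/ 2)%Z%:~R * w2).
      by rewrite ez {1}(hh m) {1}(hh n) p2.1 p2.2 addr0 intrD !intrM; field.
    by apply/(gper_zero _ pf); [exists (m %/ 2)%Z, (n %/ 2)%Z|apply: half; right].
  - have -> : z = (w1 + w2) / 2 + ((m %/ 2)%Z%:~R * w1 + (n %/ 2)%Z%:~R * w2).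
      by rewrite ez {1}(hh m) {1}(hh n) p3.1 p3.2 !intrD !intrM; field.
    by apply/(gper_zero _ pf); [exists (m %/ 2)%Z, (n %/ 2)%Z|].
have [k hk] := gsigma_law.
have pF : gper (k%:~R * (pi / S)) gsigma.
  by apply: law_gper; rewrite rmorphM /= rmorph_int.
apply: off_lattice_eq0 => // z nGz.
have Fz : gsigma z != 0 by apply/eqP => /gsigma_eq0.
have [k0|] := leP k 0; first exact: nonpos_law_eq0 k0 hk ef pf z nGz.
case: k hk pF => // -[//|n] hk pF _.
(* With [k = n + 1]: weight [2 k] from [f ^ (2 k)] and [2 k] from [gsigma ^ 2] match the [4 k] of
   [gsigma (2 z)]. *)
have pG : gper (4 * (n.+1%:~R * (pi / S))) (fun z => f z ^+ (2 * n.+1) * gsigma z ^+ 2).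
  have := gperM (gperX (2 * n.+1) pf) (gperX 2 pF).
  have -> : (2 * n.+1)%:R * (pi / S) + 2 * (n.+1%:~R * (pi / S)) = 4 * (n.+1%:~R * (pi / S)).
    by rewrite natrM -[n.+1%:~R]/(n.+1%:R); ring.
  exact.
have eG := entireM (entireX (2 * n.+1) ef) (entireX 2 entire_gsigma).
have eF2 : entire (fun z => gsigma (2 * z)).
  by apply: eq_entire (entire_affine 2 0 entire_gsigma) => ?; rewrite addr0.
suff /eqP : f z ^+ (2 * n.+1) * gsigma z ^+ 2 = 0.
  rewrite mulf_eq0 !expf_eq0 (negbTE Fz) andbF orbF => /andP[_ /eqP//].
apply: (gper_double_zero eG eF2 pG (gper_double pF)).
- exists (w1 / 2 / 2); rewrite mulrC divfK ?pnatr_eq0//.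
  by apply/eqP => /gsigma_eq0; exact: (half_notin_lattice S0).
- by exists 0; rewrite mulr0; apply/gsigma_eq0; exact: lattice0.
- clear z nGz Fz; move=> z /gsigma_eq0 G2z.
  have [m [d [m0 d0 hm]]] := gsigma_lower G2z.
  (* At lattice points, where [f] is not known to vanish, [gsigma ^ 2] supplies the double zero; at
     the other half periods the even power of [f] does. *)
  have hA : exists A : R, 0 <= A /\ forall t, nm t <= 1 ->
      nm (f (z + t) ^+ (2 * n.+1) * gsigma (z + t) ^+ 2) <= A * nm t ^+ 2.
    have [Gz|nGz] := pselect (G z).
      have [|A [A0 hA]] := @double_zero_upper gsigma (fun z => f z ^+ (2 * n.+1)) z 2 entire_gsigma (entireX _ ef) _ isT.
        exact/gsigma_eq0.
      by exists A; split=> // t t1; rewrite mulrC; exact: hA.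
    apply: (@double_zero_upper f (fun z => gsigma z ^+ 2) z) => //.
    - exact: entireX entire_gsigma.
    - exact: fz0.
    - by rewrite mulnS.
  have [A [A0 {}hA]] := hA.
  exists A, (m * 2), (Num.min 1 (d / 2)); split=> //.
  + by rewrite mulr_gt0.
  + by rewrite lt_min ltr01 divr_gt0.
  + by move=> t; rewrite le_min => /andP[t1 _]; exact: hA.
  + move=> t; rewrite le_min => /andP[_ td].
    by have := hm (2 * t); rewrite -mulrDr nmM nm_nat -mulrA; apply; lra.
Qed.

End gauged_sigma.

(** * The two-variable theta series *)

Section theta.
Variable R : realType.
Local Notation C := R[i].
Variables w1 w2 : C.
Hypothesis S1 : 0 < cell_area w1 w2.
Local Notation G := (lattice w1 w2).
Local Notation S := (cell_area w1 w2).
Local Notation nu := (wnu w1 w2).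
Local Notation mu := (wmu w1 w2).
Local Notation S0 := (S_neq0 S1).
Local Notation F := (gsigma w1 w2).
Implicit Types (z g t b : C) (f h : C -> C).

Lemma coefs_sum (I : Type) (s : seq I) (P : pred I) (f : I -> C -> C) (a : I -> nat -> C) :
  (forall i, coefs (f i) (a i)) ->
  coefs (fun z => \sum_(i <- s | P i) f i z) (fun n => \sum_(i <- s | P i) a i n).
Proof.
move=> h; elim: s => [|i s ih].
  have -> : (fun z => \sum_(i <- [::] | P i) f i z) = horner 0.
    by apply/funext => z; rewrite big_nil horner0.
  have -> : (fun n => \sum_(i <- [::] | P i) a i n) = (fun n => (0 : {poly C})`_n).
    by apply/funext => n; rewrite big_nil coef0.
  exact: coefs_poly.
have -> : (fun z => \sum_(j <- i :: s | P j) f j z) =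
    (fun z => if P i then f i z + \sum_(j <- s | P j) f j z else \sum_(j <- s | P j) f j z).
  by apply/funext => z; rewrite big_cons.
have -> : (fun n => \sum_(j <- i :: s | P j) a j n) =
    (fun n => if P i then a i n + \sum_(j <- s | P j) a j n else \sum_(j <- s | P j) a j n).
  by apply/funext => n; rewrite big_cons.
by case: (P i) => //; exact: coefsD.
Qed.

(* Two convertible constants, [conjc] and [Num.conj], share the notation [^*]
   (as do two constants for ['i]); the lemmas below normalise to the latter. *)
Lemma conjE z : conjc z = Num.conj z. Proof. by []. Qed.
Lemma conjD z t : Num.conj (z + t) = Num.conj z + Num.conj t. Proof. exact: rmorphD. Qed.
Lemma conjN z : Num.conj (- z) = - Num.conj z. Proof. exact: rmorphN. Qed.
Lemma conjM z t : Num.conj (z * t) = Num.conj z * Num.conj t. Proof. exact: rmorphM. Qed.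
Lemma conjV z : Num.conj z^-1 = (Num.conj z)^-1. Proof. exact: fmorphV. Qed.
Lemma conjK z : Num.conj (Num.conj z) = z. Proof. exact: conjCK. Qed.
Lemma conj_real (r : R) : Num.conj r%:C = r%:C. Proof. exact: conjc_real. Qed.
Lemma conj_int (k : int) : Num.conj (k%:~R : C) = k%:~R. Proof. exact: rmorph_int. Qed.
Lemma conj_nat n : Num.conj (n%:R : C) = n%:R. Proof. exact: rmorph_nat. Qed.
Lemma conj_cexp z : Num.conj (cexp z) = cexp (Num.conj z). Proof. exact: cexp_conj. Qed.
Lemma conj_nu : Num.conj nu = nu. Proof. exact: conj_real. Qed.
Lemma conj_one : Num.conj (1 : C) = 1. Proof. exact: rmorph1. Qed.
Definition conjS := (conjE, conj_nat, conj_one, conj_int, conj_cexp, conj_nu, conjK, conjV, conjN, conjD, conjM).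

(** Weierstrass's theorem for series dominated by [a3]: convergence is uniform on discs, so by
    Cauchy's estimate Taylor coefficients may be summed term by term. *)
Lemma sum_entire (E : C -> C -> C) : (forall g, entire (E g)) ->
  (forall r : R, exists K, 0 <= K /\ forall g z, G g -> nm z <= r -> nm (E g z) <= K * a3 g) ->
  exists f, [/\ entire f, forall z, has_sum G (fun g => E g z) (f z) &
    forall a (c : C -> nat -> C), coefs f a -> (forall g, coefs (E g) (c g)) ->
      forall n, has_sum G (fun g => c g n) (a n)].
Proof.
move=> eE hE; have [M [M0 hM]] := lattice_bounded_sums S0.
have bs K : 0 <= K -> bounded_sums G (fun g => K * a3 g) (K * M).
  move=> K0; apply: (bounded_sums_le (a := @a3 R) _ _ _ _ hM) => //; exact: a3_ge0.
have /choice [f hf] : forall z, exists s, has_sum G (fun g => E g z) s.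
  move=> z; have [K [K0 hK]] := hE (nm z).
  exact: (has_sum_exists (fun g Gg => hK g z Gg (lexx _)) (bs K K0)).
have unif r e : 0 < e -> exists A0 : {fset C}, forall A, fsubset A0 A ->
    forall z, nm z <= r -> nm (set_psum G (fun g => E g z) A - f z) <= e.
  move=> e0; have [K [K0 hK]] := hE r.
  have [A0 hA0] := small_tail_exists (bs K K0) e0; exists A0 => A hA z zr.
  exact: (psum_tail (fun g Gg => hK g z Gg zr) hA0 hA (hf z)).
exists f; split=> //.
  apply: entire_unif_lim => r e e0; have [A0 hA0] := unif r e e0.
  exists (fun z => set_psum G (fun g => E g z) A0); split; first exact: entire_sum.
  by move=> z zr; rewrite nmB; apply: hA0.
move=> a c ha hc n e e0; have e20 : 0 < e / 2 by lra.
have [A0 hA0] := unif 1 _ e20; exists A0 => A hA.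
have := coefs_close n (coefs_sum (enum_fset A) (fun g => g \in G) hc) ha ltr01 (hA0 A hA).
by rewrite expr1n mulr1 /set_psum; lra.
Qed.

Lemma normsq g : `|g| ^+ 2 = g * g^*.
Proof. exact: sqr_normc. Qed.

Lemma normsq_nm g : `|g| ^+ 2 = (nm g ^+ 2)%:C.
Proof. by rewrite nmE rmorphXn. Qed.

Lemma nu_gt0 : 0 < pi / S.
Proof. by rewrite divr_gt0// pi_gt0. Qed.

Lemma nm_wchi g : nm (wchi G g) = 1.
Proof. by rewrite /wchi; case: ifP; rewrite ?nmN nm1. Qed.

Lemma wchiN g : wchi G (- g) = wchi G g.
Proof.
rewrite /wchi mulNr; congr (if _ then _ else _).
by apply/idP/idP => /set_mem/latticeNE/mem_set.
Qed.

Lemma cexp_pi_int (k : int) : cexp (k%:~R * ('i * pi%:C)) = (if (2 %| k)%Z then 1 else -1) :> C.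
Proof.
have {1}-> : k = (k %/ 2)%Z * 2 + (k %% 2)%Z by lia.
rewrite intrD intrM mulrDl -mulrA cexpD cexp_2pi_int mul1r.
have [/dvdz_mod0P ->|h] := boolP (2 %| k)%Z; first by rewrite mul0r cexp0.
have -> : (k %% 2)%Z = 1 by move: h; lia.
by rewrite mul1r cexp_pi.
Qed.

Lemma wchiE (m n : int) :
  wchi G (m%:~R * w1 + n%:~R * w2) = if (2 %| m)%Z && (2 %| n)%Z then 1 else -1.
Proof.
rewrite /wchi; congr (if _ then _ else _); apply/idP/idP => [/set_mem[m' [n' h]]|/andP[hm hn]].
  have /(lattice_inj S0)[-> ->] : m%:~R * w1 + n%:~R * w2 = (2 * m')%:~R * w1 + (2 * n')%:~R * w2.
    by rewrite !intrM -!mulrA -mulrDr -h; field.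
  by apply/andP; split; lia.
apply/mem_set; exists (m %/ 2)%Z, (n %/ 2)%Z.
have -> : m = 2 * (m %/ 2)%Z by lia.
have -> : n = 2 * (n %/ 2)%Z by lia.
have h (x : int) : (2 * x %/ 2)%Z = x by lia.
by rewrite !h !intrM; field.
Qed.

(** By [conj_area] the exponential is the sign given by the parity of the other coordinate; it
    compensates the failure of [wchi] to be multiplicative. *)
Lemma wchi_shift w g : (w = w1 \/ w = w2) -> G g ->
  wchi G (g + w) * cexp (nu / 2 * (w * g^* - g * w^*)) = - wchi G g.
Proof.
have iS := SC_neq0 S1; have ca := @conj_area _ w1 w2.
move=> [->|->] [m [n ->]].
- have -> : nu / 2 * (w1 * (m%:~R * w1 + n%:~R * w2)^* - (m%:~R * w1 + n%:~R * w2) * w1^*)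
      = (- n)%:~R * ('i * pi%:C).
    rewrite rmorphD !rmorphM /= !rmorph_int.
    transitivity (- (nu / 2 * n%:~R * (w1^* * w2 - w1 * w2^*))); first by ring.
    by rewrite ca /wnu rmorphM fmorphV /= intrN; field.
  have -> : m%:~R * w1 + n%:~R * w2 + w1 = (m + 1)%:~R * w1 + n%:~R * w2 by rewrite intrD; ring.
  rewrite !wchiE cexp_pi_int.
  have -> : (2 %| - n)%Z = (2 %| n)%Z by lia.
  have -> : (2 %| m + 1)%Z = ~~ (2 %| m)%Z by lia.
  by case: (2 %| m)%Z; case: (2 %| n)%Z; rewrite /= ?mulr1 ?mulN1r ?opprK.
- have -> : nu / 2 * (w2 * (m%:~R * w1 + n%:~R * w2)^* - (m%:~R * w1 + n%:~R * w2) * w2^*)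
      = m%:~R * ('i * pi%:C).
    rewrite rmorphD !rmorphM /= !rmorph_int.
    transitivity (nu / 2 * m%:~R * (w1^* * w2 - w1 * w2^*)); first by ring.
    by rewrite ca /wnu rmorphM fmorphV /=; field.
  have -> : m%:~R * w1 + n%:~R * w2 + w2 = m%:~R * w1 + (n + 1)%:~R * w2 by rewrite intrD; ring.
  rewrite !wchiE cexp_pi_int.
  have -> : (2 %| n + 1)%Z = ~~ (2 %| n)%Z by lia.
  by case: (2 %| m)%Z; case: (2 %| n)%Z; rewrite /= ?mulr1 ?mulN1r ?opprK.
Qed.

Definition pterm b z g : C :=
  wchi G g * cexp (- (nu / 2 * `|g| ^+ 2) + nu * z * g^* - nu * b * g).

Lemma Re_le_nm z : complex.Re z <= nm z.
Proof. exact: le_trans (ler_norm _) (nm_Re z). Qed.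

Lemma nm_gauss b z g : nm (cexp (- (nu / 2 * `|g| ^+ 2) + nu * z * g^* - nu * b * g)) <=
  expR (pi / S * (nm z + nm b) * nm g - pi / S / 2 * nm g ^+ 2).
Proof.
have n0 := nu_gt0; rewrite nm_cexp ler_expR normsq_nm.
have -> : - (nu / 2 * (nm g ^+ 2)%:C) + nu * z * g^* - nu * b * g =
   nu * (z * g^* - b * g) - (pi / S / 2 * nm g ^+ 2)%:C.
  rewrite [(_ * _ * _)%:C]rmorphM /= [(pi / S / 2)%:C]rmorphM /= fmorphV rmorph_nat -/(wnu w1 w2).
  by rewrite /wnu; ring.
rewrite ReD ReN /= lerD2r /wnu ReM /= mul0r subr0 -(mulrA (pi / S)) ler_pM2l//.
apply: le_trans (Re_le_nm _) _; apply: le_trans (nmD _ _) _.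
by rewrite nmN !nmM nm_conj mulrDl.
Qed.

Lemma pterm_bound (r : R) k : exists K, 0 <= K /\ forall g z b, nm z <= r -> nm b <= r ->
  nm g ^+ k * nm (pterm b z g) <= K * a3 g.
Proof.
have n0 := nu_gt0; have c0 : 0 < pi / S / 2 by rewrite divr_gt0.
have [K [K0 hK]] := gauss_a3 (pi / S * (2 * r)) k c0.
exists K; split=> // g z b zr br; apply: le_trans (hK g).
rewrite ler_wpM2l ?exprn_ge0 ?nm_ge0// /pterm nmM nm_wchi mul1r.
apply: le_trans (nm_gauss b z g) _; rewrite ler_expR lerD2r.
by rewrite ler_wpM2r ?nm_ge0// ler_pM2l//; lra.
Qed.

Lemma has_sum_pterm b z : exists s, has_sum G (pterm b z) s.
Proof.
have [M [M0 hM]] := lattice_bounded_sums S0.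
have [K [K0 hK]] := pterm_bound (Num.max (nm z) (nm b)) 0.
apply: (@has_sum_exists _ G _ (fun g => K * a3 g) (K * M)) => [g _|].
  by have := hK g z b; rewrite !le_max !lexx orbT expr0 mul1r; apply.
apply: (bounded_sums_le (a := @a3 R) _ _ _ _ hM) => //; exact: a3_ge0.
Qed.

Definition poincare b z : C := set_sum G (pterm b z).

Lemma poincareP b z : has_sum G (pterm b z) (poincare b z).
Proof. by have [s hs] := has_sum_pterm b z; rewrite /poincare (set_sumE hs). Qed.

Lemma entire_pterm b g : entire (fun z => pterm b z g).
Proof.
apply: entireZ; apply: eq_entire (entire_cexp_lin (nu * g^*) (- (nu / 2 * `|g| ^+ 2) - nu * b * g)) => z.
by congr cexp; ring.
Qed.

Lemma entire_poincare b : entire (poincare b).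
Proof.
have [||f [ef hf _]] := @sum_entire (fun g z => pterm b z g).
- exact: entire_pterm.
- move=> r; have [K [K0 hK]] := pterm_bound (Num.max r (nm b)) 0.
  exists K; split=> // g z _ zr; have := hK g z b; rewrite !le_max lexx zr orbT expr0 mul1r; exact.
by apply: eq_entire ef => z; apply: has_sum_uniq (hf z) (poincareP b z).
Qed.

(** Reindex by [g + w]; the sign is that of [wchi_shift]. The factor [exp (nu * z * b)] cancels the
    [exp (- nu * b * w)] produced by the reindexing. *)
Lemma poincare_law b : law w1 w2 nu (fun z => cexp (nu * z * b) * poincare b z).
Proof.
move=> w hw z.
have h := has_sum_reindex (addrK w) (addrNK w) _ (poincareP b (z + w)).
have Gw : G w by case: hw => ->; [exact: lattice_w1|exact: lattice_w2].
have {}h := has_sumZ (cexp (nu * (z + w) * b)) (h (fun g => latticeDr g Gw)).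
apply: has_sum_uniq h _; rewrite mulrA.
apply: eq_has_sum (has_sumZ _ (poincareP b z)) => g Gg /=.
have e1 := wchi_shift hw Gg.
transitivity (wchi G (g + w) * cexp (nu / 2 * (w * g^* - g * w^*)) *
  (cexp (nu * w^* * (z + w / 2)) * (cexp (nu * z * b) *
   cexp (- (nu / 2 * `|g| ^+ 2) + nu * z * g^* - nu * b * g)))).
  by rewrite e1 /pterm; ring.
rewrite /pterm !normsq [RHS]mulrCA -[LHS]mulrA; congr (_ * _).
rewrite -!cexpD !conjS; congr cexp.
by move: (Num.conj w) (Num.conj g) nu => w' g' n'; field.
Qed.

Lemma pterm_opp b z g : pterm b z (- g) = pterm (- b) (- z) g.
Proof.
rewrite /pterm wchiN normrN rmorphN /=; congr (_ * cexp _); ring.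
Qed.

Lemma poincare_opp b z : poincare (- b) (- z) = poincare b z.
Proof.
have h := has_sum_reindex (@opprK C) (@opprK C) (@latticeNE _ w1 w2) (poincareP b z).
apply: has_sum_uniq (poincareP (- b) (- z)) _.
by apply: eq_has_sum h => g _; rewrite /= pterm_opp.
Qed.

(** Conjugation exchanges the two variables, so facts proved in [z] transfer to [b]. *)
Lemma poincare_conj b z : (poincare b z)^* = poincare z^* b^*.
Proof.
rewrite -[RHS]poincare_opp; apply: has_sum_uniq (has_sum_conj (poincareP b z)) _.
apply: eq_has_sum (poincareP _ _) => g _; rewrite /pterm !normsq !conjS.
have -> : Num.conj (wchi G g) = wchi G g by rewrite /wchi; case: ifP; rewrite !conjS.
by congr (_ * cexp _); ring.
Qed.

Lemma poincare0l z : poincare 0 z = 0.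
Proof.
apply: (@even_law_eq0 _ _ _ S1 (poincare 0)); first exact: entire_poincare.
  by move=> w hw z'; have := poincare_law 0 hw z'; rewrite !mulr0 cexp0 !mul1r.
by move=> z'; rewrite -{1}oppr0 poincare_opp.
Qed.

Lemma poincare0r b : poincare b 0 = 0.
Proof. by rewrite -(conjcK (poincare b 0)) poincare_conj conjc0 poincare0l conjc0. Qed.

Lemma poincare_factor : exists kap : C, forall b z,
  poincare b z = kap * cexp (- (nu * z * b)) * F z * (F b^*)^*.
Proof.
have /choice [c hc] : forall b, exists c, forall z, cexp (nu * z * b) * poincare b z = c * F z.
  move=> b; apply: (law_zero_multiple S1); last by rewrite poincare0r mulr0.
    apply: entireM (entire_poincare b).
    by apply: eq_entire (entire_cexp_lin (nu * b) 0) => z; rewrite addr0; congr cexp; ring.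
  exact: poincare_law.
have hp b z : poincare b z = c b * cexp (- (nu * z * b)) * F z.
  by rewrite cexpN mulrAC -hc mulrC mulKf// cexp_neq0.
have F1 : F (w1 / 2) != 0 by apply/eqP => /(gsigma_eq0 S1); exact: (half_notin_lattice S0).
(* The symmetry [poincare_conj] applied to the factorization in [z]; reading it at [w1 / 2], where
   [gsigma] is nonzero, determines [c] up to a constant. *)
have hs b z : c b * F z = (c z^*)^* * (F b^*)^*.
  have := poincare_conj z^* b^*; rewrite !conjcK hp hp => h.
  have e0 := cexp_neq0 (nu * z * b).
  have -> : c b * F z = cexp (nu * z * b) * (c b * cexp (- (nu * z * b)) * F z).
    by rewrite cexpN; field.
  rewrite -h !conjS.
  by rewrite [nu * b * z]mulrAC cexpN; field.
exists ((c (w1 / 2)^*)^* / F (w1 / 2)) => b z.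
have cb : c b = (c (w1 / 2)^*)^* / F (w1 / 2) * (F b^*)^*.
  by rewrite mulrAC -hs mulfK.
by rewrite hp {1}cb; ring.
Qed.

Lemma has_sum_delta (D : set C) (c : C) g0 : D g0 -> has_sum D (fun g => if g == g0 then c else 0) c.
Proof.
move=> Dg e e0; exists [fset g0]%fset => A; rewrite fsub1set => gA.
rewrite /set_psum big_mkcond (bigD1_seq g0) ?fset_uniq//= eqxx mem_set// big1 ?addr0 ?subrr ?nm0//.
by move=> g gn; rewrite (negbTE gn) if_same.
Qed.

(** The root of unity $e^{2\pi i m/N}$, with an integer [m] because frequencies have both signs. *)
Definition winding N (m : int) : C := cexp (m%:~R * (N%:R^-1 * (2 * ('i * pi%:C)))).

Lemma winding_sum N (m : int) : (0 < N)%N -> (`|m| < N)%N -> m != 0 ->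
  \sum_(p < N) winding N m ^+ p = 0.
Proof.
move=> N0 mN m0.
have n0 : (N%:R : C) != 0 by rewrite pnatr_eq0 -lt0n.
have w1' : winding N m != 1.
  apply/eqP => /cexp_eq1[k] e.
  have : m%:~R = (k * N)%:~R :> C.
    rewrite intrM; apply: (mulIf (mulf_neq0 (invr_neq0 n0) (two_pi_i_neq0 R))).
    by rewrite e -[N%:~R]/(N%:R : C); field; rewrite n0.
  by move/intr_inj => e'; move: mN m0; rewrite e' abszM absz_nat; case: (k) => [[|?]|?] //=; nia.
have wN : winding N m ^+ N = 1.
  by rewrite /winding -cexpMn mulrCA mulVKf// cexp_2pi_int.
have := subrX1 (winding N m) N; rewrite wN subrr => /esym/eqP.
by rewrite mulf_eq0 subr_eq0 (negbTE w1') => /eqP.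
Qed.

Lemma nm_winding N (m : int) p : (0 < N)%N -> nm (winding N m ^+ p) = 1.
Proof.
move=> N0; have n0 : (N%:R : C) != 0 by rewrite pnatr_eq0 -lt0n.
have wN : winding N m ^+ N = 1.
  by rewrite /winding -cexpMn mulrCA mulVKf// cexp_2pi_int.
rewrite nmX; have -> : nm (winding N m) = 1; last by rewrite expr1n.
by apply/eqP; rewrite -(@eqrXn2 _ N) ?nm_ge0 ?ler01// -nmX wN nm1 expr1n.
Qed.

(* Restricted to [b = z^*], the sum is a Fourier series on the torus with
   nonzero coefficients; averaging over the N-torsion points isolates the
   frequencies in [N G]. *)
Lemma poincare_neq0 : exists b z, poincare b z != 0.
Proof.
apply: contrapT => h.
have p0 b z : poincare b z = 0.
  by apply/eqP; apply: contrapT => /negP hn; apply: h; exists b, z.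
have d0 := latmin_gt0 S0; set d := latmin w1 w2 in d0.
have [M [M0 hM]] := lattice_bounded_sums S0.
have n0 := nu_gt0; have c0 : 0 < pi / S / 2 by rewrite divr_gt0.
have [K [K0 hK]] := gauss_a3 0 1 c0.
(* After averaging, a surviving [g != 0] has norm at least [d * N]. The spare power of [nm g] in
   [hK] then bounds all of them together by [N ^ 2 * (K * M / (d * N))], which must stay below the
   term [N ^ 2] at 0. *)
have [N' hN'] := nat_gt (K * M / d).
pose N := N'.+1; have N0 : (0 < N)%N by [].
have NR : (0 : R) < N%:R by [].
have hN : K * M / d < N%:R by apply: lt_le_trans hN' _; rewrite ler_nat.
have NC : (N%:R : C) != 0 by rewrite pnatr_eq0.
pose Z p q : C := (p%:R * w1 + q%:R * w2) / N%:R.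
pose f g := \sum_(p < N) \sum_(q < N) pterm (Z p q)^* (Z p q) g.
have hf : has_sum G f 0.
  have -> : (0 : C) = \sum_(p < N) \sum_(q < N) poincare (Z p q)^* (Z p q).
    by rewrite big1// => p _; rewrite big1.
  apply: has_sum_sum => p; apply: has_sum_sum => q; exact: poincareP.
pose w g := wchi G g * cexp (- (nu / 2 * `|g| ^+ 2)).
have fE (m n : int) : f (m%:~R * w1 + n%:~R * w2) = w (m%:~R * w1 + n%:~R * w2) *
   ((\sum_(p < N) winding N (- n) ^+ p) * (\sum_(q < N) winding N m ^+ q)).
  rewrite mulr_suml mulr_sumr; apply: eq_bigr => p _.
  rewrite !mulr_sumr; apply: eq_bigr => q _.
  rewrite /pterm /w -[RHS]mulrA; congr (_ * _).
  rewrite -addrA cexpD; congr (_ * _).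
  rewrite /winding -!cexpMn -cexpD; congr cexp; rewrite /Z.
  have iS := SC_neq0 S1; have ca := @conj_area _ w1 w2.
  rewrite !conjS.
  transitivity (nu / N%:R * (q%:R * m%:~R - p%:R * n%:~R) * (w1^* * w2 - w1 * w2^*)).
    by move: (Num.conj w1) (Num.conj w2) nu => v1 v2 n'; field.
  by rewrite ca /wnu rmorphM fmorphV /= intrN; field; rewrite NC iS.
have fsmall g : G g -> g != 0 -> nm (f g) <= N%:R ^+ 2 * (K / (d * N%:R)) * a3 g.
  move=> Gg; have bnd0 : 0 <= N%:R ^+ 2 * (K / (d * N%:R)) * a3 g.
    by rewrite mulr_ge0 ?a3_ge0// mulr_ge0 ?exprn_ge0// divr_ge0// mulr_ge0// ltW.
  move: Gg bnd0 => [m [n ->]] bnd0 g0; rewrite fE.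
  have sb (k : int) : nm (\sum_(p < N) winding N k ^+ p) <= N%:R.
    apply: le_trans (nm_sum _ _ _) _.
    under eq_bigr do rewrite nm_winding//.
    by rewrite sumr_const card_ord.
  have [mn|mn] := ltnP (`|m| + `|n|) N.
    have [m0|m0] := eqVneq m 0.
      have n0' : n != 0 by apply: contraNneq g0 => ->; rewrite m0 !mul0r addr0.
      have s0 : \sum_(p < N) winding N (- n) ^+ p = 0 by apply: winding_sum; rewrite ?oppr_eq0// abszN; apply: leq_ltn_trans mn; exact: leq_addl.
      by rewrite s0 mul0r mulr0 nm0.
    have s0 : \sum_(p < N) winding N m ^+ p = 0 by apply: winding_sum => //; apply: leq_ltn_trans mn; exact: leq_addr.
    by rewrite s0 !mulr0 nm0.
  set v := _ + _ in g0 *.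
  have dg : d * N%:R <= nm v.
    apply: le_trans (lattice_nm S0 m n); rewrite ler_pM2l// -natrD ler_nat //.
  have dN : 0 < d * N%:R by rewrite mulr_gt0.
  have wg : nm (w v) <= K / (d * N%:R) * a3 v.
    rewrite mulrAC ler_pdivlMr// mulrC; apply: le_trans (hK v).
    rewrite expr1 mul0r /w nmM nm_wchi mul1r; apply: ler_pM; rewrite ?nm_ge0 ?(ltW dN)//.
    have := nm_gauss 0 0 v; rewrite !mulr0 !mul0r subr0 addr0 nm0 addr0 !mulr0 mul0r; exact.
  rewrite mulrC -mulrA nmM mulrC [leRHS]mulrC; apply: ler_pM; rewrite ?mulr_ge0 ?nm_ge0//.
  by rewrite nmM expr2; apply: ler_pM; rewrite ?nm_ge0.
have f0 : f 0 = N%:R ^+ 2.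
  have := fE 0 0; rewrite !mul0r addr0 => ->.
  have w0 : winding N 0 = 1 by rewrite /winding mul0r cexp0.
  rewrite oppr0 w0 /w normr0 expr0n !mulr0 oppr0 cexp0 mulr1 /wchi mul0r mem_set ?mul1r; last exact: lattice0.
  by under eq_bigr do rewrite expr1n; rewrite sumr_const card_ord expr2.
have hf' : has_sum G (fun g => if g == 0 then 0 else f g) (- N%:R ^+ 2).
  rewrite -[- _]add0r; apply: eq_has_sum (has_sumD hf (has_sum_delta (- N%:R ^+ 2) (lattice0 w1 w2))) => g _ /=.
  by case: eqP => [->|_]; rewrite ?f0 ?subrr ?addr0.
have k0 : 0 <= N%:R ^+ 2 * (K / (d * N%:R)) by rewrite mulr_ge0 ?exprn_ge0// divr_ge0// mulr_ge0// ltW.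
have b1 : forall g, G g -> nm (if g == 0 then 0 else f g) <= N%:R ^+ 2 * (K / (d * N%:R)) * a3 g.
  move=> g Gg; case: eqP => [_|/eqP g0]; last exact: fsmall.
  by rewrite nm0 mulr_ge0 ?a3_ge0.
have b2 : bounded_sums G (fun g => N%:R ^+ 2 * (K / (d * N%:R)) * a3 g) (N%:R ^+ 2 * (K / (d * N%:R)) * M).
  apply: (bounded_sums_le (a := @a3 R) _ _ _ _ hM) => //; exact: a3_ge0.
have := has_sum_le b1 b2 hf'; rewrite nmN nmX nm_nat leNgt => /negP; apply.
have -> : (N%:R : R) ^+ 2 * (K / (d * N%:R)) * M = N%:R * (K * M / d).
  by field; rewrite !gt_eqF.
by rewrite expr2 ltr_pM2l.
Qed.

Definition thetaterm z g : C := wchi G g * g * cexp (- (nu / 2 * `|g| ^+ 2) + nu * z * g^*).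

Lemma thetatermE z g : thetaterm z g = g * pterm 0 z g.
Proof. by rewrite /thetaterm /pterm mulr0 mul0r subr0; ring. Qed.

Lemma coefs_pterm b g : coefs (fun z => pterm b z g)
  (fun n => pterm b 0 g * ((nu * g^*) ^+ n / n`!%:R)).
Proof.
have h := coefsZ (pterm b 0 g) (coefs_cexp (nu * g^*)).
apply: eq_coefs h => z; rewrite /pterm -mulrA -cexpD; congr (_ * cexp _); ring.
Qed.

Lemma coefs_pterm_l z g : coefs (fun b => pterm b z g)
  (fun n => pterm 0 z g * ((- (nu * g)) ^+ n / n`!%:R)).
Proof.
have h := coefsZ (pterm 0 z g) (coefs_cexp (- (nu * g))).
apply: eq_coefs h => b; rewrite /pterm -mulrA -cexpD; congr (_ * cexp _); ring.
Qed.

Lemma coefs_conj f a : coefs f a -> coefs (fun z => (f z^*)^*) (fun n => (a n)^*).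
Proof.
move=> ha; apply: coefs_of_series => z e e0.
have [N hN] := coefs_series z^* ha e0; exists N => n Nn; rewrite -nm_conj.
have -> : (\sum_(k < n) (a k)^* * z ^+ k - (f z^*)^*)^* = \sum_(k < n) a k * z^* ^+ k - f z^*.
  rewrite rmorphB rmorph_sum /= conjcK; congr (_ - _); apply: eq_bigr => k _.
  by rewrite rmorphM rmorphXn /= conjcK.
exact: hN.
Qed.

Lemma gsigma_coefs a : coefs F a -> a 0%N = 0 /\ a 1%N = 1.
Proof.
move=> ha; have a0 : a 0%N = 0 by rewrite (coefs_at0 ha); apply/(gsigma_eq0 S1); exact: lattice0.
split=> //; have [M [M0 hM]] := taylor 2 ha; have [M' [M'0 hM']] := gsigma_near0 S1.
apply/eqP; rewrite -subr_eq0; apply/eqP.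
apply: (@linear_vanish _ _ (M + M')) => [|t t1]; first by rewrite addr_ge0.
have := hM t t1; have := hM' t t1; rewrite !big_ord_recr big_ord0 /= a0 mul0r !add0r expr1 => h1 h2.
have -> : nm (a 1%N - 1) * nm t = nm (F t - t - (F t - a 1%N * t)).
  by rewrite -nmM; congr nm; ring.
by apply: le_trans (nmD _ _) _; rewrite nmN mulrDl addrC lerD.
Qed.

(* First-order expansion of [poincare_factor] in [b] at [0]. *)
Lemma theta_gsigma : exists kap : C, kap != 0 /\ forall z, has_sum G (thetaterm z) (kap * F z).
Proof.
have [kap hk] := poincare_factor; have nC : nu != 0 by rewrite /wnu eq_complex /= negb_and gt_eqF ?nu_gt0.
exists (- (nu^-1 * kap)); split.
  rewrite oppr_eq0 mulf_neq0 ?invr_eq0//; have [b [z]] := poincare_neq0.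
  by apply: contraNneq => k0; rewrite hk k0 !mul0r.
move=> z.
have [||f [ef hf hc]] := @sum_entire (fun g b => pterm b z g).
- move=> g; exact: (coefs_entire (coefs_pterm_l z g)).
- move=> r; have [K [K0 hK]] := pterm_bound (Num.max r (nm z)) 0.
  exists K; split=> // g b _ br; have := hK g z b; rewrite !le_max lexx br orbT expr0 mul1r; exact.
have fE b : f b = kap * F z * cexp (- (nu * z) * b) * (F b^*)^*.
  by rewrite (has_sum_uniq (hf b) (poincareP b z)) hk -mulNr; ring.
have [a ha] := entire_coefs ef.
have h1 := hc _ _ ha (coefs_pterm_l z) 1%N.
(* The conjugated factor is [b] plus higher order terms, so only the constant term of the
   exponential survives. *)
have a1 : a 1%N = kap * F z.
  have [c hc'] := entire_coefs (entire_gsigma S1); have [c0 c1] := gsigma_coefs hc'.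
  have h2 := coefsM (coefsZ (kap * F z) (coefs_cexp (- (nu * z)))) (coefs_conj hc').
  rewrite (coefs_uniq ha (eq_coefs (fun b => esym (fE b)) h2)).
  by rewrite !big_ord_recr big_ord0 /= c0 c1 conjc0 conjc1 expr0 (_ : 0`!%:R = 1 :> C)// divr1; ring.
have := has_sumZ (- nu^-1) h1; rewrite a1.
have -> : - nu^-1 * (kap * F z) = - (nu^-1 * kap) * F z by ring.
apply: eq_has_sum => g _.
rewrite thetatermE expr1 (_ : 1`!%:R = 1 :> C)// divr1.
by rewrite mulNr mulrN mulrN opprK (mulrCA nu^-1) mulKf// mulrC.
Qed.

End theta.

(** * Factorials and Pochhammer symbols behind the Hermite-Gauss polynomials *)

Section coefficient_identities.
Variable R : realType.
Local Notation C := R[i].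
Implicit Types z : C.

Lemma fact_neq0 n : (n`!%:R : C) != 0.
Proof. by rewrite pnatr_eq0 -lt0n fact_gt0. Qed.

Lemma coefs_cexp_sqr (c : C) : coefs (fun z => cexp (c * z ^+ 2))
  (fun n => if odd n then 0 else c ^+ n./2 / (n./2)`!%:R).
Proof.
apply: coefs_of_series => z e e0.
have [N hN] := exp_sum_cexp (c * z ^+ 2) e0; exists N.*2 => n Nn.
suff -> : \sum_(k < n) (if odd k then 0 else c ^+ k./2 / (k./2)`!%:R) * z ^+ k =
    exp_sum (uphalf n) (c * z ^+ 2) by apply: hN; lia.
elim: n {Nn} => [|n ih]; first by rewrite /exp_sum !big_ord0.
rewrite big_ord_recr /= ih uphalf_half; case: ifP => on.
  by rewrite mul0r addr0 add1n.
rewrite add0n [RHS]big_ord_recr /=; congr (_ + _).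
by rewrite exprMn -exprM mulrAC mul2n -{2}(odd_double_half n) on add0n.
Qed.

Lemma sum_even n (h : nat -> C) :
  \sum_(i < n.*2.+1) (if odd i then 0 else h i) = \sum_(k < n.+1) h k.*2.
Proof.
elim: n => [|n ih]; first by rewrite !big_ord_recr !big_ord0.
rewrite doubleS [RHS]big_ord_recr [LHS]big_ord_recr /= -ih [in LHS]big_ord_recr /=.
by rewrite odd_double /= addr0.
Qed.

Lemma pochN r k : (k <= r)%N -> pochhammer (- r%:R : C) k = (-1) ^+ k * r`!%:R / (r - k)`!%:R.
Proof.
elim: k => [_|k ih kr]; first by rewrite /pochhammer big_ord0 expr0 mul1r subn0 divff ?fact_neq0.
rewrite /pochhammer big_ord_recr /= -/(pochhammer _ k) ih; last exact: ltnW.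
have -> : (r - k)%N = (r - k.+1).+1 by lia.
rewrite factS natrM exprS.
have -> : ((r - k.+1).+1)%:R = r%:R - k%:R :> C by rewrite -natrB ?(ltnW kr)//; congr _%:R; lia.
have h : (r%:R - k%:R : C) != 0 by rewrite -natrB ?(ltnW kr)// pnatr_eq0; lia.
by have := fact_neq0 (r - k.+1); move=> h'; field; rewrite h' h.
Qed.

Lemma poch32 k : pochhammer (3 / 2 : C) k * k`!%:R * 4 ^+ k = (k.*2.+1)`!%:R.
Proof.
elim: k => [|k ih]; first by rewrite /pochhammer big_ord0 !mul1r.
rewrite /pochhammer big_ord_recr /= -/(pochhammer _ k) doubleS !factS !natrM exprS.
rewrite factS natrM in ih; rewrite -ih.
by rewrite -[k.*2.+3%:R]natr1 -[k.*2.+2%:R]natr1 -[k.*2.+1%:R]natr1 -muln2 natrM -natr1; field.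
Qed.

End coefficient_identities.

(** * Taylor coefficients and Hermite-Gauss series *)

Section taylor_coefficients.
Variable R : realType.
Local Notation C := R[i].
Variables w1 w2 : C.
Hypothesis S1 : 0 < cell_area w1 w2.
Local Notation G := (lattice w1 w2).
Local Notation S := (cell_area w1 w2).
Local Notation nu := (wnu w1 w2).
Local Notation mu := (wmu w1 w2).
Local Notation S0 := (S_neq0 S1).
Local Notation F := (gsigma w1 w2).
Implicit Types (z g t b : C) (f h : C -> C).

(* [P_r] is, up to a factor, the coefficient of [z ^ (2 r + 1)] in
   [exp (mu / 2 * z ^ 2 + nu * z * conj w)], divided by [nu * conj w]. *)
Lemma hgPE r w : hgP w1 w2 r w = 2 ^+ r * r`!%:R *
  \sum_(k < r.+1) ((mu / 2) ^+ (r - k) / (r - k)`!%:R) * ((nu * w^*) ^+ k.*2 / (k.*2.+1)`!%:R).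
Proof.
rewrite mulr_sumr; apply: eq_bigr => k _; have kr : (k <= r)%N by rewrite -ltnS.
rewrite pochN// -poch32.
have p0 : pochhammer (3 / 2 : C) k != 0.
  have := fact_neq0 R k.*2.+1; rewrite -poch32 -mulrA; by apply: contraNneq => ->; rewrite mul0r.
have := fact_neq0 R k; have := fact_neq0 R (r - k); have := fact_neq0 R r.
have e2 : (2 : C) ^+ r = 2 ^+ k * 2 ^+ (r - k) by rewrite -exprD subnKC.
have e4 : (4 : C) ^+ k = 2 ^+ k * 2 ^+ k by rewrite -exprMn -natrM.
have eX : (- (nu ^+ 2 * w^* ^+ 2 / 2)) ^+ k = (-1) ^+ k * ((nu * w^*) ^+ k.*2 / 2 ^+ k).
  transitivity ((-1) ^+ k * (nu ^+ 2 * w^* ^+ 2 / 2) ^+ k); first exact: exprNn.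
  by rewrite [in LHS]expr_div_n -[in LHS]exprMn -[in LHS]exprM mul2n.
have s1 : ((-1 : C) ^+ k) * (-1) ^+ k = 1 by rewrite -exprD addnn -signr_odd odd_double.
have t0 n : (2 : C) ^+ n != 0 by rewrite expf_neq0.
rewrite eX e2 e4 expr_div_n; move: s1 (t0 k) (t0 (r - k)%N) p0.
move: ((-1) ^+ k) (2 ^+ k) (2 ^+ (r - k)) (pochhammer _ _) ((nu * w^*) ^+ _) (mu ^+ _).
move: (r`!%:R : C) (k`!%:R : C) ((r - k)`!%:R : C) => x1 x2 x3 x4 x5 x6 x7 x8 x9 x44 x5' x6' x7' x1' x2' x3'.
transitivity (x4 * x4 * (x5 * x6 * x1 * (x9 / x6 / x3 * (x8 / (x7 * x2 * (x5 * x5)))))).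
  by field; rewrite x5' x6' x7' x2' x3'.
by rewrite x44 mul1r.
Qed.

Definition twist z g : C := cexp (mu / 2 * z ^+ 2) * thetaterm w1 w2 z g.

(** Cauchy product of the expansions of [exp (mu / 2 * z ^ 2)] and of the theta term: the first has
    even powers only, and [hgPE] recognizes the remaining sum. *)
Lemma coefs_twist r g : exists c, coefs (fun z => twist z g) c /\
  c r.*2.+1 = nu / (2 ^+ r * r`!%:R) * hgterm w1 w2 r g.
Proof.
have h := coefsM (coefs_cexp_sqr (mu / 2)) (coefsZ g (coefs_pterm w1 w2 0 g)).
exists (fun n => \sum_(i < n.+1) (if odd i then 0 else (mu / 2) ^+ i./2 / (i./2)`!%:R) *
   (g * (pterm w1 w2 0 0 g * ((nu * g^*) ^+ (n - i) / (n - i)`!%:R)))); split.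
  by apply: eq_coefs h => z; rewrite /twist thetatermE.
rewrite big_ord_recr /= odd_double /= mul0r addr0.
under eq_bigr => i _ do rewrite (fun_if (fun x => x * _)) mul0r.
rewrite (@sum_even _ r (fun i => (mu / 2) ^+ i./2 / (i./2)`!%:R *
   (g * (pterm w1 w2 0 0 g * ((nu * g^*) ^+ (r.*2.+1 - i) / (r.*2.+1 - i)`!%:R))))).
rewrite /hgterm hgPE normsq.
set s := (X in _ * X * wchi G g).
have -> : nu / (2 ^+ r * r`!%:R) * (2 ^+ r * r`!%:R * s * wchi G g * (g * g^*) *
    cexp (- (nu / 2 * (g * g^*)))) =
    (nu * g^* * g * (wchi G g * cexp (- (nu / 2 * (g * g^*))))) * s.
  have key (n x y t a a' w e : C) : x != 0 -> y != 0 ->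
    n / (x * y) * (x * y * t * w * (a * a') * e) = n * a' * a * (w * e) * t.
    by move=> x0 y0; field; rewrite x0 y0.
  by apply: key; rewrite ?fact_neq0 ?expf_neq0.
rewrite /s {s} mulr_sumr (reindex_inj rev_ord_inj) /=; apply: eq_bigr => k _.
rewrite subSS doubleK; have kr : (k <= r)%N by rewrite -ltnS.
have -> : (r.*2.+1 - (r - k).*2)%N = k.*2.+1 by lia.
rewrite /pterm !mulr0 !mul0r subr0 addr0 normsq exprS.
by rewrite -!mulrA; ring.
Qed.

(** [kap] is left free: order 0 identifies it with [hgseries w1 w2 0], after which all orders are
    read with that value. *)
Lemma coefs_hgterm kap a r : (forall z, has_sum G (thetaterm w1 w2 z) (kap * F z)) ->
  coefs (wsigma G) a ->
  has_sum G (fun g => nu / (2 ^+ r * r`!%:R) * hgterm w1 w2 r g) (kap * a r.*2.+1).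
Proof.
move=> hk ha.
have ec : entire (fun z => cexp (mu / 2 * z ^+ 2)) := coefs_entire (coefs_cexp_sqr (mu / 2)).
have /choice [c hc] : forall g, exists c, coefs (fun z => twist z g) c /\
  c r.*2.+1 = nu / (2 ^+ r * r`!%:R) * hgterm w1 w2 r g by exact: coefs_twist.
have [||f [ef hf hs]] := @sum_entire _ _ _ S1 (fun g z => twist z g).
- move=> g; have [c' [hc' _]] := coefs_twist r g; exact: coefs_entire hc'.
- move=> s; have [B [B0 hB]] := entire_bounded s ec.
  have [K [K0 hK]] := pterm_bound S1 (Num.max s 0) 1.
  exists (B * K); split=> [|g z _ zs]; first by rewrite mulr_ge0.
  have h2 : nm (thetaterm w1 w2 z g) <= K * a3 g.
    rewrite thetatermE nmM -[nm g]expr1; apply: hK; first by rewrite le_max zs.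
    by rewrite nm0 le_max lexx orbT.
  have -> : nm (twist z g) = nm (cexp (mu / 2 * z ^+ 2)) * nm (thetaterm w1 w2 z g) := nmM _ _.
  by rewrite -(mulrA B); exact: ler_pM (nm_ge0 _) (nm_ge0 _) (hB z zs) h2.
have fE z : f z = kap * wsigma G z.
  apply: has_sum_uniq (hf z) _.
  have -> : kap * wsigma G z = cexp (mu / 2 * z ^+ 2) * (kap * F z).
    rewrite /gsigma cexpN; have := cexp_neq0 (mu / 2 * z ^+ 2).
    by move: (cexp _) (wsigma G z) => e s e0; field.
  exact: has_sumZ (hk z).
have := hs _ _ (eq_coefs (fun z => esym (fE z)) (coefsZ kap ha)) (fun g => (hc g).1) r.*2.+1.
by apply: eq_has_sum => g _; rewrite (hc g).2.
Qed.

Lemma wsigma_even_coefs a n : coefs (wsigma G) a -> ~~ odd n -> a n = 0.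
Proof.
move=> ha en; have := coefs_opp ha.
have h z : wsigma G (- z) = -1 * wsigma G z by rewrite mulN1r (wsigmaN S0).
move/(eq_coefs h)/coefs_uniq => /(_ _ (coefsZ (-1) ha)) /(congr1 (fun c => c n)).
rewrite -signr_odd (negbTE en) mul1r mulN1r => /eqP; rewrite -addr_eq0 -mulr2n mulrn_eq0 /=.
by move/eqP.
Qed.

(** [wcoef] is a choice made by [get]. The odd Taylor coefficients show that an admissible sequence
    exists; interleaving the chosen one with zeros and using uniqueness of [coefs] identifies it. *)
Lemma wcoefE a r : coefs (wsigma G) a -> wcoef G r = (r.*2.+1)`!%:R * a r.*2.+1.
Proof.
move=> ha; pose P : set (nat -> C) := [set W : nat -> C | forall z : C,
    series (fun r => W r * (z ^+ r.*2.+1 / (r.*2.+1)`!%:R)) @ \oo --> wsigma G z].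
have PW : P (wcoef G).
  apply: (@getPex _ P); exists (fun r => (r.*2.+1)`!%:R * a r.*2.+1) => z; apply/slimP => e e0.
  have [N hN] := coefs_series z ha e0; exists N => n Nn.
  have -> : series (fun r => (r.*2.+1)`!%:R * a r.*2.+1 * (z ^+ r.*2.+1 / (r.*2.+1)`!%:R)) n =
      \sum_(k < n.*2) a k * z ^+ k; last by apply: hN; lia.
    rewrite seriesEord /=; elim: (n) => [|m ih]; first by rewrite !big_ord0.
    rewrite doubleS !big_ord_recr /= ih (wsigma_even_coefs ha (n := m.*2)) ?odd_double//.
    by rewrite mul0r addr0; congr (_ + _); have := fact_neq0 R m.*2.+1; move=> h; field.
pose b k : C := if odd k then wcoef G k./2 / k`!%:R else 0.
have hb : coefs (wsigma G) b.
  apply: coefs_of_series => z e e0; have /slimP h := PW z.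
  have [N hN] := h _ e0; exists N.*2 => n Nn.
  suff -> : \sum_(k < n) b k * z ^+ k =
    series (fun r => wcoef G r * (z ^+ r.*2.+1 / (r.*2.+1)`!%:R)) n./2 by apply: hN; lia.
  rewrite seriesEord /=; elim: n {Nn} => [|n ih]; first by rewrite !big_ord0.
  have bn : b n = if odd n then wcoef G n./2 / n`!%:R else 0 by [].
  rewrite big_ord_recr /= ih bn uphalf_half; case: ifP => on; last by rewrite mul0r addr0 add0n.
  rewrite add1n big_ord_recr /=; congr (_ + _).
  have -> : (n./2).*2.+1 = n by rewrite -[RHS]odd_double_half on.
  by rewrite mulrAC mulrA.
have e2 : (r.*2.+1)./2 = r by lia.
rewrite (coefs_uniq ha hb) /b e2 /= odd_double /=.
by have := fact_neq0 R r.*2.+1; move=> h; field.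
Qed.

(** Sigma has first Taylor coefficient 1, so [coefs_hgterm] at order 0 says that the nonzero [kap]
    of [theta_gsigma] is the Hermite-Gauss series. *)
Lemma hgseries_theta : hgseries w1 w2 0 != 0 /\
  forall z, has_sum G (thetaterm w1 w2 z) (hgseries w1 w2 0 * F z).
Proof.
have [kap [k0 hk]] := theta_gsigma S1; have [a ha] := entire_coefs (entire_wsigma S0).
suff -> : hgseries w1 w2 0 = kap by [].
have a1 : a 1%N = 1.
  have h z : cexp (- (mu / 2) * z ^+ 2) * wsigma G z = F z by rewrite /gsigma mulNr.
  have := (gsigma_coefs S1 (eq_coefs h (coefsM (coefs_cexp_sqr (- (mu / 2))) ha))).2.
  by rewrite !big_ord_recr big_ord0 /= add0r mul0r addr0 expr0 divr1 mul1r.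
have := coefs_hgterm 0 hk ha; rewrite a1 mulr1 => h.
have nC : nu != 0 by rewrite /wnu eq_complex /= negb_and gt_eqF ?(nu_gt0 S1).
have {}h := has_sumZ nu^-1 h.
have e : has_sum G (hgterm w1 w2 0) (nu^-1 * kap).
  by apply: eq_has_sum h => g _; rewrite !mul1r divr1 mulKf.
by rewrite /hgseries (set_sumE e) (_ : 1 / (1 * 1) = 1 :> C) ?mulr1 ?mulVKf// !mul1r invr1.
Qed.

Lemma hgtermP a r : coefs (wsigma G) a ->
  set_summable G (hgterm w1 w2 r) /\ hgseries w1 w2 r = hgseries w1 w2 0 * wcoef G r.
Proof.
move=> ha; have h := coefs_hgterm r hgseries_theta.2 ha.
have nC : nu != 0 by rewrite /wnu eq_complex /= negb_and gt_eqF ?(nu_gt0 S1).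
have f0 := fact_neq0 R r; have t0 : (2 : C) ^+ r != 0 by rewrite expf_neq0.
have k0 : nu / (2 ^+ r * r`!%:R) != 0 by rewrite mulf_neq0 ?invr_neq0 ?mulf_neq0.
have {}h := has_sumZ (nu / (2 ^+ r * r`!%:R))^-1 h.
have e : has_sum G (hgterm w1 w2 r) ((nu / (2 ^+ r * r`!%:R))^-1 * (hgseries w1 w2 0 * a r.*2.+1)).
  by apply: eq_has_sum h => g _; rewrite mulKf.
split; first exact: has_sum_summable e.
rewrite (wcoefE r ha) [LHS]/hgseries (set_sumE e).
have key (n x y v s t : C) : n != 0 -> s != 0 -> t != 0 ->
  n * (v / (s * t)) * ((n / (s * t))^-1 * (x * y)) = x * (v * y).
  by move=> n0 s0 v0; field; rewrite n0 s0 v0.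
exact: key.
Qed.

End taylor_coefficients.

(** * Integrals over the plane *)

Section plane_integrals.
Variable R : realType.
Local Notation C := R[i].
Local Notation T2 := (measurableTypeR R * measurableTypeR R)%type.
Local Notation leb := (@lebesgue_measure R).
Implicit Types (z w c t : C) (f g : C -> C).

Definition pt (p : T2) : C := p.1 +i* p.2.

Definition cmeas f := measurable_fun [set: T2] (fun p => complex.Re (f (pt p))) /\
  measurable_fun [set: T2] (fun p => complex.Im (f (pt p))).

Lemma cmeas_cst c : cmeas (fun=> c).
Proof. by split; exact: measurable_cst. Qed.

Lemma cmeas_id : cmeas id.
Proof. by split; [exact: measurable_fst|exact: measurable_snd]. Qed.

Lemma cmeas_conj f : cmeas f -> cmeas (fun z => (f z)^*).
Proof.
move=> [h1 h2]; split.
  by under eq_fun do rewrite Re_conj.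
under eq_fun do rewrite Im_conj; apply: measurableT_comp => //.
Qed.

Lemma cmeasD f g : cmeas f -> cmeas g -> cmeas (fun z => f z + g z).
Proof.
move=> [f1 f2] [g1 g2]; split.
  by under eq_fun do rewrite ReD; exact: measurable_funD.
by under eq_fun do rewrite ImD; exact: measurable_funD.
Qed.

Lemma cmeasM f g : cmeas f -> cmeas g -> cmeas (fun z => f z * g z).
Proof.
move=> [f1 f2] [g1 g2]; split.
  by under eq_fun do rewrite ReM; apply: measurable_funB; exact: measurable_funM.
by under eq_fun do rewrite ImM; apply: measurable_funD; exact: measurable_funM.
Qed.

Lemma cmeasX f n : cmeas f -> cmeas (fun z => f z ^+ n).
Proof.
move=> hf; elim: n => [|n ih]; first by under eq_fun do rewrite expr0; exact: cmeas_cst.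
by under eq_fun do rewrite exprS; exact: cmeasM.
Qed.

Lemma cmeas_sum (f : nat -> C -> C) n : (forall i, cmeas (f i)) -> cmeas (fun z => \sum_(i < n) f i z).
Proof.
move=> hf; elim: n => [|n ih]; first by under eq_fun do rewrite big_ord0; exact: cmeas_cst.
by under eq_fun do rewrite big_ord_recr /=; exact: cmeasD.
Qed.

Lemma slim_Re (u : nat -> C) l : slim u l -> (fun n => complex.Re (u n)) @ \oo --> complex.Re l.
Proof.
move=> h; apply/cvgrPdist_lt => e /h[N hN]; exists N => // n /= Nn.
rewrite distrC -ReN -ReD; exact: le_lt_trans (nm_Re _) (hN n Nn).
Qed.

Lemma slim_Im (u : nat -> C) l : slim u l -> (fun n => complex.Im (u n)) @ \oo --> complex.Im l.
Proof.
move=> h; apply/cvgrPdist_lt => e /h[N hN]; exists N => // n /= Nn.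
rewrite distrC -ImN -ImD; exact: le_lt_trans (nm_Im _) (hN n Nn).
Qed.

Lemma cmeas_slim (f : nat -> C -> C) g : (forall n, cmeas (f n)) ->
  (forall z, slim (fun n => f n z) (g z)) -> cmeas g.
Proof.
move=> hf h; split.
  apply: (measurable_fun_cvg (h := fun n p => complex.Re (f n (pt p)))) => [n|p _].
    by have [] := hf n.
  exact: slim_Re (h (pt p)).
apply: (measurable_fun_cvg (h := fun n p => complex.Im (f n (pt p)))) => [n|p _].
  by have [] := hf n.
exact: slim_Im (h (pt p)).
Qed.

Lemma cmeas_entire f : entire f -> cmeas f.
Proof.
move=> /entire_coefs[a ha].
apply: (@cmeas_slim (fun n z => \sum_(k < n) a k * z ^+ k)) => [n|z]; last exact: coefs_series.
apply: (@cmeas_sum (fun k z => a k * z ^+ k)) => k; apply: cmeasM; first exact: cmeas_cst.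
exact: cmeasX cmeas_id.
Qed.

Lemma cmeas_cexp f : cmeas f -> cmeas (fun z => cexp (f z)).
Proof.
move=> hf; apply: (@cmeas_slim (fun n z => exp_sum n (f z))) => [n|z]; last exact: exp_sum_cexp.
apply: (@cmeas_sum (fun k z => f z ^+ k / k`!%:R)) => k; apply: cmeasM; [exact: cmeasX|exact: cmeas_cst].
Qed.

(** The integrand is a multiple of the normal density with mean [a / (2 * n)] and variance
    [1 / (2 * n)]. *)
Lemma gauss1 (n a : R) : 0 < n -> (\int[leb]_x (expR (a * x - n * x ^+ 2))%:E =
  (Num.sqrt (pi / n) * expR (a ^+ 2 / (4 * n)))%:E)%E.
Proof.
move=> n0; pose s := Num.sqrt ((2 * n)^-1); have n2 : 0 < (2 * n)^-1 by rewrite invr_gt0 mulr_gt0.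
have s0 : s != 0 by rewrite gt_eqF// sqrtr_gt0.
have s2 : s ^+ 2 = (2 * n)^-1 by rewrite sqr_sqrtr// ltW.
pose k := Num.sqrt (pi / n) * expR (a ^+ 2 / (4 * n)).
have q0 : 0 < Num.sqrt (pi / n) by rewrite sqrtr_gt0 divr_gt0// pi_gt0.
have e x : expR (a * x - n * x ^+ 2) = k * normal_pdf (a / (2 * n)) s x.
  rewrite normal_pdfE// /normal_fun /normal_peak s2.
  have -> : (2 * n)^-1 * pi *+ 2 = pi / n by rewrite -mulr_natr; field; rewrite gt_eqF.
  have -> : a * x - n * x ^+ 2 = a ^+ 2 / (4 * n) + - (x - a / (2 * n)) ^+ 2 / ((2 * n)^-1 *+ 2).
    by rewrite -mulr_natr; field; rewrite gt_eqF.
  by rewrite /k expRD mulrCA mulrA mulrA mulVf ?mul1r// gt_eqF.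
under eq_integral do rewrite e EFinM.
rewrite integralZl//=; last exact: integrable_normal_pdf.
by rewrite integral_normal_pdf mule1.
Qed.

Lemma measurable_gauss1 (n a : R) : measurable_fun setT (fun x : measurableTypeR R => expR (a * x - n * x ^+ 2)).
Proof.
apply: measurableT_comp => //; apply: measurable_funB; apply: measurable_funM => //.
Qed.

Lemma gauss1Z (k n a : R) : 0 <= k -> 0 < n -> (\int[leb]_x (k%:E * (expR (a * x - n * x ^+ 2))%:E) =
  (k * (Num.sqrt (pi / n) * expR (a ^+ 2 / (4 * n))))%:E)%E.
Proof.
move=> k0 n0; rewrite ge0_integralZl//; solve
  [ by rewrite gauss1 | by move=> x _; rewrite lee_fin expR_ge0
  | apply/measurable_EFinP; exact: measurable_gauss1].
Qed.

Definition gauss (c a b : R) (p : T2) : R := expR (a * p.1 + b * p.2 - c * (p.1 ^+ 2 + p.2 ^+ 2)).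

Lemma measurable_gauss (c a b : R) : measurable_fun [set: T2] (gauss c a b).
Proof.
apply: measurableT_comp => //; apply: measurable_funB.
  by apply: measurable_funD; apply: measurable_funM => //.
apply: measurable_funM => //; apply: measurable_funD; exact: measurable_funX.
Qed.

Lemma integral_gauss (c a b : R) : 0 < c ->
  (\int[leb2 R]_p (gauss c a b p)%:E = (pi / c * expR ((a ^+ 2 + b ^+ 2) / (4 * c)))%:E)%E.
Proof.
move=> c0; rewrite /leb2 fubini_tonelli1/=; last 2 first.
- by apply/measurable_EFinP; exact: measurable_gauss.
- by move=> p; rewrite lee_fin expR_ge0.
transitivity (\int[leb]_x ((Num.sqrt (pi / c) * expR (b ^+ 2 / (4 * c)))%:E *
   (expR (a * x - c * x ^+ 2))%:E))%E.
  apply: eq_integral => x _; rewrite /fubini_F /gauss /=.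
  under eq_integral => y _.
    have -> : a * x + b * y - c * (x ^+ 2 + y ^+ 2) = (a * x - c * x ^+ 2) + (b * y - c * y ^+ 2) by ring.
    rewrite expRD EFinM; over.
  by rewrite gauss1Z ?expR_ge0// -EFinM mulrC.
rewrite gauss1Z ?mulr_ge0 ?sqrtr_ge0 ?expR_ge0//; congr EFin.
rewrite mulrACA -expr2 sqr_sqrtr ?divr_ge0 ?pi_ge0 ?(ltW c0)// -expRD; congr (_ * expR _).
by field; rewrite gt_eqF.
Qed.

Lemma integrable_gauss (c a b : R) : 0 < c ->
  (leb2 R).-integrable setT (fun p => (gauss c a b p)%:E).
Proof.
move=> c0; apply/integrableP; split.
  by apply/measurable_EFinP; exact: measurable_gauss.
under eq_integral do rewrite abse_EFin ger0_norm ?expR_ge0//.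
by rewrite integral_gauss// ltry.
Qed.

Lemma nm_pt p : nm (pt p) ^+ 2 = p.1 ^+ 2 + p.2 ^+ 2.
Proof. exact: nm_sqr. Qed.

Lemma dominated_Rintegral (h_ : nat -> T2 -> R) (h : T2 -> R) (K c : R) : 0 < c ->
  (forall n, measurable_fun setT (h_ n)) -> measurable_fun setT h ->
  (forall p, h_ ^~ p @ \oo --> h p) ->
  (forall n p, `|h_ n p| <= K * gauss c 0 0 p) ->
  (leb2 R).-integrable setT (fun p => (h p)%:E) /\
  (fun n => Rintegral (leb2 R) setT (h_ n)) @ \oo --> Rintegral (leb2 R) setT h.
Proof.
move=> c0 mh_ mh hh bh.
have [] := @dominated_convergence _ T2 R (leb2 R) setT measurableT
  (fun n p => (h_ n p)%:E) (fun p => (h p)%:E) (fun p => (K * gauss c 0 0 p)%:E).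
- by move=> n; exact/measurable_EFinP.
- exact/measurable_EFinP.
- by apply: aeW => p _; apply: cvg_EFin; [exact: nearW|exact: hh].
- under eq_fun do rewrite EFinM; apply: integrableZl => //; exact: integrable_gauss.
- by apply: aeW => p n _; rewrite lee_fin; exact: bh.
move=> ih _ hc; split=> //.
by rewrite -(fineK (integrable_fin_num measurableT ih)) in hc; exact: fine_cvg hc.
Qed.

(** Gaussian decay with unspecified constants: it survives multiplication by functions of
    exponential growth, which is how powers and parameters enter the integrals. *)
Definition gbound f := exists c K : R, [/\ 0 < c, 0 <= K &
  forall w, nm (f w) <= K * expR (- (c * nm w ^+ 2))].

Lemma dominated_cintegral (f_ : nat -> C -> C) f (K c : R) : 0 < c ->
  (forall n, cmeas (f_ n)) -> (forall w, slim (fun n => f_ n w) (f w)) ->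
  (forall n w, nm (f_ n w) <= K * expR (- (c * nm w ^+ 2))) ->
  cintegrable f /\ slim (fun n => cintegral (f_ n)) (cintegral f).
Proof.
move=> c0 mf_ hf bf; have [mf1 mf2] := cmeas_slim mf_ hf.
have gE p : gauss c 0 0 p = expR (- (c * nm (pt p) ^+ 2)).
  by rewrite /gauss !mul0r !add0r nm_pt.
have [||||i1 h1] := @dominated_Rintegral (fun n p => complex.Re (f_ n (pt p)))
  (fun p => complex.Re (f (pt p))) K c c0.
- by move=> n; have [] := mf_ n.
- by [].
- by move=> p; exact: slim_Re.
- by move=> n p; rewrite gE; apply: le_trans (bf n _); exact: nm_Re.
have [||||i2 h2] := @dominated_Rintegral (fun n p => complex.Im (f_ n (pt p)))
  (fun p => complex.Im (f (pt p))) K c c0.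
- by move=> n; have [] := mf_ n.
- by [].
- by move=> p; exact: slim_Im.
- by move=> n p; rewrite gE; apply: le_trans (bf n _); exact: nm_Im.
by split; [split|exact: slim_ReIm].
Qed.

Lemma gbound_cintegrable f : cmeas f -> gbound f -> cintegrable f.
Proof.
move=> mf [c [K [c0 K0 h]]].
by have [] := @dominated_cintegral (fun=> f) f K c c0 (fun=> mf) (fun w => slim_cst _) (fun=> h).
Qed.

Lemma cintegrableD f g : cintegrable f -> cintegrable g -> cintegrable (fun w => f w + g w).
Proof.
move=> [f1 f2] [g1 g2]; split.
  by under eq_fun do rewrite ReD EFinD; exact: integrableD.
by under eq_fun do rewrite ImD EFinD; exact: integrableD.
Qed.

Lemma cintegralD f g : cintegrable f -> cintegrable g ->
  cintegral (fun w => f w + g w) = cintegral f + cintegral g.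
Proof.
move=> [f1 f2] [g1 g2]; rewrite /cintegral.
have -> : (fun p : T2 => complex.Re (f (p.1 +i* p.2) + g (p.1 +i* p.2))) =
  (fun p => complex.Re (f (p.1 +i* p.2)) + complex.Re (g (p.1 +i* p.2))) by apply/funext => p; exact: ReD.
have -> : (fun p : T2 => complex.Im (f (p.1 +i* p.2) + g (p.1 +i* p.2))) =
  (fun p => complex.Im (f (p.1 +i* p.2)) + complex.Im (g (p.1 +i* p.2))) by apply/funext => p; exact: ImD.
by rewrite !RintegralD.
Qed.

Lemma cintegrableZ c f : cintegrable f -> cintegrable (fun w => c * f w).
Proof.
move=> [f1 f2]; split.
  under eq_fun do rewrite ReM EFinB !EFinM.
  by apply: integrableB => //; apply: integrableZl.
under eq_fun do rewrite ImM EFinD !EFinM.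
by apply: integrableD => //; apply: integrableZl.
Qed.

Lemma cintegralZ c f : cintegrable f -> cintegral (fun w => c * f w) = c * cintegral f.
Proof.
move=> [f1 f2]; rewrite /cintegral.
have i1 (r : R) : (leb2 R).-integrable setT (EFin \o (fun p : T2 => r * complex.Re (f (p.1 +i* p.2)))).
  by rewrite /comp; under eq_fun do rewrite EFinM; exact: integrableZl.
have i2 (r : R) : (leb2 R).-integrable setT (EFin \o (fun p : T2 => r * complex.Im (f (p.1 +i* p.2)))).
  by rewrite /comp; under eq_fun do rewrite EFinM; exact: integrableZl.
have -> : (fun p : T2 => complex.Re (c * f (p.1 +i* p.2))) =
  (fun p => complex.Re c * complex.Re (f (p.1 +i* p.2)) - complex.Im c * complex.Im (f (p.1 +i* p.2))).
  by apply/funext => p; exact: ReM.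
have -> : (fun p : T2 => complex.Im (c * f (p.1 +i* p.2))) =
  (fun p => complex.Re c * complex.Im (f (p.1 +i* p.2)) + complex.Im c * complex.Re (f (p.1 +i* p.2))).
  by apply/funext => p; exact: ImM.
rewrite RintegralB// RintegralD// !RintegralZl//.
by apply/complex_eq; rewrite ?ReM ?ImM.
Qed.

Lemma cintegral_sum (f : nat -> C -> C) n : (forall k, cintegrable (f k)) ->
  cintegral (fun w => \sum_(k < n) f k w) = \sum_(k < n) cintegral (f k) /\
  cintegrable (fun w => \sum_(k < n) f k w).
Proof.
move=> hf; elim: n => [|n [ih1 ih2]].
  have h0 : cintegrable (fun=> 0 : C).
    apply: gbound_cintegrable; first exact: cmeas_cst.
    by exists 1, 0; split=> // w; rewrite nm0 mul0r.
  split; last by under eq_fun do rewrite big_ord0.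
  have -> : (fun w : C => \sum_(k < 0) f k w) = (fun w => 0 * 0) by apply/funext => w; rewrite big_ord0 mul0r.
  by rewrite cintegralZ// mul0r big_ord0.
have -> : (fun w => \sum_(k < n.+1) f k w) = (fun w => \sum_(k < n) f k w + f n w).
  by apply/funext => w; rewrite big_ord_recr.
by split; [rewrite cintegralD// ih1 big_ord_recr|exact: cintegrableD].
Qed.

End plane_integrals.

(** * The reproducing formula *)

Section fock_space.
Variable R : realType.
Local Notation C := R[i].
Implicit Types (z w t u : C) (f g p phi : C -> C) (a b : nat -> C).

Lemma gauss_le (L c t : R) : 0 < c ->
  expR (L * t - c * t ^+ 2) <= expR (L ^+ 2 / (2 * c)) * expR (- (c / 2 * t ^+ 2)).
Proof.
move=> c0; rewrite -expRD ler_expR -subr_ge0.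
have -> : L ^+ 2 / (2 * c) + - (c / 2 * t ^+ 2) - (L * t - c * t ^+ 2) = (L - c * t) ^+ 2 / (2 * c).
  by field; rewrite gt_eqF.
by rewrite divr_ge0 ?sqr_ge0 ?mulr_ge0 ?(ltW c0).
Qed.

Lemma gbound_exp phi (L : R) : gbound phi -> exists c K : R, [/\ 0 < c, 0 <= K &
  forall w, expR (L * nm w) * nm (phi w) <= K * expR (- (c * nm w ^+ 2))].
Proof.
move=> [c [K [c0 K0 h]]]; exists (c / 2), (K * expR (L ^+ 2 / (2 * c))).
split=> [||w]; [by rewrite divr_gt0|by rewrite mulr_ge0 ?expR_ge0|].
apply: le_trans (ler_wpM2l (expR_ge0 _) (h w)) _.
rewrite mulrCA -[leRHS]mulrA ler_wpM2l// -[in leLHS]expRD; exact: gauss_le.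
Qed.

Lemma gboundM_exp f phi (L M : R) : 0 <= M -> gbound phi ->
  (forall w, nm (f w) <= M * expR (L * nm w)) -> gbound (fun w => f w * phi w).
Proof.
move=> M0 hphi hf; have [c [K [c0 K0 h]]] := gbound_exp L hphi.
exists c, (M * K); split=> [//||w]; first by rewrite mulr_ge0.
rewrite nmM; apply: le_trans (ler_wpM2r (nm_ge0 _) (hf w)) _.
by rewrite -!mulrA ler_wpM2l.
Qed.

Lemma exprn_le_expR (t : R) n : 0 <= t -> t ^+ n <= n`!%:R * expR t.
Proof.
move=> t0; rewrite mulrC -ler_pdivrMr ?ltr0n ?fact_gt0//.
apply: le_trans (exp_sum_le_expR n.+1 t0); rewrite /exp_sum big_ord_recr /= lerDr.
by apply: sumr_ge0 => k _; rewrite divr_ge0 ?exprn_ge0.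
Qed.

Lemma gboundX p phi n : (forall w, nm (p w) <= nm w) -> gbound phi ->
  gbound (fun w => p w ^+ n * phi w).
Proof.
move=> hp hphi; apply: (@gboundM_exp _ _ 1 n`!%:R) hphi _ => // w.
rewrite nmX mul1r; apply: le_trans (exprn_le_expR n (nm_ge0 w)).
by apply: lerXn2r; rewrite ?nnegrE ?nm_ge0.
Qed.

Lemma gbound_cexp p phi z : (forall w, nm (p w) <= nm w) -> gbound phi ->
  gbound (fun w => cexp (z * p w) * phi w).
Proof.
move=> hp hphi; apply: (@gboundM_exp _ _ (nm z) 1) hphi _ => // w.
rewrite mul1r nm_cexp ler_expR; apply: le_trans (Re_le_nm _) _.
by rewrite nmM ler_wpM2l ?nm_ge0.
Qed.

(** The exponential series is integrated term by term, its partial sums being dominated by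
    [expR (nm z * nm w)]. A general [p] covers [w], its conjugate and its real and imaginary
    parts. *)
Lemma cintegral_coefs p phi : cmeas p -> (forall w, nm (p w) <= nm w) -> cmeas phi -> gbound phi ->
  coefs (fun z => cintegral (fun w => cexp (z * p w) * phi w))
    (fun n => cintegral (fun w => p w ^+ n * phi w) / n`!%:R).
Proof.
move=> mp hp mphi hphi; apply: coefs_of_series => z.
have ik k : cintegrable (fun w => p w ^+ k * phi w).
  by apply: gbound_cintegrable; [apply: cmeasM => //; exact: cmeasX|exact: gboundX].
have [c [K [c0 K0 h]]] := gbound_exp (nm z) hphi.
have [|||_ hs] := @dominated_cintegral _ (fun n w => exp_sum n (z * p w) * phi w)
  (fun w => cexp (z * p w) * phi w) K c c0.
- move=> n; apply: cmeasM => //; apply: (@cmeas_sum _ (fun k w => (z * p w) ^+ k / k`!%:R)) => k.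
  by apply: cmeasM; [apply: cmeasX; apply: cmeasM => //|]; exact: cmeas_cst.
- by move=> w; apply: slimM; [exact: exp_sum_cexp|exact: slim_cst].
- move=> n w; apply: le_trans (h w); rewrite nmM ler_wpM2r ?nm_ge0//.
  apply: le_trans (exp_sum_nm _ _) _; apply: le_trans (exp_sum_le_expR _ (nm_ge0 _)) _.
  by rewrite ler_expR nmM ler_wpM2l ?nm_ge0.
apply: eq_slim hs => n.
have -> : (fun w => exp_sum n (z * p w) * phi w) =
    (fun w => \sum_(k < n) (z ^+ k / k`!%:R) * (p w ^+ k * phi w)).
  by apply/funext => w; rewrite mulr_suml; apply: eq_bigr => k _; rewrite exprMn; ring.
have [-> _] := @cintegral_sum _ (fun k w => (z ^+ k / k`!%:R) * (p w ^+ k * phi w)) n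
  (fun k => cintegrableZ _ (ik k)).
by apply: eq_bigr => k _; rewrite cintegralZ//; ring.
Qed.

Lemma entire_real_eq f g : entire f -> entire g -> (forall r : R, f r%:C = g r%:C) -> f =1 g.
Proof.
move=> ef eg h z; apply/eqP; rewrite -subr_eq0; apply/eqP.
apply: (@entire_identity _ (fun t => f t - g t) 0 1 _ ltr01 _ z); first exact: entireB.
by move=> t _ _; rewrite add0r h subrr.
Qed.

Section weight.
Variable c : R.
Hypothesis c0 : 0 < c.

Lemma cmeas_conj_id : cmeas (fun w : C => w^*).
Proof. exact: (@cmeas_conj R id (@cmeas_id R)). Qed.

Definition weight w : C := cexp (- (c%:C * `|w| ^+ 2)).

Lemma weightE w : weight w = (expR (- (c * nm w ^+ 2)))%:C.
Proof. by rewrite /weight normsq_nm -cexp_real; congr cexp; transitivity (- (c * nm w ^+ 2)%:C); [by rewrite (rmorphM _ c)|by rewrite rmorphN]. Qed.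

Lemma weight_meas : cmeas weight.
Proof.
apply: cmeas_cexp; under eq_fun do rewrite normsq -mulN1r.
do 2 (apply: cmeasM; first exact: cmeas_cst).
by apply: cmeasM; [exact: cmeas_id|exact: cmeas_conj_id].
Qed.

Lemma weight_bound : gbound weight.
Proof.
by exists c, 1; split=> // w; rewrite weightE nm_real ger0_norm ?expR_ge0// mul1r.
Qed.

Definition cRe w : C := (complex.Re w)%:C.
Definition cIm w : C := (complex.Im w)%:C.

Lemma cmeas_Re : cmeas cRe.
Proof. by split; [exact: measurable_fst|exact: measurable_cst]. Qed.

Lemma cmeas_Im : cmeas cIm.
Proof. by split; [exact: measurable_snd|exact: measurable_cst]. Qed.

Lemma nm_cRe w : nm (cRe w) <= nm w.
Proof. by rewrite nm_real nm_Re. Qed.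

Lemma nm_cIm w : nm (cIm w) <= nm w.
Proof. by rewrite nm_real nm_Im. Qed.

(* Real parameters are covered by Tonelli; the identity theorem, applied to one
   parameter at a time, extends the formula to complex ones. *)
Lemma gauss_complex (z t : C) : cintegral (fun w => cexp (z * cRe w) * (cexp (t * cIm w) * weight w)) =
  (pi / c)%:C * cexp ((4 * c)^-1%:C * (z ^+ 2 + t ^+ 2)).
Proof.
have eR (k : C) : entire (fun z : C => (pi / c)%:C * cexp ((4 * c)^-1%:C * (z ^+ 2 + k))).
  have h := entireM (coefs_entire (coefs_cexp_sqr (4 * c)^-1%:C)) (entire_cst (cexp ((4 * c)^-1%:C * k))).
  apply: eq_entire (entireZ (pi / c)%:C h) => x; congr (_ * _).
  by rewrite -cexpD; congr cexp; ring.
have mexp p x : cmeas p -> cmeas (fun w => cexp (x * p w)).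
  by move=> mp; apply: cmeas_cexp; apply: cmeasM => //; exact: cmeas_cst.
have real2 (x y : R) : cintegral (fun w => cexp (x%:C * cRe w) * (cexp (y%:C * cIm w) * weight w)) =
    (pi / c)%:C * cexp ((4 * c)^-1%:C * (x%:C ^+ 2 + y%:C ^+ 2)).
  have e : (fun w => cexp (x%:C * cRe w) * (cexp (y%:C * cIm w) * weight w)) =
      (fun w => (gauss c x y (complex.Re w, complex.Im w))%:C).
    apply/funext => w; rewrite weightE /cRe /cIm /gauss /= -!rmorphM /= !cexp_real -!rmorphM /= -!expRD.
    by congr (expR _)%:C; rewrite nm_sqr addrA.
  rewrite e /cintegral /=.
  have -> : Rintegral (leb2 R) setT (fun q : measurableTypeR R * measurableTypeR R => gauss c x y (q.1, q.2)) =
      pi / c * expR ((x ^+ 2 + y ^+ 2) / (4 * c)).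
    by rewrite /Rintegral -[RHS]/(fine _%:E) -(integral_gauss x y c0).
  have -> : Rintegral (leb2 R) setT (fun=> 0) = 0 by rewrite /Rintegral integral0.
  rewrite -rmorphXn -rmorphXn /= -rmorphD -rmorphM /= cexp_real -rmorphM.
  by congr (_ * expR _)%:C; rewrite mulrC.
have step1 (x : C) (y : R) : cintegral (fun w => cexp (x * cRe w) * (cexp (y%:C * cIm w) * weight w)) =
    (pi / c)%:C * cexp ((4 * c)^-1%:C * (x ^+ 2 + y%:C ^+ 2)).
  apply: (@entire_real_eq (fun x => cintegral (fun w => cexp (x * cRe w) * (cexp (y%:C * cIm w) * weight w)))
     (fun x => (pi / c)%:C * cexp ((4 * c)^-1%:C * (x ^+ 2 + y%:C ^+ 2)))) => //.
  apply: coefs_entire (cintegral_coefs cmeas_Re nm_cRe _ _).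
    apply: cmeasM weight_meas; exact: mexp cmeas_Im.
  exact: gbound_cexp nm_cIm weight_bound.
apply: (@entire_real_eq (fun t => cintegral (fun w => cexp (z * cRe w) * (cexp (t * cIm w) * weight w)))
     (fun t => (pi / c)%:C * cexp ((4 * c)^-1%:C * (z ^+ 2 + t ^+ 2)))) => //.
  have -> : (fun t => cintegral (fun w => cexp (z * cRe w) * (cexp (t * cIm w) * weight w))) =
    (fun t => cintegral (fun w => cexp (t * cIm w) * (cexp (z * cRe w) * weight w))).
    by apply/funext => x; congr cintegral; apply/funext => w; rewrite mulrCA.
  apply: coefs_entire (cintegral_coefs cmeas_Im nm_cIm _ _).
    apply: cmeasM weight_meas; exact: mexp cmeas_Re.
  exact: gbound_cexp nm_cRe weight_bound.
apply: eq_entire (eR (z ^+ 2)) => x; by rewrite addrC.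
Qed.

(** Since $uw+z\bar w=(z+u)\,\mathrm{Re}\,w+i(u-z)\,\mathrm{Im}\,w$, this is [gauss_complex], with
    exponent $((z+u)^2-(u-z)^2)/(4c)=zu/c$. *)
Lemma fock_exp (z u : C) : cintegral (fun w => cexp (u * w) * (cexp (z * w^*) * weight w)) =
  (pi / c)%:C * cexp (z / c%:C * u).
Proof.
have := gauss_complex (z + u) ('i * (u - z)).
have -> : (4 * c)^-1%:C * ((z + u) ^+ 2 + ('i * (u - z)) ^+ 2) = z / c%:C * u.
  have cC : c%:C != 0 by rewrite -nm_eq0 nm_real normr_eq0 gt_eqF.
  rewrite exprMn sqr_i fmorphV rmorphM rmorph_nat /=.
  by field; rewrite cC.
move=> <-; congr cintegral; apply/funext => w.
rewrite (mulrA (cexp (u * w))) (mulrA (cexp ((z + u) * cRe w))); congr (_ * _).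
rewrite -!cexpD; congr cexp.
have e1 : w = cRe w + 'i * cIm w by rewrite mul_i; case: w => x y; apply/complex_eq; rewrite /= ?addr0 ?add0r.
have e2 : Num.conj w = cRe w - 'i * cIm w by rewrite mul_i; case: w {e1} => x y; apply/complex_eq; rewrite /= ?oppr0 ?addr0 ?add0r.
by rewrite {1}e1 e2; ring.
Qed.

Lemma nm_conj_le w : nm w^* <= nm w.
Proof. by rewrite nm_conj. Qed.

Lemma cmeas_cexp_conj z : cmeas (fun w => cexp (z * w^*)).
Proof. by apply: cmeas_cexp; apply: cmeasM; [exact: cmeas_cst|exact: cmeas_conj_id]. Qed.

(** Coefficient of [u ^ n] in [fock_exp]. *)
Lemma fock_monomial n z : cintegral (fun w => w ^+ n * (cexp (z * w^*) * weight w)) =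
  (pi / c)%:C * (z / c%:C) ^+ n.
Proof.
have h := cintegral_coefs (@cmeas_id R) (fun w => lexx (nm w))
  (cmeasM (cmeas_cexp_conj z) weight_meas) (gbound_cexp z nm_conj_le weight_bound).
have h' := coefsZ (pi / c)%:C (coefs_cexp (z / c%:C)).
have := congr1 (fun a => a n) (coefs_uniq h (eq_coefs (fun u => esym (fock_exp z u)) h')).
move=> /= e; apply: (mulIf (invr_neq0 (fact_neq0 R n))); rewrite e; ring.
Qed.

(* Cauchy's estimate on the circle of radius [6/5 |w| + 1] dominates the Taylor
   polynomials of a function of order [exp (c/2 |w|^2)] by a function that is
   still integrable against the weight, since [(6/5)^2 / 2 < 1]. *)
Lemma fock_reproducing f (B : R) : 0 <= B -> entire f ->
  (forall w, nm (f w) <= B * expR (c / 2 * nm w ^+ 2)) ->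
  forall z, cintegral (fun w => cexp (z * w^*) * (f w * weight w)) = (pi / c)%:C * f (z / c%:C).
Proof.
move=> B0 ef hf z; have [a ha] := entire_coefs ef.
(* With [r = 6/5 |w| + 1], [c / 2 * r ^ 2] is [0.72 c |w| ^ 2 + 1.2 c |w| + c / 2]: hence [L], the
   remaining [0.28 c], and the factor [expR (c / 2)]. The 6 sums the geometric series of ratio
   5/6. *)
pose L := nm z + 12 / 10 * c.
have hb n w : nm ((\sum_(k < n) a k * w ^+ k) * (cexp (z * w^*) * weight w)) <=
    6 * B * expR (c / 2) * expR (L * nm w - 28 / 100 * c * nm w ^+ 2).
  pose r := 12 / 10 * nm w + 1; have t0 := nm_ge0 w.
  have r0 : 0 < r by rewrite /r; lra.
  have hr u : nm u <= r -> nm (f u) <= B * expR (c / 2 * r ^+ 2).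
    move=> ur; apply: le_trans (hf u) _; rewrite ler_wpM2l// ler_expR ler_pM2l ?divr_gt0//.
    by apply: lerXn2r; rewrite ?nnegrE ?nm_ge0// ltW.
  have h1 : nm (\sum_(k < n) a k * w ^+ k) <= 6 * B * expR (c / 2 * r ^+ 2).
    apply: le_trans (nm_sum _ _ _) _.
    apply: (@le_trans _ _ (\sum_(k < n) B * expR (c / 2 * r ^+ 2) * (5 / 6) ^+ k)).
      apply: ler_sum => k _; rewrite nmM nmX.
      have hk := coefs_le k ha r0 hr.
      apply: (@le_trans _ _ (nm (a k) * (r ^+ k * (5 / 6) ^+ k))).
        rewrite ler_wpM2l ?nm_ge0// -exprMn; apply: lerXn2r; rewrite ?nnegrE ?nm_ge0// /r; lra.
      by rewrite mulrA ler_wpM2r ?exprn_ge0// divr_ge0.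
    rewrite -mulr_sumr mulrC -(mulrA 6) ler_wpM2r ?mulr_ge0 ?expR_ge0//.
    have -> : \sum_(k < n) (5 / 6 : R) ^+ k = 6 - 6 * (5 / 6) ^+ n.
      elim: (n) => [|m ih]; first by rewrite big_ord0 expr0; lra.
      by rewrite big_ord_recr /= ih exprS; lra.
    have : (0 : R) <= (5 / 6) ^+ n by rewrite exprn_ge0// divr_ge0.
    lra.
  have h2 : nm (cexp (z * w^*)) <= expR (nm z * nm w).
    by rewrite nm_cexp ler_expR; apply: le_trans (Re_le_nm _) _; rewrite nmM nm_conj.
  rewrite (nmM _ (_ * _)) (nmM (cexp _) (weight w)) weightE nm_real ger0_norm ?expR_ge0//.
  apply: (@le_trans _ _ (6 * B * expR (c / 2 * r ^+ 2) * (expR (nm z * nm w) * expR (- (c * nm w ^+ 2))))).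
    by apply: ler_pM; rewrite ?mulr_ge0 ?nm_ge0 ?expR_ge0// ler_wpM2r ?expR_ge0.
  have -> : L * nm w - 28 / 100 * c * nm w ^+ 2 =
      - (c / 2) + (c / 2 * r ^+ 2 + (nm z * nm w - c * nm w ^+ 2)) by rewrite /r /L; field.
  by rewrite -!(mulrA (6 * B)) -!expRD addNKr.
have c28 : 0 < 28 / 100 * c by rewrite mulr_gt0// divr_gt0.
have [|||_ hs] := @dominated_cintegral _
  (fun n w => (\sum_(k < n) a k * w ^+ k) * (cexp (z * w^*) * weight w))
  (fun w => f w * (cexp (z * w^*) * weight w))
  (6 * B * expR (c / 2) * expR (L ^+ 2 / (2 * (28 / 100 * c)))) (28 / 100 * c / 2) (divr_gt0 c28 (ltr0Sn R 1)).
- move=> n; apply: cmeasM; last exact: cmeasM (cmeas_cexp_conj z) weight_meas.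
  apply: (@cmeas_sum _ (fun k w => a k * w ^+ k)) => k.
  by apply: cmeasM; [exact: cmeas_cst|apply: cmeasX; exact: cmeas_id].
- by move=> w; apply: slimM; [exact: coefs_series|exact: slim_cst].
- move=> n w; apply: le_trans (hb n w) _; rewrite -(mulrA (6 * B * expR (c / 2))) ler_wpM2l ?mulr_ge0 ?expR_ge0//.
  exact: gauss_le.
have ik k : cintegrable (fun w => w ^+ k * (cexp (z * w^*) * weight w)).
  apply: gbound_cintegrable.
    by apply: cmeasM (cmeasM (cmeas_cexp_conj z) weight_meas); apply: cmeasX; exact: cmeas_id.
  by apply: (gboundX (p := id)) => //; exact: gbound_cexp nm_conj_le weight_bound.
have h1 : slim (fun n => (pi / c)%:C * \sum_(k < n) a k * (z / c%:C) ^+ k)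
    (cintegral (fun w => f w * (cexp (z * w^*) * weight w))).
  apply: eq_slim hs => n.
  have -> : (fun w => (\sum_(k < n) a k * w ^+ k) * (cexp (z * w^*) * weight w)) =
      (fun w => \sum_(k < n) a k * (w ^+ k * (cexp (z * w^*) * weight w))).
    by apply/funext => w; rewrite mulr_suml; apply: eq_bigr => k _; rewrite -[LHS]mulrA.
  have [-> _] := @cintegral_sum _ (fun k w => a k * (w ^+ k * (cexp (z * w^*) * weight w))) n
    (fun k => cintegrableZ _ (ik k)).
  rewrite mulr_sumr; apply: eq_bigr => k _.
  by rewrite cintegralZ// fock_monomial mulrCA.
have -> : (fun w => cexp (z * w^*) * (f w * weight w)) = (fun w => f w * (cexp (z * w^*) * weight w)).
  by apply/funext => w; rewrite mulrCA.
exact: slim_uniq h1 (slimM (slim_cst _) (coefs_series _ ha)).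
Qed.

Lemma fock_bound f (B : R) : 0 <= B -> 
  (forall w, nm (f w) <= B * expR (c / 2 * nm w ^+ 2)) -> gbound (fun w => f w * weight w).
Proof.
move=> B0 hf; exists (c / 2), B; split=> [||w]; [by rewrite divr_gt0|by []|].
rewrite nmM weightE nm_real ger0_norm ?expR_ge0//.
apply: le_trans (ler_wpM2r (expR_ge0 _) (hf w)) _; rewrite -(mulrA B) ler_wpM2l// -expRD ler_expR.
lra.
Qed.

Lemma fock_moment f a (B : R) n : 0 <= B -> coefs f a ->
  (forall w, nm (f w) <= B * expR (c / 2 * nm w ^+ 2)) ->
  cintegrable (fun w => w^* ^+ n * (f w * weight w)) /\
  cintegral (fun w => w^* ^+ n * (f w * weight w)) = (pi / c)%:C * n`!%:R * a n / c%:C ^+ n.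
Proof.
move=> B0 ha hf; have ef := coefs_entire ha.
have mf := cmeasM (cmeas_entire ef) weight_meas.
have mc := cmeas_conj_id.
split.
  apply: gbound_cintegrable; first by apply: cmeasM => //; exact: cmeasX.
  exact: gboundX nm_conj_le (fock_bound B0 hf).
have h := cintegral_coefs mc nm_conj_le mf (fock_bound B0 hf).
have hc : coefs (fun z => (pi / c)%:C * f (z / c%:C)) (fun n => (pi / c)%:C * (a n / c%:C ^+ n)).
  apply: coefsZ; apply: coefs_of_series => z; apply: eq_slim (coefs_series (z / c%:C) ha) => m.
  by apply: eq_bigr => k _; rewrite expr_div_n; ring.
have := congr1 (fun a => a n) (coefs_uniq h (eq_coefs (fun z => esym (fock_reproducing B0 ef hf z)) hc)).
move=> /= e; apply: (mulIf (invr_neq0 (fact_neq0 R n))); rewrite e.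
have key (x y t s : C) : s != 0 -> x * (y * t) = x * s * y * t * s^-1 by move=> s0; field.
exact: key (fact_neq0 R n).
Qed.

End weight.
End fock_space.

(** * Growth of the gauged sigma function and the integral formulas *)

Section sigma_integrals.
Variable R : realType.
Local Notation C := R[i].
Variables w1 w2 : C.
Hypothesis S1 : 0 < cell_area w1 w2.
Local Notation G := (lattice w1 w2).
Local Notation S := (cell_area w1 w2).
Local Notation nu := (wnu w1 w2).
Local Notation mu := (wmu w1 w2).
Local Notation S0 := (S_neq0 S1).
Local Notation F := (gsigma w1 w2).
Local Notation c := (pi / S).
Implicit Types (z g t b w : C).

(** For a [b] at which the two-variable series is not identically zero, [exp (nu * z * b)] times the
    series is a nonzero multiple of [gsigma], which thus inherits the multiplier [nu]. *)
Lemma law_gsigma : law w1 w2 nu F.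
Proof.
have [kap hk] := poincare_factor S1; have [b [z0 h0]] := poincare_neq0 S1.
have k0 : kap * (F b^*)^* != 0.
  apply: contraNneq h0 => k0; rewrite hk.
  have -> : kap * cexp (- (nu * z0 * b)) * F z0 * (F b^*)^* = kap * (F b^*)^* * (cexp (- (nu * z0 * b)) * F z0).
    by rewrite !conjE; ring.
  by rewrite k0 mul0r.
move=> w hw z; have := poincare_law S1 b hw z.
have e t : cexp (nu * t * b) * poincare w1 w2 b t = kap * (F b^*)^* * F t.
  rewrite hk cexpN; have := cexp_neq0 (nu * t * b).
  by move: (cexp _) (F t) (Num.conj (F b^*)) => x y s x0; field.
rewrite !e => h; apply: (mulfI k0); rewrite h.
by move: (cexp _) (F z) (kap * _) => x y s; ring.
Qed.

(** The multiplier being [nu], the modulus times [exp (- c / 2 * |z| ^ 2)] is periodic, so a bound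
    on one cell suffices. This is the growth required by [fock_reproducing]. *)
Lemma gsigma_bound : exists B : R, 0 <= B /\ forall z, nm (F z) <= B * expR (c / 2 * nm z ^+ 2).
Proof.
have hper : gper w1 w2 c F by apply: law_gper => //; exact: law_gsigma.
have [B [B0 hB]] := entire_bounded (nm w1 + nm w2) (entire_gsigma S1).
exists B; split=> // z.
set x := complex.Im (z^* * w2) / S; set y := complex.Im (w1^* * z) / S.
pose s := (x - (Num.floor x)%:~R)%:C * w1 + (y - (Num.floor y)%:~R)%:C * w2.
have hz : z = s + ((Num.floor x)%:~R * w1 + (Num.floor y)%:~R * w2).
  rewrite [LHS](basis_coords z S0) -/x -/y /s !rmorphB /= !rmorph_int.
  by ring.
have fl (r : R) : `|r - (Num.floor r)%:~R| <= 1.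
  have /andP[h3 h4] := floor_itv r; rewrite intrD in h4.
  by rewrite ger0_norm; lra.
have hs : nm s <= nm w1 + nm w2.
  by apply: le_trans (nmD _ _) _; rewrite !nmM !nm_real; apply: lerD; rewrite ler_piMl ?nm_ge0.
have Gz : G ((Num.floor x)%:~R * w1 + (Num.floor y)%:~R * w2) by exists (Num.floor x), (Num.floor y).
have e := hper _ Gz s; rewrite -hz in e.
have : nm (F z) * expR (- (c / 2 * nm z ^+ 2)) <= B.
  rewrite e; apply: le_trans (hB s hs); rewrite ler_piMr ?nm_ge0// -expR0 ler_expR oppr_le0.
  by rewrite mulr_ge0 ?exprn_ge0 ?nm_ge0// divr_ge0 ?(ltW (nu_gt0 S1)).
by rewrite expRN ler_pdivrMr ?expR_gt0.
Qed.

Lemma weight_wnu w : weight c w = cexp (- (nu * `|w| ^+ 2)).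
Proof. by []. Qed.

Lemma sigma_integral z :
  let kernel w := cexp (nu * z * w^* - mu / 2 * w ^+ 2 - nu * `|w| ^+ 2) * wsigma G w in
  cintegrable kernel /\
  wsigma G z = nu / (pi : R)%:C * cexp (mu / 2 * z ^+ 2) * cintegral kernel.
Proof.
move=> kernel; have [B [B0 hB]] := gsigma_bound; have c0 := nu_gt0 S1.
have nC : nu != 0 by rewrite -nm_eq0 nm_real normr_eq0 gt_eqF.
have p0 : (pi : R)%:C != 0 by rewrite -nm_eq0 nm_real normr_eq0 gt_eqF ?pi_gt0.
have -> : kernel = fun w => cexp (nu * z * w^*) * (F w * weight c w).
  apply/funext => w; rewrite /kernel /gsigma weight_wnu !cexpD.
  by move: (wsigma G w) (cexp (- (nu * _))) (cexp (- _)) (cexp _) => x y s t; ring.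
split.
  apply: gbound_cintegrable.
    apply: cmeasM (cmeas_cexp_conj _) _; apply: cmeasM (weight_meas _).
    exact: cmeas_entire (entire_gsigma S1).
  exact: gbound_cexp (@nm_conj_le R) (fock_bound c0 B0 hB).
rewrite (fock_reproducing c0 B0 (entire_gsigma S1) hB).
have -> : nu * z / c%:C = z by rewrite mulrAC divff ?mul1r.
have -> : (pi / c)%:C = (pi : R)%:C / nu by rewrite rmorphM fmorphV.
rewrite /gsigma cexpN; have := cexp_neq0 (mu / 2 * z ^+ 2).
have key (n p e s : C) : n != 0 -> p != 0 -> e != 0 -> s = n / p * e * (p / n * (e^-1 * s)).
  by move=> n0 p0' e0; field; rewrite p0' n0 e0.
exact: key.
Qed.

(** By [hgPE] the integrand is a combination of moments of [gsigma] against odd powers of [conj w],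
    which [fock_moment] evaluates. The resulting sum is the Cauchy product for sigma as
    [exp (mu / 2 * z ^ 2)] times [gsigma]. *)
Lemma wcoef_integral r :
  let moment w := w^* * hgP w1 w2 r w * cexp (- (mu / 2 * w ^+ 2) - nu * `|w| ^+ 2) * wsigma G w in
  cintegrable moment /\
  wcoef G r = nu ^+ 2 / (pi : R)%:C * ((r.*2.+1)`!%:R / (2 ^+ r * r`!%:R)) * cintegral moment.
Proof.
move=> moment; have [B [B0 hB]] := gsigma_bound; have c0 := nu_gt0 S1.
have nC : nu != 0 by rewrite -nm_eq0 nm_real normr_eq0 gt_eqF.
have p0 : (pi : R)%:C != 0 by rewrite -nm_eq0 nm_real normr_eq0 gt_eqF ?pi_gt0.
have [a ha] := entire_coefs (entire_gsigma S1).
pose e k := (mu / 2) ^+ (r - k) / (r - k)`!%:R.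
pose q k := 2 ^+ r * r`!%:R * e k * (nu ^+ k.*2 / (k.*2.+1)`!%:R).
have mE : moment = fun w => \sum_(k < r.+1) q k * (w^* ^+ k.*2.+1 * (F w * weight c w)).
  apply/funext => w; rewrite /moment /gsigma weight_wnu hgPE cexpD.
  set s := (X in w^* * (_ * X)); set E := cexp (- (mu / 2 * w ^+ 2)); set V := cexp (- (nu * _)).
  transitivity (2 ^+ r * r`!%:R * (E * wsigma G w * V) * w^* * s).
    by move: s E V (wsigma G w) (Num.conj w) (2 ^+ r) (r`!%:R : C) => x1 x2 x3 x4 x5 x6 x7; ring.
  rewrite mulr_sumr; apply: eq_bigr => k _; rewrite /q /e exprS (exprMn k.*2).
  move: E V (wsigma G w) (Num.conj w) ((Num.conj w) ^+ _) (2 ^+ r) (r`!%:R : C) => x1 x2 x3 x4 x5 x6 x7.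
  by ring.
have im k := fock_moment c0 k.*2.+1 B0 ha hB.
have [h1 h2] := @cintegral_sum _ (fun k w => q k * (w^* ^+ k.*2.+1 * (F w * weight c w))) r.+1
  (fun k => cintegrableZ _ (im k).1).
rewrite mE; split; first exact: h2.
have ew z : cexp (mu / 2 * z ^+ 2) * F z = wsigma G z.
  by rewrite /gsigma cexpN mulVKf// cexp_neq0.
rewrite h1 (wcoefE S1 r (eq_coefs ew (coefsM (coefs_cexp_sqr (mu / 2)) ha))).
rewrite big_ord_recr /= odd_double /= mul0r addr0.
under eq_bigr => i _ do rewrite (fun_if (fun x => x * _)) mul0r.
rewrite (@sum_even _ r (fun i => (mu / 2) ^+ i./2 / (i./2)`!%:R * a (r.*2.+1 - i)%N)).
rewrite !mulr_sumr (reindex_inj rev_ord_inj) /=; apply: eq_bigr => k _.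
rewrite subSS doubleK cintegralZ; last exact: (im k).1.
have kr : (k <= r)%N by rewrite -ltnS.
have -> : (r.*2.+1 - (r - k).*2)%N = k.*2.+1 by lia.
rewrite (im k).2 /q /e (exprS c%:C).
have -> : (pi / c)%:C = (pi : R)%:C / nu by rewrite rmorphM fmorphV.
rewrite -[c%:C]/nu.
have key (p f t v n x y m d : C) : p != 0 -> f != 0 -> t != 0 -> v != 0 -> n != 0 -> m != 0 ->
  d * (x * y) = n ^+ 2 / p * (d / (t * v)) * (t * v * x * (m / f) * (p / n * f * y / (n * m))).
  by move=> p0' f0 t0 v0 n0 m0; field; rewrite p0' f0 t0 v0 n0 m0.
by apply: key; rewrite ?fact_neq0 ?expf_neq0.
Qed.

End sigma_integrals.

Theorem theorem1p2 (R : realType) (w1 w2 : R[i])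
    (area_gt0 : 0 < cell_area w1 w2) :
  let G := lattice w1 w2 in
  let nu := wnu w1 w2 in
  let mu := wmu w1 w2 in
  let H := hgseries w1 w2 in
  let thetaterm (z g : R[i]) :=
    wchi G g * g * cexp (- (nu / 2 * `|g| ^+ 2) + nu * z * g^*) in
  let kernel (z w : R[i]) :=
    cexp (nu * z * w^* - mu / 2 * w ^+ 2 - nu * `|w| ^+ 2) * wsigma G w in
  let moment (r : nat) (w : R[i]) :=
    w^* * hgP w1 w2 r w * cexp (- (mu / 2 * w ^+ 2) - nu * `|w| ^+ 2) *
      wsigma G w in
  [/\ H 0%N != 0,
    (forall z : R[i],
       set_summable G (thetaterm z) /\
       wsigma G z = (H 0%N)^-1 * cexp (mu / 2 * z ^+ 2) *
                    set_sum G (thetaterm z)),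
    (forall z : R[i],
       cintegrable (kernel z) /\
       wsigma G z = nu / (pi : R)%:C * cexp (mu / 2 * z ^+ 2) *
                    cintegral (kernel z)),
    (forall r : nat,
       set_summable G (hgterm w1 w2 r) /\
       wcoef G r = H r / H 0%N)
    & (forall r : nat,
       cintegrable (moment r) /\
       wcoef G r = nu ^+ 2 / (pi : R)%:C *
                   ((r.*2.+1)`!%:R / (2 ^+ r * r`!%:R)) *
                   cintegral (moment r)) ].
Proof.
move=> G nu mu H theta kernel moment.
have [H0 hs] := hgseries_theta area_gt0.
have [a ha] := entire_coefs (entire_wsigma (S_neq0 area_gt0)).
split=> [//|z|z|r|r].
- split; first exact: has_sum_summable (hs z).
  rewrite (set_sumE (hs z)) /gsigma cexpN -/mu -/G -/H.
  have := cexp_neq0 (mu / 2 * z ^+ 2); rewrite -/(H 0%N) in H0; move: (cexp _) (wsigma G z) (H 0%N) H0 => x y k k0 x0.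
  by field; rewrite x0 k0.
- exact: sigma_integral.
- by have [h e] := hgtermP area_gt0 r ha; rewrite /H e; split=> //; rewrite mulrC mulKf.
- exact: wcoef_integral.
Qed.
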